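(* There exists an absolute constant $C>0$ such that the following holds. Fix $\epsilon>0$, even $n$, $s\ge2$, $T\ge1$. Consider a stochastic block model $\mathcal M(\bm{\mathcal A})\in\mathcal M_n(\epsilon)$ with two equally-sized groups and affinity matrix $\bm\Omega=\frac{a-b}{n}\bm I_2+\frac bn\bm1_2\bm1_2^\top$, where $a>b$, and suppose $\rho=(a+b)/(2n)$ is known. Let $\bm A$ be drawn from this model, $\bm L=\bm D^{-1/2}\bm A\bm D^{-1/2}$, and let $\bm x_0^{(1)},\dots,\bm x_0^{(s)}$ be i.i.d. zero-mean sub-Gaussian vectors in $\mathbb R^n$, independent of $\bm A$, with covariance $\bm I$ and satisfying the bounded moments assumption; let $\bm x_T^{(i)}=\bm L^T\bm x_0^{(i)}$ and let $\widehat{\bm\Sigma}(T)$ be their sample covariance. Define the estimator $$\hat a=\big(\lambda_2(\widehat{\bm\Sigma}(T))\big)^{1/2T}\rho n+\rho n,$$ where $\lambda_2(\cdot)$ denotes the second largest eigenvalue in magnitude. Then, with probability at least $1-5s^{-1}-2\epsilon$, the relative error $\eta=|\hat a-a|/a$ satisfies $$\eta\le\frac{(2TM+B(T))^{1/2T}}{\lambda_2(\bm{\mathcal L})+1},$$ where $M=3\sqrt{3\ln(4n/\epsilon)/\delta_{\min}}$ and $B(T)=C\big(1+\sum_{i=2}^k\min\{1,|\mu_i|+M\}^{2T}+(n-k)M^{2T}\big)\sqrt{\ln s/s}$ with $k=2$ and $\mu_i$ the eigenvalues of $\bm{\mathcal L}$ ordered by decreasing magnitude.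
   Context: SBM: node $i$ has group label $g_i$, $\bm G\in\{0,1\}^{n\times k}$ with $G_{ij}=1$ iff $g_i=j$, and independent $A_{ij}=A_{ji}\sim\mathrm{Bernoulli}(\Omega_{g_ig_j})$ for $i\le j$ (self-loops allowed). $\bm D=\operatorname{diag}(\bm A\bm 1)$. $\bm{\mathcal A}=\bm G\bm\Omega\bm G^\top$, $\delta_i=(\bm{\mathcal A}\bm1)_i$, $\delta_{\min}=\min_i\delta_i$, $\bm{\mathcal L}=\operatorname{diag}(\bm{\mathcal A}\bm1)^{-1/2}\bm{\mathcal A}\operatorname{diag}(\bm{\mathcal A}\bm1)^{-1/2}$. $\mathcal M_n(\epsilon)$: SBMs on $n$ nodes with $\delta_{\min}>27\ln(4n/\epsilon)$. Sample covariance $\widehat{\bm\Sigma}(T)=\frac1s\sum_i[\bm x_T^{(i)}-\bar{\bm x}_T][\bm x_T^{(i)}-\bar{\bm x}_T]^\top$ with $\bar{\bm x}_T$ the sample mean. Bounded moments assumption: for an absolute constant $c_0>0$, $\mathbb E[(\bm u^\top\bm x_0^{(i)})^2]\ge c_0\|\bm u^\top\bm x_0^{(i)}\|_{\Psi_2}^2$ for all $\bm u$, with $\|x\|_{\Psi_2}=\sup_{p\ge1}p^{-1/2}(\mathbb E|x|^p)^{1/p}$. *)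

(* Defs.v *)
From HB Require Import structures.
From mathcomp Require Import all_boot all_order all_algebra.
From mathcomp Require Import all_classical all_reals all_analysis.
Set Implicit Arguments. Unset Strict Implicit. Unset Printing Implicit Defensive.
Import Order.TTheory GRing.Theory Num.Theory.
Local Open Scope classical_set_scope.
Local Open Scope ring_scope.

Section Defs.
Variable R : realType.

(* minimum of a list (0 for the empty list) *)
Definition seqmin (l : seq R) : R := \big[Num.min/head 0 l]_(x <- l) x.

Definition memb_mx n k (g : 'I_n -> 'I_k) : 'M[R]_(n, k) :=
  \matrix_(i, j) (g i == j)%:R.

Definition exp_adj n k (g : 'I_n -> 'I_k) (Om : 'M[R]_k) : 'M[R]_n :=
  memb_mx g *m Om *m (memb_mx g)^T.

Definition exp_deg n k (g : 'I_n -> 'I_k) (Om : 'M[R]_k) (i : 'I_n) : R :=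
  \sum_j exp_adj g Om i j.

Definition delta_min n k (g : 'I_n -> 'I_k) (Om : 'M[R]_k) : R :=
  seqmin [seq exp_deg g Om i | i <- enum 'I_n].

(* D^{-1/2} M D^{-1/2}, with D the diagonal of row sums of M
   (degree 0 gives the entry 0, MathComp's convention 0^-1 = 0) *)
Definition sym_normalize n (M : 'M[R]_n) : 'M[R]_n :=
  let Dm := diag_mx (\row_i (Num.sqrt (\sum_j M i j))^-1) in
  Dm *m M *m Dm.

Definition exp_lap n k (g : 'I_n -> 'I_k) (Om : 'M[R]_k) : 'M[R]_n :=
  sym_normalize (exp_adj g Om).

Definition in_Mn_eps n k (g : 'I_n -> 'I_k) (Om : 'M[R]_k) (eps : R) : Prop :=
  delta_min g Om > 27 * ln (4 * n%:R / eps).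

Definition eigs_by_magnitude n (M : 'M[R]_n) (e : seq R) : Prop :=
  [/\ size e = n,
      char_poly M = \prod_(x <- e) ('X - x%:P)
    & sorted (fun x y => `|y| <= `|x|) e].

Definition sample_mean n s (x : 'I_s -> 'cV[R]_n) : 'cV[R]_n :=
  s%:R^-1 *: \sum_i x i.

Definition sample_cov n s (x : 'I_s -> 'cV[R]_n) : 'M[R]_n :=
  s%:R^-1 *: \sum_i ((x i - sample_mean x) *m (x i - sample_mean x)^T).

Local Open Scope ereal_scope.
Context d (Omega : measurableType d) (P : probability Omega R).

Definition psi2_norm (X : Omega -> R) : \bar R :=
  ereal_sup [set ((p `^ (-(2^-1)))%R)%:E *
                 (\int[P]_w ((`|X w| `^ p)%R)%:E) `^ (p^-1)
            | p in [set p : R | (1 <= p)%R]].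

(* mutual independence of blocks of real random variables:
   the blocks (X k)_{k in S}, each block being the family (X k j)_j,
   are independent (product rule for the joint events defined by
   Borel conditions on every coordinate) *)
Definition indep_blocks (K J : finType) (S : {pred K})
  (X : K -> J -> Omega -> R) : Prop :=
  forall B : K -> J -> set R, (forall k j, measurable (B k j)) ->
    P (\bigcap_(k in [set k | k \in S]) \bigcap_(j in [set: J]) (X k j @^-1` B k j))
    = \prod_(k in S) P (\bigcap_(j in [set: J]) (X k j @^-1` B k j)).

Definition same_law (J : finType) (X Y : J -> Omega -> R) : Prop :=
  forall B : J -> set R, (forall j, measurable (B j)) ->
    P (\bigcap_(j in [set: J]) (X j @^-1` B j))
    = P (\bigcap_(j in [set: J]) (Y j @^-1` B j)).

End Defs.

(* Main.v *)
(** Two independent sources of error are controlled.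

    Spectral error.  Put [X = A - E A], a sum over edges [e] of
    [(A_e - p_e) M_e] with [M_e ^ 2] diagonal.  Resampling one edge at a time
    and the trace inequality
    [tr((B-C)(B^q-C^q)) <= q/2 tr((B-C)^2 (B^(q-1)+C^(q-1)))] for odd [q]
    bound [E tr X^(2k)] by [E sum_i (k (D_i + delta))^k], with no matrix
    exponential.  For [k] close to [l = ln(4n/eps)] Markov's inequality gives
    [|X| <= (9/5) h delta], where [h = sqrt(3 l / delta)]; a Chernoff bound
    gives [|D_i - delta| <= h delta]; together [|L - Lc| <= 3 h = M].

    Sampling error.  Condition on [A], which takes finitely many values.  Each
    entry of the empirical covariance of [L^T x_0], once divided by
    [sigma_j sigma_k], has sub-exponential moment generating function; by
    Jensen's inequality with the weights [sigma_j^2 sigma_k^2 / (tr L^(2T))^2],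
    which sum to one, the Frobenius error is at most a constant times
    [tr(L^(2T)) sqrt(ln s / s)], without dependence on the dimension.  The same
    argument handles the sample mean.

    Both errors move the second eigenvalue by at most the operator norm of the
    perturbation, and [|x^(1/2T) - y^(1/2T)| <= |x - y|^(1/2T)]. *)
Require Import Defs.
From HB Require Import structures.
From mathcomp Require Import all_boot all_order all_algebra.
From mathcomp Require Import all_classical all_reals all_analysis.
From mathcomp Require Import perm complex measurable_realfun ring lra.
Import Order.TTheory GRing.Theory Num.Theory.
Local Open Scope classical_set_scope.
Local Open Scope ring_scope.

Set Implicit Arguments. Unset Strict Implicit. Unset Printing Implicit Defensive.

(** * Real spectral theorem *)

(** Since [M] has a prescribed constant, the spectral part is an exact budget: replacing random
    degrees by [delta] costs [6/5 h], which leaves [9/5 h] for the distance of [A] from its mean.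
    The hypothesis [27 l < delta] gives [h <= 1/3], so that quadratic bounds on [expR] and on square
    roots apply.

    The trace inequality lowers the power by two at the price of a degree matrix. Young's inequality
    returns the result to the original moment with a coefficient below one, so the recursion closes
    in one step, without induction on the power.

    The term [2 T M] comes from telescoping the difference of two powers of matrices of norm at most
    1. The bracket in [B(T)] bounds [tr L^(2T)]: the expected Laplacian has rank two, hence all but
    two eigenvalues of [L] are at most [M].

    Conditioning is done without conditional expectations: an integral against the indicator of
    [A = al] factors over independent blocks, and these events are disjoint. *)

Section RealSpectral.
Context {R : realType}.

(** Hermitian theory supplies only a real eigenvalue: an entry of the complex spectral diagonal is
    real, hence a root of the characteristic polynomial over [R], and that root yields a real
    eigenvector. *)
Lemma sym_eigenvector n (S : 'M[R]_n.+1) : S^T = S ->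
  exists (l : R) (v : 'cV[R]_n.+1), v != 0 /\ S *m v = l *: v.
Proof.
move=> Ssym; pose SC := map_mx (real_complex R) S.
have SCh : SC \is hermsymmx.
  apply/is_hermitianmxP; rewrite expr0 scale1r; apply/matrixP => i j.
  rewrite !mxE; rewrite -[in LHS]Ssym mxE; apply/esym/CrealP.
  by apply/complex_realP; exists (S j i).
have /hermitian_normalmx /orthomx_spectralP SCE := SCh.
have dr := hermitian_spectral_diag_real SCh.
set P := spectralmx SC in SCE; set sp := spectral_diag SC in SCE dr.
have Pu : P \in unitmx by exact: spectral_unit.
have [l lE] : exists l : R, sp 0 0 = real_complex R l.
  by have /mxOverP/(_ 0 0)/complex_realP := dr.
have : eigenvalue SC (sp 0 0).
  apply/eigenvalueP; exists (row 0 P).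
    rewrite {1}SCE -row_mul !mulmxA mulmxV // mul1mx row_mul.
    by rewrite row_diag_mx -scalemxAl -rowE.
  rewrite rowE mulmx_free_eq0 ?row_free_unit //.
  by apply/eqP => /matrixP/(_ 0 0); rewrite !mxE !eqxx => /eqP; rewrite oner_eq0.
rewrite lE eigenvalue_root_char /SC -map_char_poly fmorph_root -eigenvalue_root_char.
move=> /eigenvalueP[v vS v0]; exists l, v^T; split; first by rewrite trmx_eq0.
by rewrite -[S]Ssym -trmx_mul vS linearZ.
Qed.

Definition dotc n (u v : 'cV[R]_n) : R := (u^T *m v) 0 0.
Definition nsq n (u : 'cV[R]_n) : R := dotc u u.

Lemma dotcE n (u v : 'cV[R]_n) : dotc u v = \sum_i u i 0 * v i 0.
Proof. by rewrite /dotc mxE; apply: eq_bigr => i _; rewrite mxE. Qed.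

Lemma dotcC n (u v : 'cV[R]_n) : dotc u v = dotc v u.
Proof. by rewrite !dotcE; apply: eq_bigr => i _; rewrite mulrC. Qed.

Lemma dotcDl n (u v w : 'cV[R]_n) : dotc (u + v) w = dotc u w + dotc v w.
Proof. by rewrite /dotc linearD mulmxDl mxE. Qed.
Lemma dotcZl n a (u w : 'cV[R]_n) : dotc (a *: u) w = a * dotc u w.
Proof. by rewrite /dotc linearZ -scalemxAl mxE. Qed.
Lemma dotcBl n (u v w : 'cV[R]_n) : dotc (u - v) w = dotc u w - dotc v w.
Proof. by rewrite -scaleN1r dotcDl dotcZl mulN1r. Qed.
Lemma dotcDr n (u v w : 'cV[R]_n) : dotc w (u + v) = dotc w u + dotc w v.
Proof. by rewrite dotcC dotcDl !(dotcC w). Qed.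
Lemma dotcZr n a (u w : 'cV[R]_n) : dotc w (a *: u) = a * dotc w u.
Proof. by rewrite dotcC dotcZl (dotcC w). Qed.
Lemma dotcBr n (u v w : 'cV[R]_n) : dotc w (u - v) = dotc w u - dotc w v.
Proof. by rewrite dotcC dotcBl !(dotcC w). Qed.
Lemma dotc0r n (w : 'cV[R]_n) : dotc w 0 = 0.
Proof. by rewrite /dotc mulmx0 mxE. Qed.
Lemma dotc0l n (w : 'cV[R]_n) : dotc 0 w = 0.
Proof. by rewrite dotcC dotc0r. Qed.

Lemma dotc_mull m n (S : 'M[R]_(m, n)) u v : dotc (S *m u) v = dotc u (S^T *m v).
Proof. by rewrite /dotc trmx_mul mulmxA. Qed.

Lemma nsq_ge0 n (u : 'cV[R]_n) : 0 <= nsq u.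
Proof. by rewrite /nsq dotcE; apply: sumr_ge0 => i _; rewrite -expr2 sqr_ge0. Qed.
Hint Resolve nsq_ge0 : core.

Lemma nsq_eq0 n (u : 'cV[R]_n) : (nsq u == 0) = (u == 0).
Proof.
apply/idP/eqP => [|->]; last by rewrite /nsq dotc0l.
rewrite /nsq dotcE psumr_eq0 => [|i _]; last by rewrite -expr2 sqr_ge0.
move=> /allP u0; apply/matrixP => i j; rewrite ord1 mxE.
by have /(_ (mem_index_enum _)) := u0 i; rewrite -expr2 sqrf_eq0 => /eqP.
Qed.

Lemma nsq_gt0 n (u : 'cV[R]_n) : (0 < nsq u) = (u != 0).
Proof. by rewrite lt0r nsq_eq0 nsq_ge0 andbT. Qed.

Lemma nsqZ n a (u : 'cV[R]_n) : nsq (a *: u) = a ^+ 2 * nsq u.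
Proof. by rewrite /nsq dotcZl dotcZr mulrA. Qed.

Lemma outer_mul n (u v w : 'cV[R]_n) : u *m v^T *m w = dotc v w *: u.
Proof.
by rewrite -mulmxA [v^T *m w]mx11_scalar mul_mx_scalar.
Qed.

(** Householder reflection along [e - u], which exchanges the two unit vectors; when [u = e] this
    direction vanishes and the identity serves. *)
Lemma reflection_to_unit n (u : 'cV[R]_(1 + n)) : nsq u = 1 ->
  exists H : 'M[R]_(1 + n),
    [/\ H^T = H, H *m H = 1%:M & H *m delta_mx 0 0 = u].
Proof.
move=> u1; set e : 'cV[R]_(1 + n) := delta_mx 0 0.
have e1 : nsq e = 1.
  rewrite /nsq dotcE big_ord_recl big1 => [|i _]; first by rewrite mxE !mulr1 addr0.
  by rewrite !mxE mulr0.
have [->|ue] := eqVneq u e.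
  by exists 1%:M; rewrite trmx1 mulmx1 mul1mx.
pose w := e - u; pose c := 2 / nsq w.
have w0 : nsq w != 0 by rewrite nsq_eq0 subr_eq0 eq_sym.
have cw : c * nsq w = 2 by rewrite /c mulfVK.
pose W := w *m w^T.
have WW : W *m W = nsq w *: W by rewrite /W mulmxA outer_mul -scalemxAl.
exists (1%:M - c *: W); split.
- by rewrite raddfB /= trmx1 linearZ /= trmx_mul trmxK.
- rewrite mulmxBl mul1mx mulmxBr mulmx1 -scalemxAl -scalemxAr WW !scalerA.
  have -> : c * c * nsq w = c + c by rewrite -mulrA cw; ring.
  by rewrite scalerDl opprB addrK subrK.
rewrite mulmxBl mul1mx -scalemxAl outer_mul scalerA.
have -> : c * dotc w e = 1.
  have we : nsq w = 2 * dotc w e.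
    by rewrite /nsq {1}/w !(dotcBl, dotcBr) -!/(nsq _) u1 e1 (dotcC u e) /w; ring.
  by apply: (@mulfI _ 2) => //; rewrite mulrCA -we cw mulr1.
by rewrite scale1r /w opprB addrC subrK.
Qed.

(** Deflation: after conjugation by a reflection carrying the first basis vector to an eigenvector,
    the first column is a multiple of that basis vector, symmetry clears the first row, and
    induction diagonalizes the remaining block. *)
Lemma sym_spectral n (S : 'M[R]_n) : S^T = S ->
  exists (Q : 'M[R]_n) (d : 'rV[R]_n),
    Q *m Q^T = 1%:M /\ S = Q^T *m diag_mx d *m Q.
Proof.
elim: n S => [|n IHn] S Ssym.
  by exists 1%:M, 0; split; apply/matrixP => - [].
have [l [v [v0 Sv]]] := sym_eigenvector Ssym.
pose u := (Num.sqrt (nsq v))^-1 *: v.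
have u1 : nsq u = 1.
  by rewrite nsqZ exprVn sqr_sqrtr // mulVf // nsq_eq0.
have Su : S *m u = l *: u by rewrite -scalemxAr Sv !scalerA mulrC.
have [H [Hs HH He]] := reflection_to_unit u1.
have [S1 S1def] : exists S1 : 'M[R]_(1 + n), S1 = H *m S *m H by eexists.
have S1s : S1^T = S1 by rewrite S1def !trmx_mul Hs Ssym mulmxA.
have S1e : S1 *m delta_mx 0 0 = l *: delta_mx 0 0 :> 'cV[R]_(1 + n).
  by rewrite S1def -!mulmxA He Su -scalemxAr -He mulmxA HH mul1mx.
have drs : (drsubmx S1)^T = drsubmx S1 by rewrite trmx_drsub S1s.
have [Q1 [d1 [Q1o E1]]] := IHn _ drs.
have S1E : S1 = block_mx l%:M 0 0 (drsubmx S1).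
  rewrite -[LHS]submxK.
  have c0 i : S1 i 0 = l * (i == 0)%:R.
    have /matrixP/(_ i 0) := S1e.
    by rewrite -colE !mxE andbT.
  have l0 : lshift n (0 : 'I_1) = 0 by exact: val_inj.
  have dl : dlsubmx S1 = 0.
    by apply/matrixP => i j; rewrite ord1 !mxE l0 c0 mulr0.
  have ul : ulsubmx S1 = l%:M.
    by apply/matrixP => i j; rewrite !ord1 !mxE l0 c0 eqxx mulr1.
  have ur : ursubmx S1 = 0 by rewrite -S1s -trmx_dlsub dl trmx0.
  by rewrite dl ul ur.
pose B : 'M[R]_(1 + n) := block_mx 1%:M 0 0 Q1.
pose D : 'rV[R]_(1 + n) := row_mx l%:M d1.
have BB : B *m B^T = 1%:M.
  rewrite /B tr_block_mx mulmx_block !trmx0 trmx1.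
  by rewrite !(mulmx0, mul0mx, mul1mx, addr0, add0r) Q1o -scalar_mx_block.
have BD : B^T *m diag_mx D *m B = S1.
  rewrite /B /D diag_mx_row tr_block_mx !trmx0 trmx1 !mulmx_block.
  rewrite !(mulmx0, mul0mx, mul1mx, mulmx1, addr0, add0r) -E1 [RHS]S1E.
  by congr block_mx; apply/matrixP => i j; rewrite !ord1 !mxE eqxx.
exists (B *m H), D; split.
  by rewrite trmx_mul Hs mulmxA -[_ *m H *m H]mulmxA HH mulmx1.
have -> : S = H *m S1 *m H by rewrite S1def !mulmxA HH mul1mx -mulmxA HH mulmx1.
by rewrite trmx_mul Hs -BD !mulmxA.
Qed.

End RealSpectral.

(** * Characteristic polynomials and ordered eigenvalue lists *)

Section CharPoly.
Context {R : realType}.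

Lemma char_poly_conj n (Q S : 'M[R]_n) : Q *m Q^T = 1%:M ->
  char_poly (Q^T *m S *m Q) = char_poly S.
Proof.
move=> QQ; have QQ' := mulmx1C QQ.
rewrite /char_poly /char_poly_mx.
have -> : 'X%:M - map_mx polyC (Q^T *m S *m Q) =
    map_mx polyC Q^T *m ('X%:M - map_mx polyC S) *m map_mx polyC Q.
  rewrite mulmxBr mulmxBl !map_mxM; congr (_ - _).
  by rewrite mul_mx_scalar -scalemxAl -map_mxM QQ' map_mx1 scalemx1.
rewrite !det_mulmx mulrC mulrA -det_mulmx -map_mxM QQ map_mx1 det1 mul1r //.
Qed.

Lemma char_poly_diag n (d : 'rV[R]_n) :
  char_poly (diag_mx d) = \prod_(x <- codom (d 0)) ('X - x%:P).
Proof.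
rewrite char_poly_trig; last exact: diag_mx_is_trig.
rewrite codomE big_map big_enum /=.
by apply: eq_bigr => i _; rewrite mxE eqxx.
Qed.

Lemma spectralE n (Q : 'M[R]_n) d i j :
  (Q^T *m diag_mx d *m Q) i j = \sum_k d 0 k * Q k i * Q k j.
Proof.
rewrite mxE; apply: eq_bigr => k _; rewrite mul_mx_diag !mxE; ring.
Qed.

(** Unique factorization makes the given list a permutation of the spectral diagonal; permuting the
    rows of [Q] in the same way puts the eigenvectors in the order of [e]. *)
Lemma eigs_spectral n (S : 'M[R]_n) (e : seq R) : S^T = S ->
  eigs_by_magnitude S e ->
  exists Q : 'M[R]_n, Q *m Q^T = 1%:M /\
    S = Q^T *m diag_mx (\row_i e`_i) *m Q.
Proof.
move=> Ssym [es ep _].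
have [Q [d [QQ SE]]] := sym_spectral Ssym.
have := ep; rewrite {1}SE char_poly_conj // char_poly_diag.
move=> /esym/prod_XsubC_eq; rewrite codomE => pe.
have es' : size e == n by rewrite es.
have /tuple_permP[s sE] : perm_eq (Tuple es') [tuple d 0 i | i < n] by [].
have eE (i : 'I_n) : e`_i = d 0 (s i).
  have /(congr1 (fun t => nth 0 t i)) := sE.
  by rewrite /= (nth_map i) ?size_enum_ord // nth_ord_enum tnth_mktuple.
exists (row_perm s Q); split.
  apply/matrixP => i j; have /matrixP/(_ (s i) (s j)) := QQ.
  rewrite !mxE (inj_eq perm_inj) => <-.
  by apply: eq_bigr => k _; rewrite !mxE.
apply/matrixP => i j; rewrite [in LHS]SE !spectralE (reindex_inj (@perm_inj _ s)) /=.
by apply: eq_bigr => k _; rewrite !mxE eE.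
Qed.
End CharPoly.

(** * Operator norm and min-max bounds *)

Section OperatorBounds.
Context {R : realType}.
Implicit Types (n : nat).

Definition vnorm n (v : 'cV[R]_n) : R := Num.sqrt (nsq v).

Lemma vnorm_ge0 n (v : 'cV[R]_n) : 0 <= vnorm v.
Proof. exact: sqrtr_ge0. Qed.
Hint Resolve vnorm_ge0 : core.

Lemma vnorm_sqr n (v : 'cV[R]_n) : vnorm v ^+ 2 = nsq v.
Proof. by rewrite sqr_sqrtr // nsq_ge0. Qed.

Lemma vnorm_gt0 n (v : 'cV[R]_n) : (0 < vnorm v) = (v != 0).
Proof. by rewrite sqrtr_gt0 nsq_gt0. Qed.

Lemma vnorm_le n m (u : 'cV[R]_n) (v : 'cV[R]_m) : (vnorm u <= vnorm v) = (nsq u <= nsq v).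
Proof. by rewrite ler_sqrt // nsq_ge0. Qed.

Lemma vnormZ n a (v : 'cV[R]_n) : vnorm (a *: v) = `|a| * vnorm v.
Proof. by rewrite /vnorm nsqZ sqrtrM ?sqr_ge0 // sqrtr_sqr. Qed.

Lemma dotc_le n (u v : 'cV[R]_n) : dotc u v <= vnorm u * vnorm v.
Proof.
have [->|v0] := eqVneq v 0; first by rewrite dotc0r mulr_ge0.
have v_gt0 : 0 < nsq v by rewrite nsq_gt0.
suff H : dotc u v ^+ 2 <= (vnorm u * vnorm v) ^+ 2.
  have [h|h] := leP (dotc u v) 0; first by rewrite (le_trans h) ?mulr_ge0.
  by rewrite -(@ler_pXn2r _ 2) // nnegrE ?mulr_ge0 // ltW.
rewrite exprMn !vnorm_sqr.
have := nsq_ge0 (nsq v *: u - dotc u v *: v).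
rewrite /nsq !(dotcBl, dotcBr, dotcZl, dotcZr) (dotcC v u) -!/(nsq _) => H.
have : 0 <= nsq v * (nsq u * nsq v - dotc u v ^+ 2) by lra.
by rewrite pmulr_rge0 // subr_ge0.
Qed.

Lemma vnormD n (u v : 'cV[R]_n) : vnorm (u + v) <= vnorm u + vnorm v.
Proof.
rewrite -(@ler_pXn2r _ 2) ?nnegrE ?addr_ge0 // sqrrD !vnorm_sqr.
rewrite /nsq !(dotcDl, dotcDr) (dotcC v u) -!/(nsq _).
have := dotc_le u v; lra.
Qed.

Lemma vnormN n (v : 'cV[R]_n) : vnorm (- v) = vnorm v.
Proof. by rewrite -scaleN1r vnormZ normrN1 mul1r. Qed.

Lemma vnormB_ge n (u v : 'cV[R]_n) : vnorm u - vnorm v <= vnorm (u - v).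
Proof. by rewrite lerBlDr (le_trans _ (vnormD _ _)) // subrK. Qed.

Definition opbound m n (S : 'M[R]_(m, n)) c := forall v, vnorm (S *m v) <= c * vnorm v.

Lemma opbound_le m n (S : 'M[R]_(m, n)) c c' : c <= c' -> opbound S c -> opbound S c'.
Proof. by move=> cc h v; rewrite (le_trans (h v)) // ler_wpM2r. Qed.

Lemma opboundD m n (S S' : 'M[R]_(m, n)) c c' :
  opbound S c -> opbound S' c' -> opbound (S + S') (c + c').
Proof.
by move=> h h' v; rewrite mulmxDl (le_trans (vnormD _ _)) // mulrDl lerD.
Qed.

Lemma opboundN m n (S : 'M[R]_(m, n)) c : opbound S c -> opbound (- S) c.
Proof. by move=> h v; rewrite mulNmx vnormN. Qed.

Lemma opboundB m n (S S' : 'M[R]_(m, n)) c c' :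
  opbound S c -> opbound S' c' -> opbound (S - S') (c + c').
Proof. by move=> h /opboundN; exact: opboundD. Qed.

Lemma opboundZ m n (S : 'M[R]_(m, n)) a c : opbound S c -> opbound (a *: S) (`|a| * c).
Proof. by move=> h v; rewrite -scalemxAl vnormZ -mulrA ler_wpM2l. Qed.

Lemma opboundM m n k (S : 'M[R]_(m, n)) (S' : 'M[R]_(n, k)) c c' : 0 <= c ->
  opbound S c -> opbound S' c' -> opbound (S *m S') (c * c').
Proof.
move=> c0 h h' v; rewrite -mulmxA (le_trans (h _)) // -mulrA ler_wpM2l //.
Qed.

Lemma opboundX n (S : 'M[R]_n) k : opbound S 1 -> opbound (S ^+ k) 1.
Proof.
move=> h; elim: k => [|k IH] v; first by rewrite expr0 mul1mx mul1r.
by rewrite exprS -[1]mul1r; apply: opboundM.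
Qed.

(** Telescoping, one factor at a time; at exponent [2T] this is the source of [2 T M]. *)
Lemma opboundXB n (A B : 'M[R]_n) k c : opbound A 1 -> opbound B 1 ->
  opbound (A - B) c -> opbound (A ^+ k - B ^+ k) (k%:R * c).
Proof.
move=> hA hB hAB; elim: k => [|k IH].
  by move=> v; rewrite !expr0 subrr mul0mx !mul0r -(scale0r (0 : 'cV[R]_n)) vnormZ normr0 mul0r.
have -> : A ^+ k.+1 - B ^+ k.+1 = A *m (A ^+ k - B ^+ k) + (A - B) *m B ^+ k.
  by rewrite mulmxBr mulmxBl !exprS addrA subrK.
rewrite -addn1 natrD mulrDl mul1r; apply: opboundD.
  by rewrite -[k%:R * c]mul1r; apply: opboundM.
move=> v; rewrite -mulmxA (le_trans (hAB _)) //.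
have c0 := hAB.
have [->|v0] := eqVneq v 0.
  by rewrite !mulmx0.
have hv := opboundX k hB v; rewrite mul1r in hv.
apply: ler_wpM2l => //.
(* Nonnegativity of [c] is read off from the bound at the nonzero vector [v]. *)
have : 0 <= c * vnorm v by rewrite (le_trans _ (hAB v)).
by rewrite pmulr_lge0 // vnorm_gt0.
Qed.

Lemma nsq_orth n (Q : 'M[R]_n) v : Q *m Q^T = 1%:M -> nsq (Q *m v) = nsq v.
Proof. by move=> /mulmx1C QQ; rewrite /nsq dotc_mull mulmxA QQ mul1mx. Qed.

Lemma spectralX n (Q : 'M[R]_n) d k : Q *m Q^T = 1%:M ->
  (Q^T *m diag_mx d *m Q) ^+ k = Q^T *m diag_mx (\row_i d 0 i ^+ k) *m Q.
Proof.
move=> QQ; elim: k => [|k IH].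
  rewrite expr0 (_ : diag_mx _ = 1%:M) ?mulmx1 ?(mulmx1C QQ) //.
  by apply/matrixP => i j; rewrite !mxE expr0.
rewrite exprS IH -[LHS]/(_ *m _) !mulmxA -[_ *m Q *m Q^T]mulmxA QQ mulmx1.
congr (_ *m _); rewrite -mulmxA; congr (_ *m _).
by rewrite mulmx_diag; congr diag_mx; apply/matrixP => i j; rewrite ord1 !mxE exprS.
Qed.

Lemma spectral_trace n (Q : 'M[R]_n) d : Q *m Q^T = 1%:M ->
  \tr (Q^T *m diag_mx d *m Q) = \sum_i d 0 i.
Proof. by move=> QQ; rewrite mxtrace_mulC mulmxA QQ mul1mx mxtrace_diag. Qed.

Lemma spectral_nsq n (Q : 'M[R]_n) d v : Q *m Q^T = 1%:M ->
  nsq ((Q^T *m diag_mx d *m Q) *m v) = \sum_i d 0 i ^+ 2 * (Q *m v) i 0 ^+ 2.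
Proof.
move=> QQ; rewrite -!mulmxA nsq_orth ?trmxK; last exact: mulmx1C.
rewrite /nsq dotcE; apply: eq_bigr => i _; rewrite mul_diag_mx mxE; ring.
Qed.

Lemma ker_exists k m (G : 'M[R]_(k, m)) : (k < m)%N ->
  exists2 y : 'cV[R]_m, y != 0 & G *m y = 0.
Proof.
move=> km; have : kermx G^T != 0.
  rewrite kermx_eq0 /row_free mxrank_tr; apply: contraTneq km => <-.
  by rewrite -leqNgt rank_leq_row.
move=> /rowV0Pn[w /sub_kermxP wG w0]; exists w^T; first by rewrite trmx_eq0.
by apply: trmx_inj; rewrite trmx_mul trmxK wG trmx0.
Qed.

Lemma sorted_abs n (M : 'M[R]_n) e i j : eigs_by_magnitude M e -> (i <= j < n)%N ->
  `|e`_j| <= `|e`_i|.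
Proof.
move=> [es _ so] /andP[ij jn].
have tr : transitive (fun x y : R => `|y| <= `|x|) by move=> x y z h1 h2; exact: le_trans h1.
apply: (sorted_leq_nth tr _ 0 so) => //; rewrite ?inE ?es //.
exact: leq_ltn_trans jn.
Qed.

(** Upper half of Courant-Fischer: [k] linear constraints cannot exclude every nonzero vector in the
    span of the first [k+1] eigenvectors, and on that span [S] stretches by at least the magnitude
    of eigenvalue number [k], counted from 0. *)
Lemma eig_le n (S : 'M[R]_n) e k (F : 'M[R]_(k, n)) c : S^T = S ->
  eigs_by_magnitude S e -> (k < n)%N ->
  (forall v, F *m v = 0 -> vnorm (S *m v) <= c * vnorm v) -> `|e`_k| <= c.
Proof.
move=> Ssym he kn hF; have [Q [QQ SE]] := eigs_spectral Ssym he.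
pose Pk : 'M[R]_(n, k.+1) := \matrix_(i, j) (i == j :> nat)%:R.
have [y y0 Fy] := ker_exists (F *m Q^T *m Pk) (ltnSn k).
pose v := Q^T *m (Pk *m y).
have Fv : F *m v = 0 by rewrite /v !mulmxA in Fy *.
have Qv : Q *m v = Pk *m y by rewrite /v mulmxA QQ mul1mx.
have Py (i : 'I_n) : (k < i)%N -> (Pk *m y) i 0 = 0.
  move=> ki; rewrite mxE big1 // => j _; rewrite mxE; case: eqP => [E|]; rewrite ?mul0r //.
  by have := ltn_ord j; rewrite -E ltnS leqNgt ki.
have v0 : v != 0.
  apply: contraNneq y0 => v0; apply/eqP/matrixP => j z; rewrite ord1 [RHS]mxE.
  have jn : (j < n)%N by exact: leq_trans (ltn_ord j) _.
  have := congr1 (fun w : 'cV[R]_n => w (Ordinal jn) 0) Qv.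
  rewrite v0 mulmx0 !mxE (bigD1 j) //= mxE eqxx mul1r big1 ?addr0 // => a aj.
  by rewrite mxE /= eq_sym (inj_eq val_inj) (negPf aj) mul0r.
have := hF v Fv; rewrite -(@ler_pXn2r _ 2) ?nnegrE //; last first.
  exact: le_trans (hF v Fv).
rewrite exprMn !vnorm_sqr => h.
have : `|e`_k| ^+ 2 * nsq v <= c ^+ 2 * nsq v.
  apply: le_trans h; rewrite SE spectral_nsq // -(nsq_orth v QQ) /nsq dotcE mulr_sumr.
  apply: ler_sum => i _; rewrite [(\row_i _) _ _]mxE -expr2.
  have [ki|ik] := ltnP k i; first by rewrite Qv Py // expr0n !mulr0.
  rewrite ler_wpM2r ?sqr_ge0 // real_normK ?num_real // -(real_normK (num_real e`_k)).
  rewrite -(real_normK (num_real e`_i)) ler_sqr ?nnegrE //.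
  by apply: (sorted_abs he); rewrite ik.
rewrite ler_pM2r ?nsq_gt0 // ler_sqr ?nnegrE //.
have : 0 <= c * vnorm v by exact: le_trans (hF v Fv).
by rewrite pmulr_lge0 // vnorm_gt0.
Qed.

(** Lower half for the second eigenvalue: a two-dimensional subspace contains a nonzero vector
    orthogonal to the leading eigenvector, and there [S] stretches by at most the second
    magnitude. *)
Lemma eig1_ge n (S : 'M[R]_n) e (U : 'M[R]_(n, 2)) c : S^T = S ->
  eigs_by_magnitude S e -> (1 < n)%N ->
  (forall y : 'cV[R]_2, U *m y = 0 -> y = 0) ->
  (forall y : 'cV[R]_2, c * vnorm (U *m y) <= vnorm (S *m (U *m y))) -> c <= `|e`_1|.
Proof.
move=> Ssym he n1 Uinj hU; have [Q [QQ SE]] := eigs_spectral Ssym he.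
pose i0 : 'I_n := Ordinal (ltnW n1).
have [y y0 Gy] := ker_exists (row i0 (Q *m U)) (ltnSn 1).
pose v := U *m y.
have v0 : v != 0 by apply: contraNneq y0 => /Uinj ->.
have Qv0 : (Q *m v) i0 0 = 0.
  by have /matrixP/(_ 0 0) := Gy; rewrite -row_mul -mulmxA !mxE.
have [c0|c0] := leP c 0; first exact: le_trans c0 _.
have := hU y; rewrite -/v -(@ler_pXn2r _ 2) ?nnegrE ?mulr_ge0 ?(ltW c0) //.
rewrite exprMn !vnorm_sqr => h.
rewrite -ler_sqr ?nnegrE ?(ltW c0) // -(ler_pM2r (_ : 0 < nsq v)) ?nsq_gt0 //.
apply: le_trans h _; rewrite SE spectral_nsq // -(nsq_orth v QQ) /nsq dotcE mulr_sumr.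
apply: ler_sum => i _; rewrite [(\row_i _) _ _]mxE -expr2.
have [->|ii] := eqVneq i i0; first by rewrite Qv0 expr0n !mulr0.
rewrite ler_wpM2r ?sqr_ge0 // -(real_normK (num_real e`_i)).
rewrite ler_sqr ?nnegrE //; apply: (sorted_abs he).
by rewrite ltn_ord andbT lt0n; apply: contraNneq ii => E; apply/eqP/val_inj.
Qed.

End OperatorBounds.

(** * Trace inequalities *)

Section TraceInequalities.
Context {R : realType}.
Implicit Types (n : nat).

Lemma trace_spectral2 n (Q P : 'M[R]_n) d e : 
  \tr ((Q^T *m diag_mx d *m Q) *m (P^T *m diag_mx e *m P)) =
  \sum_i \sum_j (Q *m P^T) i j ^+ 2 * (d 0 i * e 0 j).
Proof.
rewrite -!mulmxA mxtrace_mulC -!mulmxA -[P *m Q^T]trmxK trmx_mul trmxK.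
rewrite (mulmxA Q P^T); set Z := Q *m P^T; rewrite /mxtrace; apply: eq_bigr => i _.
rewrite mul_diag_mx mxE [X in _ * X]mxE mulr_sumr; apply: eq_bigr => j _.
by rewrite mul_diag_mx !mxE; ring.
Qed.

Lemma subX_mul_ge0 (x y : R) (i j : nat) : 0 <= x -> 0 <= y ->
  0 <= (x ^+ i - y ^+ i) * (x ^+ j - y ^+ j).
Proof.
move=> x0 y0; have [xy|/ltW yx] := leP x y.
  by apply: mulr_le0; rewrite subr_le0; apply: lerXn2r; rewrite ?nnegrE.
by apply: mulr_ge0; rewrite subr_ge0; apply: lerXn2r; rewrite ?nnegrE.
Qed.

(** The terms of index [i] and [r - i] are paired; [(x^i - y^i)(x^(r-i) - y^(r-i)) >= 0] bounds each
    pair by [x^r + y^r]. For even [r], passing to absolute values leaves [a^r] and [b^r]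
    unchanged. *)
Lemma sum_mixed_powers_le (a b : R) (r : nat) : ~~ odd r ->
  \sum_(i < r.+1) a ^+ (r - i) * b ^+ i <= r.+1%:R / 2 * (a ^+ r + b ^+ r).
Proof.
move=> ro.
have re (x : R) : x ^+ r = `|x| ^+ r.
  have := odd_double_half r; rewrite (negPf ro) add0n => <-.
  by rewrite -mul2n !exprM real_normK ?num_real.
have pair (i : 'I_r.+1) : a ^+ (r - i) * b ^+ i + a ^+ i * b ^+ (r - i) <= a ^+ r + b ^+ r.
  set x := `|a|; set y := `|b|.
  have x0 : 0 <= x by exact: normr_ge0.
  have y0 : 0 <= y by exact: normr_ge0.
  have le1 : a ^+ (r - i) * b ^+ i <= x ^+ (r - i) * y ^+ i.
    by rewrite (le_trans (ler_norm _)) // normrM !normrX.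
  have le2 : a ^+ i * b ^+ (r - i) <= x ^+ i * y ^+ (r - i).
    by rewrite (le_trans (ler_norm _)) // normrM !normrX.
  have ir : (i <= r)%N by rewrite -ltnS.
  have xr : a ^+ r = x ^+ i * x ^+ (r - i) by rewrite -exprD subnKC.
  have yr : b ^+ r = y ^+ i * y ^+ (r - i) by rewrite -exprD subnKC.
  rewrite xr yr.
  have := subX_mul_ge0 i (r - i) x0 y0.
  by move: le1 le2; nra.
have rv : \sum_(i < r.+1) a ^+ (r - i) * b ^+ i = \sum_(i < r.+1) a ^+ i * b ^+ (r - i).
  rewrite (reindex_inj rev_ord_inj) /=; apply: eq_bigr => i _.
  by rewrite subSS subKn // -ltnS.
rewrite mulrAC ler_pdivlMr // mulr_natr mulr2n {2}rv -big_split /=.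
rewrite mulr_natl -[X in _ *+ X](card_ord r.+1) -sumr_const; exact: ler_sum.
Qed.

Lemma mean_value_scalar (a b : R) (r : nat) : ~~ odd r ->
  (a - b) * (a ^+ r.+1 - b ^+ r.+1) <=
  r.+1%:R / 2 * ((a - b) ^+ 2 * (a ^+ r + b ^+ r)).
Proof.
move=> ro; rewrite subrXX mulrA -expr2 mulrCA ler_wpM2l ?sqr_ge0 //.
exact: sum_mixed_powers_le.
Qed.

(* In eigenbases of [A] and [B] every [tr (A^k B^l)] is
   [sum_ij w_ij a_i^k b_j^l] with the same weights [w_ij >= 0], so the scalar
   inequality can be summed. *)
Lemma mean_value_trace n (A B : 'M[R]_n) (r : nat) : A^T = A -> B^T = B -> ~~ odd r ->
  \tr ((A - B) *m (A ^+ r.+1 - B ^+ r.+1)) <=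
  r.+1%:R / 2 * \tr ((A - B) *m (A - B) *m (A ^+ r + B ^+ r)).
Proof.
move=> As Bs ro.
have [Q [d [QQ AE]]] := sym_spectral As; have [P [e [PP BE]]] := sym_spectral Bs.
pose w i j := (Q *m P^T) i j ^+ 2.
have T k l : \tr (A ^+ k *m B ^+ l) = \sum_i \sum_j w i j * (d 0 i ^+ k * e 0 j ^+ l).
  rewrite AE BE !spectralX // trace_spectral2; apply: eq_bigr => i _.
  by apply: eq_bigr => j _; rewrite /w !mxE.
have TA k : \tr (A ^+ k) = \tr (A ^+ k *m B ^+ 0) by rewrite expr0 mulmx1.
have TB k : \tr (B ^+ k) = \tr (A ^+ 0 *m B ^+ k) by rewrite expr0 mul1mx.
have -> : \tr ((A - B) *m (A ^+ r.+1 - B ^+ r.+1)) =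
   \tr (A ^+ r.+2 *m B ^+ 0) - \tr (A ^+ 1 *m B ^+ r.+1)
   - \tr (A ^+ r.+1 *m B ^+ 1) + \tr (A ^+ 0 *m B ^+ r.+2).
  rewrite -TA -TB mulmxBl !mulmxBr !linearB /= !expr1 [\tr (B *m A ^+ _)]mxtrace_mulC.
  rewrite (exprS A r.+1) (exprS B r.+1) -![in RHS]/(_ *m _); ring.
have -> : \tr ((A - B) *m (A - B) *m (A ^+ r + B ^+ r)) =
   \tr (A ^+ r.+2 *m B ^+ 0) - 2 * \tr (A ^+ r.+1 *m B ^+ 1) + \tr (A ^+ r *m B ^+ 2)
   + \tr (A ^+ 2 *m B ^+ r) - 2 * \tr (A ^+ 1 *m B ^+ r.+1) + \tr (A ^+ 0 *m B ^+ r.+2).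
  have H1 : \tr (A *m B *m A ^+ r) = \tr (A ^+ r.+1 *m B).
    by rewrite mxtrace_mulC mulmxA -[A ^+ r *m A]/(_ * _) -exprSr.
  have H2 : \tr (B *m A *m A ^+ r) = \tr (A ^+ r.+1 *m B).
    by rewrite -mulmxA mxtrace_mulC -[A *m A ^+ r]/(_ * _) -exprS.
  have H3 : \tr (B *m B *m A ^+ r) = \tr (A ^+ r *m B ^+ 2) by rewrite mxtrace_mulC expr2.
  have H4 : \tr (A *m B *m B ^+ r) = \tr (A *m B ^+ r.+1) by rewrite -mulmxA exprS.
  have H5 : \tr (B *m A *m B ^+ r) = \tr (A *m B ^+ r.+1).
    by rewrite -mulmxA mxtrace_mulC -mulmxA -[B ^+ r *m B]/(_ * _) -exprSr.
  have H6 : \tr (A *m A *m A ^+ r) = \tr (A ^+ r.+2) by rewrite -mulmxA !exprS.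
  have H7 : \tr (B *m B *m B ^+ r) = \tr (B ^+ r.+2) by rewrite -mulmxA !exprS.
  have H8 : \tr (A *m A *m B ^+ r) = \tr (A ^+ 2 *m B ^+ r) by rewrite expr2.
  have H9 C : \tr ((A - B) *m (A - B) *m C) = \tr (A *m A *m C) - \tr (A *m B *m C)
      - \tr (B *m A *m C) + \tr (B *m B *m C).
    by rewrite mulmxBl !mulmxBr !mulmxBl !linearB /=; ring.
  rewrite mulmxDr linearD /= !H9 H1 H2 H3 H4 H5 H6 H7 H8 -TA -TB !expr1; ring.
rewrite !T !mulr_sumr -!sumrN -!big_split /= mulr_sumr; apply: ler_sum => i _.
rewrite !mulr_sumr -!sumrN -!big_split /= mulr_sumr; apply: ler_sum => j _.
have := mean_value_scalar (d 0 i) (e 0 j) ro.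
move=> /(ler_wpM2l (sqr_ge0 _ : 0 <= w i j)).
rewrite !expr0 !expr1 !mulr1 !mul1r !exprS expr0 mulr1 => h.
apply: le_trans (le_trans h _); rewrite le_eqVlt; apply/orP; left; apply/eqP; ring.
Qed.

(** Induction: the hypothesis multiplied by [y] is added to [(x - y)(x^(p+1) - y^(p+1)) >= 0]. It
    serves both as Young's inequality for traces and as the tangent inequality behind Jensen's. *)
Lemma young_pow (x y : R) (p : nat) : 0 <= x -> 0 <= y ->
  p.+1%:R * (x * y ^+ p) <= x ^+ p.+1 + p%:R * y ^+ p.+1.
Proof.
move=> x0 y0; elim: p => [|p IH]; first by rewrite !expr1 expr0 mulr1 mul1r mul0r addr0.
have := subX_mul_ge0 1 p.+1 x0 y0; rewrite !expr1.
have := ler_wpM2l y0 IH.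
rewrite (exprS x p.+1) (exprS y p.+1) -(natr1 p.+1) -(natr1 p).
rewrite {1 2}(exprS y p); set u := x ^+ _; set v := y ^+ p.
have -> : y ^+ p.+1 = y * v by rewrite exprS.
nra.
Qed.

(** Returns a trace of power [2p] with a diagonal weight to the pure trace of power [2p+2]. The
    coefficient [p], against [p+1] on the left, is what later allows absorption. *)
Lemma young_trace n (X : 'M[R]_n) (v : 'rV[R]_n) c p : X^T = X -> (forall i, 0 <= v 0 i) ->
  0 <= c ->
  p.+1%:R * (c * \tr (diag_mx v *m X ^+ (2 * p))) <=
    \sum_i (c * v 0 i) ^+ p.+1 + p%:R * \tr (X ^+ (2 * p.+1)).
Proof.
move=> Xs v0 c0; have [Q [d [QQ XE]]] := sym_spectral Xs.
pose w i j := (1%:M *m Q^T : 'M[R]_n) i j ^+ 2.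
have T u k : \tr (diag_mx u *m X ^+ k) = \sum_i \sum_j w i j * (u 0 i * d 0 j ^+ k).
  have := trace_spectral2 1%:M Q u (\row_i d 0 i ^+ k).
  rewrite trmx1 mul1mx mulmx1 XE spectralX // => ->.
  apply: eq_bigr => i _; apply: eq_bigr => j _.
  by rewrite /w !mxE.
(* Read as a trace against [X ^+ 0], this sum acquires the same weights [w] as the other two, and
   the scalar inequality applies term by term. *)
have -> : \sum_i (c * v 0 i) ^+ p.+1 =
    \sum_i \sum_j w i j * ((c * v 0 i) ^+ p.+1 * d 0 j ^+ 0).
  transitivity (\sum_i (\row_k (c * v 0 k) ^+ p.+1) 0 i).
    by apply: eq_bigr => i _; rewrite mxE.
  rewrite -mxtrace_diag -[diag_mx _]mulmx1 -[1%:M]/(X ^+ 0) T.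
  by apply: eq_bigr => i _; apply: eq_bigr => j _; rewrite mxE.
rewrite -[X ^+ (2 * p.+1)]mul1mx -diag_const_mx !T !mulr_sumr -big_split /=.
apply: ler_sum => i _; rewrite !mulr_sumr -big_split /=; apply: ler_sum => j _.
rewrite mxE mul1r expr0 mulr1 !exprM.
have := young_pow p (mulr_ge0 c0 (v0 i)) (sqr_ge0 (d 0 j)).
move=> /(ler_wpM2l (sqr_ge0 _ : 0 <= w i j)).
set a := _ ^+ p.+1; set b := _ ^+ p.+1; set z := _ ^+ p; rewrite mulrDr; nra.
Qed.
End TraceInequalities.

(** * Moments of sums of independent Bernoulli matrices *)

Section SymPow.
Context {R : realType}.

Lemma sym_expr n (X : 'M[R]_n) k : X^T = X -> (X ^+ k)^T = X ^+ k.
Proof.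
move=> Xs; elim: k => [|k IH]; first by rewrite expr0 trmx1.
by rewrite {1}exprS trmx_mul IH Xs -[_ *m _]/(_ * _) -exprSr.
Qed.

Lemma sym_even_diag_ge0 n (X : 'M[R]_n) r i : X^T = X -> ~~ odd r -> 0 <= (X ^+ r) i i.
Proof.
move=> Xs ro; have := odd_double_half r; rewrite (negPf ro) add0n => <-.
rewrite -addnn exprD -[_ * _]/(_ *m _) mxE; apply: sumr_ge0 => j _.
by rewrite -{2}(sym_expr _ Xs) [X in _ * X]mxE -expr2 sqr_ge0.
Qed.

Lemma trace_diag_mul n (d : 'rV[R]_n) (X : 'M[R]_n) :
  \tr (diag_mx d *m X) = \sum_i d 0 i * X i i.
Proof. by apply: eq_bigr => i _; rewrite mul_diag_mx mxE. Qed.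
End SymPow.

Section Bernoulli.
Context {R : realType} {E : finType}.
Variable p : E -> R.
Hypothesis p01 : forall e, 0 <= p e <= 1.
Implicit Types (f g : {ffun E -> bool} -> R) (al : {ffun E -> bool}).

Definition bern (q : R) (b : bool) : R := if b then q else 1 - q.
Definition bweight al : R := \prod_e bern (p e) (al e).
(** Expectation under the product law, as a finite sum over configurations: the spectral part then
    needs no measure theory. *)
Definition bmean f : R := \sum_al bweight al * f al.
Definition setb al e b : {ffun E -> bool} := [ffun e' => if e' == e then b else al e'].

Lemma bern_ge0 e b : 0 <= bern (p e) b.
Proof. by have := p01 e; case: b => /=; lra. Qed.

Lemma bweight_ge0 al : 0 <= bweight al.
Proof. by apply: prodr_ge0 => e _; exact: bern_ge0. Qed.

Lemma bmean_prod (h : E -> bool -> R) :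
  bmean (fun al => \prod_e h e (al e)) = \prod_e (p e * h e true + (1 - p e) * h e false).
Proof.
transitivity (\prod_e \sum_b bern (p e) b * h e b); last first.
  by apply: eq_bigr => e _; rewrite big_bool.
by rewrite bigA_distr_bigA; apply: eq_bigr => al _; rewrite big_split.
Qed.

Lemma bweight_sum : \sum_al bweight al = 1.
Proof.
transitivity (bmean (fun al => \prod_(e : E) 1)).
  by apply: eq_bigr => al _; rewrite big1 ?mulr1.
by rewrite (bmean_prod (fun _ _ => 1)) big1 // => e _; lra.
Qed.

Lemma bmean_le f g : (forall al, f al <= g al) -> bmean f <= bmean g.
Proof. by move=> fg; apply: ler_sum => al _; rewrite ler_wpM2l ?bweight_ge0. Qed.

Lemma bmeanD f g : bmean (fun al => f al + g al) = bmean f + bmean g.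
Proof. by rewrite /bmean -big_split; apply: eq_bigr => al _; rewrite mulrDr. Qed.

Lemma bmeanZ c f : bmean (fun al => c * f al) = c * bmean f.
Proof. by rewrite /bmean mulr_sumr; apply: eq_bigr => al _; rewrite mulrCA. Qed.

Lemma bmean_sum (I : finType) (f : I -> {ffun E -> bool} -> R) :
  bmean (fun al => \sum_i f i al) = \sum_i bmean (f i).
Proof. by rewrite exchange_big; apply: eq_bigr => al _; rewrite mulr_sumr. Qed.

Lemma setb_id al e : setb al e (al e) = al.
Proof. by apply/ffunP => e'; rewrite ffunE; case: eqP => // ->. Qed.

Lemma setb_set al e b c : setb (setb al e b) e c = setb al e c.
Proof. by apply/ffunP => e'; rewrite !ffunE; case: eqP. Qed.

Lemma setbE al e b : setb al e b e = b.
Proof. by rewrite ffunE eqxx. Qed.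

(* Each [al] with [al e = true] is paired with its flip at [e]. *)
Lemma bmean_half e f : bmean f = \sum_(al : {ffun E -> bool} | al e) (\prod_(e' | e' != e) bern (p e') (al e')) *
   (p e * f (setb al e true) + (1 - p e) * f (setb al e false)).
Proof.
have wE al b : bweight (setb al e b) =
    bern (p e) b * \prod_(e' | e' != e) bern (p e') (al e').
  rewrite /bweight (bigD1 e) //= setbE; congr (_ * _).
  by apply: eq_bigr => e' /negPf ee; rewrite ffunE ee.
rewrite /bmean (bigID (fun al : {ffun E -> bool} => al e)) /=.
rewrite [X in _ + X](reindex_onto (fun al : {ffun E -> bool} => setb al e false) (fun al : {ffun E -> bool} => setb al e true)) /=; last first.
  by move=> al /negPf ale; rewrite setb_set -ale setb_id.
rewrite [X in _ + X](eq_bigl (fun al : {ffun E -> bool} => al e)); last first.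
  move=> al; rewrite setbE setb_set /=; apply/eqP/idP => [<-|ale]; first by rewrite setbE.
  by rewrite -[in LHS]ale setb_id.
rewrite -big_split; apply: eq_bigr => al ale /=.
have {1 2}-> : al = setb al e true by rewrite -[in RHS]ale setb_id.
by rewrite !wE /=; ring.
Qed.

(** Averages over one edge with the others held fixed, in place of a conditional expectation. *)
Lemma bmean_resample e f :
  bmean f = bmean (fun al => p e * f (setb al e true) + (1 - p e) * f (setb al e false)).
Proof.
rewrite (bmean_half e) [RHS](bmean_half e); apply: eq_bigr => al _.
by rewrite !setb_set; congr (_ * _); ring.
Qed.

Lemma bmean_markov (bad : pred {ffun E -> bool}) f c : 0 < c ->
  (forall al, 0 <= f al) -> (forall al, bad al -> c <= f al) ->
  \sum_(al | bad al) bweight al <= bmean f / c.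
Proof.
move=> c0 f0 fc; rewrite ler_pdivlMr // mulr_suml /bmean [leRHS](bigID bad) /=.
rewrite -[leLHS]addr0; apply: lerD; last first.
  by apply: sumr_ge0 => al _; rewrite mulr_ge0 ?bweight_ge0.
by apply: ler_sum => al bal; rewrite ler_wpM2l ?bweight_ge0 ?fc.
Qed.

Section Matrix.
Context {n : nat}.
Variable M : E -> 'M[R]_n.
Variable m : E -> 'I_n -> bool.
Hypothesis Ms : forall e, (M e)^T = M e.
Hypothesis MM : forall e, M e *m M e = diag_mx (\row_i (m e i)%:R).

Definition cmx al : 'M[R]_n := \sum_e ((al e)%:R - p e) *: M e.
Definition bdeg al i : R := \sum_e (al e)%:R * (m e i)%:R.
Definition bexp i : R := \sum_e p e * (m e i)%:R.

Lemma cmx_sym al : (cmx al)^T = cmx al.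
Proof.
rewrite /cmx (linear_sum (@trmx R n n)) /=; apply: eq_bigr => e _.
by rewrite linearZ /= Ms.
Qed.

Lemma cmx_diff al e : cmx (setb al e true) - cmx (setb al e false) = M e.
Proof.
rewrite /cmx (bigD1 e) //= [X in _ - X](bigD1 e) //= !setbE opprD addrACA.
rewrite [X in _ + X](_ : _ = 0) ?addr0; last first.
  apply/eqP; rewrite subr_eq0; apply/eqP; apply: eq_bigr => e' /negPf ee.
  by rewrite !ffunE ee.
rewrite -scalerBl /= mulr1n mulr0n (_ : _ - _ = 1) ?scale1r //; ring.
Qed.

(** For one edge, [E (A_e - p) f(A_e) = p (1 - p) (f(1) - f(0))], the left side of the trace
    inequality for two matrices that differ by [M_e]. The factor [(1 - p) A_e + p (1 - A_e)] has
    total weight [p (1 - p)] at each value of [A_e], so it reproduces the right side. *)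
Lemma bmean_trace_step r : ~~ odd r ->
  bmean (fun al => \tr (cmx al ^+ r.+2)) <=
  r.+1%:R / 2 * bmean (fun al =>
     \tr (diag_mx (\row_i (bdeg al i + bexp i)) *m cmx al ^+ r)).
Proof.
move=> ro.
have H1 e : bmean (fun al => ((al e)%:R - p e) * \tr (M e *m cmx al ^+ r.+1)) <=
   r.+1%:R / 2 * bmean (fun al => ((1 - p e) * (al e)%:R + p e * (1 - (al e)%:R)) *
        \tr (M e *m M e *m cmx al ^+ r)).
  rewrite (bmean_resample e) [in leRHS](bmean_resample e) -bmeanZ; apply: bmean_le => al.
  rewrite !setbE /=.
  have := mean_value_trace (cmx_sym (setb al e true)) (cmx_sym (setb al e false)) ro.
  rewrite cmx_diff !mulmxBr !mulmxDr !linearB !linearD /=.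
  have pp : 0 <= p e * (1 - p e) by have := p01 e; nra.
  move=> /(ler_wpM2l pp) h.
  apply: le_trans (le_trans h _); rewrite le_eqVlt; apply/orP; left; apply/eqP; ring.
have -> : bmean (fun al => \tr (cmx al ^+ r.+2)) =
    \sum_e bmean (fun al => ((al e)%:R - p e) * \tr (M e *m cmx al ^+ r.+1)).
  rewrite -bmean_sum; congr bmean; apply/funext => al.
  rewrite exprS -[_ * _]/(_ *m _) {1}/cmx mulmx_suml linear_sum; apply: eq_bigr => e _.
  by rewrite -scalemxAl linearZ.
apply: le_trans (ler_sum _ (fun e _ => H1 e)) _.
rewrite -mulr_sumr ler_wpM2l ?divr_ge0 // -bmean_sum; apply: bmean_le => al.
rewrite trace_diag_mul.
(* [(1 - p) A_e + p (1 - A_e) <= A_e + p] turns the sum over edges into degree plus expected degree;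
   even powers have nonnegative diagonal entries. *)
apply: (@le_trans _ _ (\sum_e \sum_i ((al e)%:R + p e) * ((m e i)%:R * (cmx al ^+ r) i i))).
  apply: ler_sum => e _; rewrite MM trace_diag_mul mulr_sumr; apply: ler_sum => i _.
  rewrite mxE ler_wpM2r ?mulr_ge0 ?sym_even_diag_ge0 ?cmx_sym //.
  by have := p01 e; case: (al e) => /=; nra.
rewrite exchange_big /=; apply: ler_sum => i _.
rewrite mxE /bdeg /bexp -big_split /= mulr_suml; apply: ler_sum => e _.
rewrite le_eqVlt; apply/orP; left; apply/eqP; ring.
Qed.

(** Young's inequality bounds [k+1] copies of the moment by the degree sum plus [k] copies of the
    same moment, and [k] copies cancel. The factor [(2k+1)/2] is rounded up to [k+1]. *)
Lemma bmean_trace_le k : bmean (fun al => \tr (cmx al ^+ (2 * k.+1))) <=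
  bmean (fun al => \sum_i ((2 * k.+1)%:R / 2 * (bdeg al i + bexp i)) ^+ k.+1).
Proof.
set c : R := (2 * k.+1)%:R / 2.
have c0 : 0 <= c by rewrite divr_ge0.
have ro : ~~ odd (2 * k) by rewrite mul2n odd_double.
have dd al i : 0 <= bdeg al i + bexp i.
  rewrite addr_ge0 //; apply: sumr_ge0 => e _; rewrite mulr_ge0 //.
  by case/andP: (p01 e).
have h1 := bmean_trace_step ro.
set V := fun al => \row_i (bdeg al i + bexp i) in h1.
have h2 : k.+1%:R * (c * bmean (fun al => \tr (diag_mx (V al) *m cmx al ^+ (2 * k)))) <=
   bmean (fun al => \sum_i (c * (bdeg al i + bexp i)) ^+ k.+1) +
   k%:R * bmean (fun al => \tr (cmx al ^+ (2 * k.+1))).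
  rewrite -!bmeanZ -bmeanD; apply: bmean_le => al.
  have := @young_trace _ _ (cmx al) (V al) c k (cmx_sym al) _ c0.
  rewrite (eq_bigr (fun i => (c * (bdeg al i + bexp i)) ^+ k.+1)); last first.
    by move=> i _; rewrite mxE.
  by apply => i; rewrite mxE.
have h3 : (2 * k).+1%:R / 2 * bmean (fun al => \tr (diag_mx (V al) *m cmx al ^+ (2 * k))) <=
   c * bmean (fun al => \tr (diag_mx (V al) *m cmx al ^+ (2 * k))).
  apply: ler_wpM2r.
    apply: sumr_ge0 => al _; rewrite mulr_ge0 ?bweight_ge0 // trace_diag_mul.
    by apply: sumr_ge0 => i _; rewrite mulr_ge0 ?sym_even_diag_ge0 ?cmx_sym // mxE.
  by rewrite ler_wpM2r // ler_nat mulnS.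
have e2 : (2 * k).+2 = (2 * k.+1)%N by rewrite mulnS.
rewrite e2 in h1.
have h4 := le_trans h1 h3; have := ler_wpM2l (ler0n R k.+1) h4.
move=> /le_trans/(_ h2); rewrite -natr1 mulrDl mul1r addrC lerD2r //.
Qed.

End Matrix.
End Bernoulli.

(** * Matrix and degree concentration *)

Section Tail.
Context {R : realType}.

(** Polynomial form of the next bound: [(1 - x/4)^4 <= expR (- x)] reduces an upper bound on
    [expR x] to this inequality. *)
Lemma inv_pow4_bound (x : R) : - (1 / 4) <= x -> x <= 1 / 4 ->
  1 <= (1 + x + 3 / 4 * x ^+ 2) * (1 - x / 4) ^+ 4.
Proof.
move=> x1 x2; rewrite -subr_ge0.
have -> : (1 + x + 3 / 4 * x ^+ 2) * (1 - x / 4) ^+ 4 - 1 =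
  x ^+ 2 * ((1 / 8 - 7 / 16 * x) + x ^+ 2 * (57 / 256 - 11 / 256 * x + 3 / 1024 * x ^+ 2)).
  by field.
have x20 := sqr_ge0 x.
have k1 : 0 <= 1 / 8 - 7 / 16 * x by lra.
have k2 : 0 <= 57 / 256 - 11 / 256 * x + 3 / 1024 * x ^+ 2 by lra.
exact: (mulr_ge0 x20 (addr_ge0 k1 (mulr_ge0 x20 k2))).
Qed.

Lemma expR_le_quad (x : R) : `|x| <= 1 / 4 -> expR x <= 1 + x + 3 / 4 * x ^+ 2.
Proof.
rewrite ler_norml => /andP[x1 x2].
have h4 : 0 < 1 - x / 4 by lra.
have le1 : (1 - x / 4) ^+ 4 <= expR (- x).
  have -> : - x = (- (x / 4)) * 4%:R by lra.
  by rewrite expRM_natr lerXn2r ?nnegrE ?expR_ge0 ?(ltW h4) //; exact: expR_ge1Dx.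
have le2 := inv_pow4_bound x1 x2.
have q0 : 0 <= 1 + x + 3 / 4 * x ^+ 2.
  by clear le1 le2; have := sqr_ge0 x; lra.
have le3 := le_trans le2 (ler_wpM2l q0 le1).
by rewrite expRN ler_pdivlMr ?expR_gt0 // mul1r in le3.
Qed.

Lemma expR1_le3 : expR 1 <= 3 :> R.
Proof.
have -> : (1 : R) = (1 / 4) * 4%:R by lra.
have q : `|1 / 4 : R| <= 1 / 4 by rewrite ger0_norm; lra.
rewrite expRM_natr (le_trans (lerXn2r 4 _ _ (expR_le_quad q))) ?nnegrE ?expR_ge0 //; lra.
Qed.

Lemma opbound_of_trace n (X : 'M[R]_n) t k : X^T = X -> 0 <= t ->
  \tr (X ^+ (2 * k.+1)) <= t ^+ (2 * k.+1) -> opbound X t.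
Proof.
move=> Xs t0; have [Q [d [QQ XE]]] := sym_spectral Xs.
rewrite XE spectralX // spectral_trace // => h v.
have dt i : d 0 i ^+ 2 <= t ^+ 2.
  have : (d 0 i ^+ 2) ^+ k.+1 <= (t ^+ 2) ^+ k.+1.
    rewrite -!exprM; apply: le_trans h; rewrite (bigD1 i) //= mxE lerDl.
    by apply: sumr_ge0 => j _; rewrite mxE exprM exprn_ge0 ?sqr_ge0.
  by rewrite ler_pXn2r // nnegrE sqr_ge0.
rewrite -(@ler_pXn2r _ 2) ?nnegrE ?mulr_ge0 ?vnorm_ge0 // exprMn !vnorm_sqr.
rewrite spectral_nsq // -(nsq_orth v QQ) /nsq dotcE mulr_sumr.
by apply: ler_sum => i _; rewrite -expr2 ler_wpM2r ?sqr_ge0.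
Qed.

Context {E : finType} (p : E -> R).
Hypothesis p01 : forall e, 0 <= p e <= 1.
Context {n : nat}.
Variable m : E -> 'I_n -> bool.

(** Independence factors the mean over edges; each factor is bounded by [1 + y <= expR y] and the
    quadratic bound on [expR th], which requires [|th| <= 1/4]. *)
Lemma bdeg_mgf i th : `|th| <= 1 / 4 ->
  bmean p (fun al => expR (th * (bdeg m al i - bexp p m i))) <=
  expR (3 / 4 * th ^+ 2 * bexp p m i).
Proof.
move=> th1.
have -> : bmean p (fun al => expR (th * (bdeg m al i - bexp p m i))) =
  bmean p (fun al => \prod_e expR (th * (((al e)%:R - p e) * (m e i)%:R))).
  apply: eq_bigr => al _; congr (_ * _).
  rewrite -expR_sum -mulr_sumr /bdeg /bexp -sumrB; congr (expR (_ * _)).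
  by apply: eq_bigr => e _; rewrite mulrBl.
rewrite (bmean_prod p (fun e b => expR (th * ((b%:R - p e) * (m e i)%:R)))).
rewrite /bexp mulr_sumr expR_sum; apply: ler_prod => e _.
have /andP[pe0 pe1] := p01 e.
rewrite addr_ge0 ?mulr_ge0 ?expR_ge0 ?subr_ge0 //=.
case: (m e i); rewrite /= ?mulr0 ?mulr1 ?expR0; last lra.
have -> : th * (1 - p e) = th + - (th * p e) by ring.
have -> : th * (0 - p e) = - (th * p e) by ring.
rewrite expRD mulrA -mulrDl.
apply: (@le_trans _ _ (expR (p e * (expR th - 1)) * expR (- (th * p e)))).
  rewrite ler_wpM2r ?expR_ge0 // (le_trans _ (expR_ge1Dx _)) //; lra.
rewrite -expRD ler_expR; have := expR_le_quad th1; nra.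
Qed.

Lemma bdeg_tail i (de h : R) : bexp p m i = de -> 0 <= h <= 1 / 3 ->
  \sum_(al | h * de < `|bdeg m al i - de|) bweight p al <= 2 * expR (- (h ^+ 2 * de / 3)).
Proof.
move=> dE /andP[h0 h1].
(* [th = (2/3) h] minimizes [3/4 th^2 de - th h de], with value [- h^2 de / 3]; [h <= 1/3] keeps it
   below [1/4]. The sign [s] covers both tails. *)
pose f s al := expR (s * (2 / 3 * h) * (bdeg m al i - de)).
pose c := expR (2 / 3 * h * (h * de)).
have mgf s : `|s| = 1 -> bmean p (f s) / c <= expR (- (h ^+ 2 * de / 3)).
  move=> s1; rewrite ler_pdivrMr ?expR_gt0 // -expRD.
  have th1 : `|s * (2 / 3 * h)| <= 1 / 4.
    by rewrite normrM s1 mul1r ger0_norm; lra.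
  have := bdeg_mgf i th1; rewrite dE => /le_trans; apply; rewrite ler_expR.
  rewrite exprMn -(real_normK (num_real s)) s1; lra.
have tail s : `|s| = 1 -> \sum_(al | h * de < s * (bdeg m al i - de)) bweight p al <= expR (- (h ^+ 2 * de / 3)).
  move=> s1; apply: le_trans (mgf s s1); apply: bmean_markov => //; rewrite ?expR_gt0 //.
    by move=> al; exact: expR_ge0.
  move=> al h'; rewrite ler_expR; have := ltW h'; nra.
rewrite mulr_natl mulr2n.
apply: le_trans (lerD (tail 1 _) (tail (-1) _)); rewrite ?normrN ?normr1 //.
rewrite [leLHS](bigID (fun al => h * de < 1 * (bdeg m al i - de))) /=; apply: lerD.
  rewrite big_mkcond [leRHS]big_mkcond; apply: ler_sum => al _.
  case: ifP => [/andP[_ ->] //|_].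
  by case: ifP => // _; exact: bweight_ge0.
rewrite big_mkcond [leRHS]big_mkcond; apply: ler_sum => al _.
case: ifP => [/andP[n2]|_]; last by case: ifP => // _; exact: bweight_ge0.
rewrite mul1r -leNgt => n3; rewrite ifT // mulN1r.
by move: n2; rewrite lter_normr => /orP[|//]; rewrite ltNge n3.
Qed.

Variable M : E -> 'M[R]_n.
Hypothesis Ms : forall e, (M e)^T = M e.
Hypothesis MM : forall e, M e *m M e = diag_mx (\row_i (m e i)%:R).

(* [y <= expR (y - 1)] at [y = (D_i + de) / (2 de)], raised to the power [k+1],
   reduces the moment to the generating function of [D_i]. *)
Lemma bmean_trace_pow (de : R) k : 0 < de -> (forall i, bexp p m i = de) ->
  k.+1%:R / (2 * de) <= 1 / 4 ->
  bmean p (fun al => \tr (cmx p M al ^+ (2 * k.+1))) <=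
  n%:R * ((2 * k.+1%:R * de) ^+ k.+1 * expR (3 / 16 * k.+1%:R ^+ 2 / de)).
Proof.
move=> de0 dE hk; apply: le_trans (bmean_trace_le p01 Ms MM k) _.
rewrite bmean_sum; have -> : n%:R = \sum_(i < n) (1 : R) by rewrite sumr_const card_ord.
rewrite mulr_suml; apply: ler_sum => i _; rewrite mul1r dE.
set th : R := k.+1%:R / (2 * de) in hk.
have th0 : 0 <= th by rewrite divr_ge0 // mulr_ge0 // ltW.
have := @bdeg_mgf i th; rewrite ger0_norm // => /(_ hk); rewrite dE.
have -> : 3 / 4 * th ^+ 2 * de = 3 / 16 * k.+1%:R ^+ 2 / de.
  by rewrite /th; field; rewrite gt_eqF.
have c0 : 0 <= (2 * k.+1%:R * de) ^+ k.+1.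
  by rewrite exprn_ge0 // mulr_ge0 ?mulr_ge0 // ltW.
move=> /(ler_wpM2l c0); apply: le_trans; rewrite -bmeanZ; apply: (bmean_le p01) => al.
have -> : (2 * k.+1)%:R / 2 * (bdeg m al i + de) =
    (2 * k.+1%:R * de) * ((bdeg m al i + de) / (2 * de)).
  by rewrite natrM; field; rewrite gt_eqF.
rewrite exprMn ler_wpM2l //.
have -> : th * (bdeg m al i - de) = ((bdeg m al i + de) / (2 * de) - 1) * k.+1%:R.
  by rewrite /th; field; rewrite gt_eqF.
have bd0 : 0 <= bdeg m al i :> R by rewrite /bdeg; apply: sumr_ge0 => e _; rewrite mulr_ge0.
rewrite expRM_natr lerXn2r ?nnegrE ?expR_ge0 //.
  by rewrite divr_ge0 // ?addr_ge0 ?mulr_ge0 // ltW.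
by apply: le_trans (expR_ge1Dx _); rewrite [leRHS]addrC subrK.
Qed.

(** The failure bound collects two Chernoff tails per vertex, [2 n expR (- l)], and one trace tail,
    [n expR (- l)]. *)
Lemma adjacency_concentration (de l : R) : 2 <= l -> 27 * l < de ->
  (forall i, bexp p m i = de) ->
  let h := Num.sqrt (3 * l / de) in
  exists good : pred {ffun E -> bool},
    (forall al, good al -> (forall i, `|bdeg m al i - de| <= h * de) /\
        opbound (cmx p M al) (9 / 5 * h * de)) /\
    \sum_(al | ~~ good al) bweight p al <= 3 * n%:R * expR (- l).
Proof.
move=> l2 lde dE h.
have de0 : 0 < de by lra.
have hh : h ^+ 2 = 3 * l / de by rewrite sqr_sqrtr // divr_ge0 ?mulr_ge0 // ?(ltW de0) //; lra.
have h0 : 0 <= h by exact: sqrtr_ge0.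
have h1 : h <= 1 / 3.
  rewrite -(@ler_pXn2r _ 2) ?nnegrE ?divr_ge0 // hh ler_pdivrMr //; lra.
(* This moment order makes the Markov ratio at most [expR (-1)] per factor. *)
pose k := Num.truncn l.
have /andP[kl lk] : (k%:R <= l < k.+1%:R) by apply: truncn_itv; lra.
pose t := 9 / 5 * h * de.
have t0 : 0 <= t by rewrite /t !mulr_ge0 // ltW.
pose G al := [forall i, `|bdeg m al i - de| <= h * de].
pose G' al := \tr (cmx p M al ^+ (2 * k.+1)) <= t ^+ (2 * k.+1).
exists (fun al => G al && G' al); split.
  move=> al /andP[/forallP g1 g2]; split=> //.
  exact: (opbound_of_trace (cmx_sym p Ms al) t0 g2).
have tp : 0 < t ^+ (2 * k.+1).
  rewrite exprn_gt0 // /t mulr_gt0 // mulr_gt0 // sqrtr_gt0 divr_gt0 //; lra.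
have P1 : \sum_(al | ~~ G al) bweight p al <= 2 * n%:R * expR (- l).
  have <- : h ^+ 2 * de / 3 = l by rewrite hh; field; rewrite gt_eqF.
  apply: (@le_trans _ _ (\sum_(i < n) \sum_(al | h * de < `|bdeg m al i - de|) bweight p al)).
    rewrite (exchange_big_dep predT) //= big_mkcond; apply: ler_sum => al _.
    case: ifP => [|_]; last by apply: sumr_ge0 => i _; apply: bweight_ge0.
    rewrite negb_forall => /existsP[i hi].
    rewrite (bigD1 i) /=; last by rewrite ltNge.
    by rewrite lerDl; apply: sumr_ge0 => j _; apply: bweight_ge0.
  apply: le_trans (ler_sum _ (fun i _ => bdeg_tail (dE i) _)) _; first by rewrite h0.
  by rewrite sumr_const card_ord -mulr_natl; lra.
have P2 : \sum_(al | ~~ G' al) bweight p al <= n%:R * expR (- l).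
  have kde : k.+1%:R / (2 * de) <= 1 / 4.
    by rewrite ler_pdivrMr ?mulr_gt0 // -natr1; lra.
  apply: le_trans (bmean_markov p01 (c := t ^+ (2 * k.+1)) (f := fun al => \tr (cmx p M al ^+ (2 * k.+1))) tp _ _) _.
  - move=> al; apply: sumr_ge0 => i _; apply: sym_even_diag_ge0; first exact: cmx_sym.
    by rewrite mul2n odd_double.
  - by move=> al; rewrite -ltNge => /ltW.
  rewrite ler_pdivrMr //; apply: le_trans (bmean_trace_pow de0 dE kde) _.
  rewrite -[leRHS]mulrA ler_wpM2l //.
  have e1 : expR (- k.+1%:R) <= expR (- l) :> R by rewrite ler_expR lerN2 ltW.
  apply: le_trans (ler_wpM2r (ltW tp) e1).
  have -> : 3 / 16 * k.+1%:R ^+ 2 / de = (3 / 16 * k.+1%:R / de) * k.+1%:R.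
    by field; rewrite gt_eqF.
  rewrite exprM expRM_natr -exprMn -mulN1r expRM_natr -exprMn lerXn2r //.
  - by rewrite nnegrE mulr_ge0 ?expR_ge0 ?mulr_ge0 // ltW.
  - by rewrite nnegrE mulr_ge0 ?expR_ge0 ?sqr_ge0.
  (* Here [t^2 = 9.72 l de] must exceed [2 (k+1) de expR (3/16 (k+1) / de)] times [expR 1]. With
     [k+1 <= 3/2 l] and [expR 1 <= 3] that product is at most [9.18 l de], so [9/5] suffices. *)
  have -> : t ^+ 2 = 243 / 25 * l * de.
    by rewrite /t !exprMn hh; field; rewrite gt_eqF.
  rewrite expRN ler_pdivlMl ?expR_gt0 //.
  have e3 := expR1_le3.
  have x1 : 3 / 16 * k.+1%:R / de <= 1 / 54.
    by rewrite ler_pdivrMr // -natr1; lra.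
  have x0 : 0 <= 3 / 16 * k.+1%:R / de by rewrite divr_ge0 ?mulr_ge0 // ltW.
  have e4 : expR (3 / 16 * k.+1%:R / de) <= 51 / 50 :> R.
    have q : `|3 / 16 * k.+1%:R / de| <= 1 / 4 by rewrite ger0_norm //; lra.
    apply: le_trans (expR_le_quad q) _; set x := _ / de in x0 x1 *; nra.
  have k3 : k.+1%:R <= 3 / 2 * l by rewrite -natr1; lra.
  have e34 : expR 1 * expR (3 / 16 * k.+1%:R / de) <= 153 / 50.
    have := ler_pM (expR_ge0 1) (expR_ge0 (3 / 16 * k.+1%:R / de)) e3 e4; lra.
  have kd : k.+1%:R * de <= 3 / 2 * l * de by rewrite ler_pM2r.
  have := ler_pM (mulr_ge0 (expR_ge0 1) (expR_ge0 (3 / 16 * k.+1%:R / de))) _ e34 kd.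
  rewrite mulr_ge0 ?(ltW de0) // => /(_ isT) H.
  have : 0 < l * de by rewrite mulr_gt0 //; lra.
  by move: H; nra.
rewrite (bigID (fun al => ~~ G al)) /=.
have -> : 3 * n%:R * expR (- l) = 2 * n%:R * expR (- l) + n%:R * expR (- l) by ring.
apply: lerD; [apply: le_trans P1|apply: le_trans P2].
  rewrite big_mkcond [leRHS]big_mkcond; apply: ler_sum => al _.
  by have := bweight_ge0 p01 al; case: (G al); case: (G' al).
rewrite big_mkcond [leRHS]big_mkcond; apply: ler_sum => al _.
by have := bweight_ge0 p01 al; case: (G al); case: (G' al).
Qed.
End Tail.

(** * Perturbation of the normalized adjacency matrix *)

Section Normalize.
Context {R : realType}.
Implicit Types n : nat.

Definition rowsum n (A : 'M[R]_n) i := \sum_j A i j.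

Lemma sym_normalizeE n (A : 'M[R]_n) i j :
  sym_normalize A i j = (Num.sqrt (rowsum A i))^-1 * A i j * (Num.sqrt (rowsum A j))^-1.
Proof. by rewrite /sym_normalize mul_mx_diag mxE mul_diag_mx !mxE. Qed.

Lemma sym_normalize_sym n (A : 'M[R]_n) : A^T = A -> (sym_normalize A)^T = sym_normalize A.
Proof.
move=> As; apply/matrixP => i j; rewrite mxE !sym_normalizeE.
have -> : A j i = A i j by rewrite -[in LHS]As mxE.
ring.
Qed.

(** AM-GM on [u_i r_i] and [v_j r_j], weighted by [A_ij], bounds the bilinear form by
    [(|u|^2 + |v|^2) / 2]; the choice [u = L v] concludes. *)
Lemma sym_normalize_opbound n (A : 'M[R]_n) : A^T = A -> (forall i j, 0 <= A i j) ->
  opbound (sym_normalize A) 1.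
Proof.
move=> As A0 v; rewrite mul1r; set L := sym_normalize A.
pose r i := (Num.sqrt (rowsum A i))^-1.
have d0 i : 0 <= rowsum A i by exact: sumr_ge0.
(* A vertex of degree zero has [r i = 0] since [0^-1 = 0], hence an inequality instead of an
   equality. *)
have rd i : r i ^+ 2 * rowsum A i <= 1.
  rewrite /r exprVn sqr_sqrtr //; have [->|ne] := eqVneq (rowsum A i) 0.
    by rewrite mulr0.
  by rewrite mulVf.
have bil u : dotc u (L *m v) <= (nsq u + nsq v) / 2.
  apply: (@le_trans _ _ (\sum_i \sum_j A i j * ((u i 0 ^+ 2 * r i ^+ 2 + v j 0 ^+ 2 * r j ^+ 2) / 2))).
    rewrite dotcE; apply: ler_sum => i _; rewrite mxE mulr_sumr; apply: ler_sum => j _.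
    rewrite sym_normalizeE -/(r i) -/(r j).
    have -> : u i 0 * (r i * A i j * r j * v j 0) = A i j * ((u i 0 * r i) * (v j 0 * r j)) by ring.
    rewrite ler_wpM2l // -!exprMn.
    have := sqr_ge0 (u i 0 * r i - v j 0 * r j); rewrite sqrrB; lra.
  have -> : \sum_i \sum_j A i j * ((u i 0 ^+ 2 * r i ^+ 2 + v j 0 ^+ 2 * r j ^+ 2) / 2) =
    (\sum_i u i 0 ^+ 2 * (r i ^+ 2 * rowsum A i) + \sum_i v i 0 ^+ 2 * (r i ^+ 2 * rowsum A i)) / 2.
    have -> : \sum_i v i 0 ^+ 2 * (r i ^+ 2 * rowsum A i) =
        \sum_j \sum_i A i j * (v j 0 ^+ 2 * r j ^+ 2).
      apply: eq_bigr => j _; rewrite -mulr_suml.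
      have -> : \sum_i A i j = rowsum A j.
        by apply: eq_bigr => i _; rewrite -[in LHS]As mxE.
      ring.
    rewrite [X in _ = (_ + X) / _]exchange_big -big_split mulr_suml; apply: eq_bigr => i _.
    rewrite /rowsum !mulr_sumr -big_split mulr_suml /=; apply: eq_bigr => j _; ring.
  rewrite ler_pM2r // /nsq !dotcE; apply: lerD; apply: ler_sum => i _.
    by rewrite -expr2 -[leRHS]mulr1 ler_wpM2l ?sqr_ge0.
  by rewrite -expr2 -[leRHS]mulr1 ler_wpM2l ?sqr_ge0.
by rewrite vnorm_le; have := bil (L *m v); rewrite -/(nsq _); lra.
Qed.

Lemma opbound_diag n (x : 'rV[R]_n) c : 0 <= c -> (forall i, `|x 0 i| <= c) ->
  opbound (diag_mx x) c.
Proof.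
move=> c0 h v; rewrite -(@ler_pXn2r _ 2) ?nnegrE ?mulr_ge0 ?vnorm_ge0 // exprMn !vnorm_sqr.
rewrite /nsq !dotcE mulr_sumr; apply: ler_sum => i _; rewrite mul_diag_mx mxE.
rewrite -expr2 exprMn -expr2 ler_wpM2r ?sqr_ge0 // -(real_normK (num_real (x 0 i))).
by rewrite lerXn2r ?nnegrE.
Qed.

(** [|1 - w| = |1 - x| / (1 + w)] with [w >= 4/5] explains [5/9]; [29/25] bounds the square root of
    [4/3]. *)
Lemma sqrt_near1 (x h : R) : 0 <= h <= 1 / 3 -> `|x - 1| <= h ->
  `|1 - Num.sqrt x| <= 5 / 9 * h /\ Num.sqrt x <= 29 / 25.
Proof.
move=> /andP[h0 h1]; rewrite ler_norml => /andP[x1 x2].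
have s2 : Num.sqrt x ^+ 2 = x by rewrite sqr_sqrtr //; lra.
have s0 : 0 <= Num.sqrt x by exact: sqrtr_ge0.
set w := Num.sqrt x in s2 s0 *.
have w1 : 4 / 5 <= w by rewrite -(@ler_pXn2r _ 2) ?nnegrE // s2; lra.
split; last by rewrite -(@ler_pXn2r _ 2) ?nnegrE // s2; lra.
by rewrite ler_norml; apply/andP; split; nra.
Qed.

Lemma sym_normalize_const n (A : 'M[R]_n) de : 0 <= de -> (forall i, rowsum A i = de) ->
  sym_normalize A = de^-1 *: A.
Proof.
move=> de0 hd; apply/matrixP => i j; rewrite sym_normalizeE !hd mxE.
by rewrite -mulrA mulrCA -invfM -expr2 sqr_sqrtr // mulrC.
Qed.

(** The three pieces cost [5/9 h], [29/25] times [5/9 h], and [9/5 h]; as [5/9 (1 + 29/25) = 6/5],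
    the total is exactly [3 h]. *)
Lemma sym_normalize_perturb n (A B : 'M[R]_n) (de h : R) :
  A^T = A -> (forall i j, 0 <= A i j) -> 0 < de -> (forall i, rowsum B i = de) ->
  0 <= h <= 1 / 3 -> (forall i, `|rowsum A i - de| <= h * de) ->
  opbound (A - B) (9 / 5 * h * de) ->
  opbound (sym_normalize A - sym_normalize B) (3 * h).
Proof.
move=> As A0 de0 hB h01 hA hAB; have /andP[h0 h1] := h01.
rewrite (sym_normalize_const (ltW de0) hB); set L := sym_normalize A.
pose w : 'rV[R]_n := \row_i Num.sqrt (rowsum A i / de).
pose W := diag_mx w.
have hw i : `|1 - w 0 i| <= 5 / 9 * h /\ w 0 i <= 29 / 25.
  rewrite mxE; apply: sqrt_near1 => //.
  have -> : rowsum A i / de - 1 = (rowsum A i - de) / de by field; rewrite gt_eqF.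
  by rewrite normrM normfV (gtr0_norm de0) ler_pdivrMr.
have dA i : 0 < rowsum A i.
  by have := hA i; rewrite ler_norml => /andP[+ _]; nra.
(* [L - A / de = (1 - W) L + W L (1 - W)] with [W = diag (sqrt (D_i / de))]. *)
have WLW : W *m L *m W = de^-1 *: A.
  apply/matrixP => i j; rewrite mul_mx_diag mxE mul_diag_mx 2!mxE sym_normalizeE !mxE.
  rewrite !sqrtrM ?(ltW (dA _)) //.
  have hi := dA i; have hj := dA j.
  rewrite -sqrtr_gt0 in hi; rewrite -sqrtr_gt0 in hj.
  have qE : Num.sqrt de^-1 ^+ 2 = de^-1 by rewrite sqr_sqrtr // invr_ge0 ltW.
  rewrite -[in RHS]qE; set q := Num.sqrt de^-1.
  by field; rewrite !gt_eqF.
have b1 : opbound (1%:M - W) (5 / 9 * h).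
  have -> : 1%:M - W = diag_mx (\row_i (1 - w 0 i)).
    by apply/matrixP => i j; rewrite !mxE; case: eqP => _; rewrite ?mulr1n ?mulr0n ?subr0.
  by apply: opbound_diag => [|i]; [lra|rewrite mxE; case: (hw i)].
have b2 : opbound W (29 / 25).
  apply: opbound_diag => [|i]; first lra.
  by rewrite ger0_norm ?mxE ?sqrtr_ge0 //; case: (hw i); rewrite mxE.
have bL : opbound L 1 by exact: sym_normalize_opbound.
have b3 : opbound ((1%:M - W) *m L) (5 / 9 * h * 1) by apply: opboundM => //; lra.
have b4 : opbound (W *m L *m (1%:M - W)) (29 / 25 * 1 * (5 / 9 * h)).
  by apply: opboundM; [lra| |]; last exact: b1; apply: opboundM => //; lra.
have b5 : opbound (de^-1 *: (A - B)) (`|de^-1| * (9 / 5 * h * de)) by exact: opboundZ.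
have -> : L - de^-1 *: B = (1%:M - W) *m L + W *m L *m (1%:M - W) + de^-1 *: (A - B).
  rewrite scalerBr -WLW mulmxBl mul1mx mulmxBr mulmx1 addrA; congr (_ - _).
  by rewrite addrA subrK subrK.
apply: opbound_le (opboundD (opboundD b3 b4) b5).
have -> : `|de^-1| * (9 / 5 * h * de) = 9 / 5 * h.
  by rewrite gtr0_norm ?invr_gt0 //; field; rewrite gt_eqF.
lra.
Qed.

End Normalize.

(** * The two-block expected Laplacian *)

Section Deterministic.
Context {R : realType}.

Lemma eigs_exist n (S : 'M[R]_n) : S^T = S -> exists e, eigs_by_magnitude S e.
Proof.
move=> Ss; have [Q [d [QQ SE]]] := sym_spectral Ss.
exists (sort (fun x y => `|y| <= `|x|) (codom (d 0))); split.
- by rewrite size_sort size_codom card_ord.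
- rewrite SE char_poly_conj // char_poly_diag.
  by apply: perm_big; rewrite perm_sym perm_sort.
- by apply: sort_sorted => x y; exact: le_total.
Qed.

Lemma eigs_trace n (S : 'M[R]_n) e k : S^T = S -> eigs_by_magnitude S e ->
  \tr (S ^+ k) = \sum_(i < n) e`_i ^+ k.
Proof.
move=> Ss he; have [Q [QQ SE]] := eigs_spectral Ss he.
rewrite SE spectralX // spectral_trace //.
by apply: eq_bigr => i _; rewrite !mxE.
Qed.

(** The form is tested on the eigenvector of index [i]. This removes the absolute values left by an
    ordering by magnitude. *)
Lemma eigs_ge0 n (S : 'M[R]_n) e (i : nat) : S^T = S -> eigs_by_magnitude S e ->
  (i < n)%N -> (forall v, 0 <= dotc v (S *m v)) -> 0 <= e`_i.
Proof.
move=> Ss he ni psd; have [Q [QQ SE]] := eigs_spectral Ss he.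
pose j := Ordinal ni.
have := psd (Q^T *m delta_mx j 0); rewrite {1}SE.
rewrite -!mulmxA (mulmxA Q) QQ mul1mx dotc_mull trmxK (mulmxA Q) QQ mul1mx.
rewrite dotcE (bigD1 j) //= big1 => [|k kj]; last by rewrite mxE (negPf kj) /= mul0r.
by rewrite mul_diag_mx !mxE !eqxx /= mul1r mulr1 addr0.
Qed.

Context {n : nat} (a b : R) (g : 'I_n -> 'I_2).
Hypothesis n0 : (0 < n)%N.
Hypothesis neven : ~~ odd n.
Hypothesis b0 : 0 <= b.
Hypothesis ba : b < a.
Hypothesis card_g : #|[pred i | g i == 0]| = n./2.
Let Om : 'M[R]_2 := ((a - b) / n%:R)%:M + const_mx (b / n%:R).
Let Lc : 'M[R]_n := exp_lap g Om.
Let mu2 := (a - b) / (a + b).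
Let one : 'cV[R]_n := const_mx 1.
(** Unnormalized second eigenvector of the expected Laplacian, orthogonal to the constants because
    the groups have equal size. *)
Definition signv : 'cV[R]_n := \col_i (if g i == 0 then 1 else -1).

Let nR0 : 0 < n%:R :> R. Proof. by rewrite ltr0n. Qed.
Let ab0 : 0 < a + b. Proof. by have := b0; have := ba; lra. Qed.

Lemma mu2_gt0 : 0 < mu2. Proof. by rewrite divr_gt0 // subr_gt0. Qed.
Lemma mu2_le1 : mu2 <= 1. Proof. by rewrite ler_pdivrMr //; have := b0; lra. Qed.

Lemma even_gt1 : (1 < n)%N.
Proof. by case: n n0 neven => // -[]. Qed.

Lemma exp_adjE (Q : 'M[R]_2) i j : exp_adj g Q i j = Q (g i) (g j).
Proof.
rewrite /exp_adj /memb_mx mxE (bigD1 (g j)) //= [X in _ + X]big1 ?addr0; last first.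
  by move=> k kj; rewrite !mxE eq_sym (negPf kj) mulr0.
rewrite mxE (bigD1 (g i)) //= [X in _ + X]big1 ?addr0; last first.
  by move=> k kj; rewrite !mxE eq_sym (negPf kj) mul0r.
by rewrite !mxE !eqxx mul1r mulr1.
Qed.

Lemma exp_adj_blockE i j : exp_adj g Om i j =
  ((a + b) / 2 + (a - b) / 2 * (signv i 0 * signv j 0)) / n%:R.
Proof.
rewrite exp_adjE !mxE.
have two (x : 'I_2) : x = 0 \/ x = 1.
  by case: x => [[|[|//]]] h; [left|right]; apply/val_inj.
case: (two (g i)) => ->; case: (two (g j)) => -> /=; rewrite ?mulr1n ?mulr0n; field; exact: lt0r_neq0.
Qed.

Lemma signv_sum : \sum_i signv i 0 = 0.
Proof.
rewrite (bigID (fun i => g i == 0)) /=.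
rewrite (eq_bigr (fun=> 1)) => [|i gi]; last by rewrite mxE gi.
rewrite [X in _ + X](eq_bigr (fun=> -1)) => [|i /negPf gi]; last by rewrite mxE gi.
rewrite !sumr_const mulNrn card_g.
have -> : #|[pred i | g i != 0]| = n./2.
  have := cardC [pred i | g i == 0]; rewrite card_g card_ord.
  rewrite -[X in _ = X]odd_double_half (negPf neven) add0n -addnn => /addnI <-.
  by apply: eq_card => i.
by rewrite subrr.
Qed.

Lemma dotc_one v : dotc one v = \sum_i v i 0.
Proof. by rewrite dotcE; apply: eq_bigr => i _; rewrite mxE mul1r. Qed.

Lemma nsq_one : nsq one = n%:R.
Proof. by rewrite /nsq dotc_one (eq_bigr (fun=> 1)) ?sumr_const ?card_ord // => i _; rewrite mxE. Qed.

Lemma nsq_signv : nsq signv = n%:R.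
Proof.
rewrite /nsq dotcE (eq_bigr (fun=> 1)) ?sumr_const ?card_ord // => i _.
by rewrite mxE; case: ifP; rewrite ?mulr1 ?mulrNN ?mulr1.
Qed.

Lemma dotc_one_signv : dotc one signv = 0.
Proof. by rewrite dotc_one signv_sum. Qed.

Lemma rowsum_exp_adj i : rowsum (exp_adj g Om) i = (a + b) / 2.
Proof.
rewrite /rowsum (eq_bigr (fun j => (a + b) / 2 / n%:R + (a - b) / 2 / n%:R * signv i 0 * signv j 0)).
  rewrite big_split /= sumr_const card_ord -mulr_sumr signv_sum mulr0 addr0 -mulr_natr.
  by field; exact: lt0r_neq0.
by move=> j _; rewrite exp_adj_blockE; field; exact: lt0r_neq0.
Qed.

Lemma delta_min_block : delta_min g Om = (a + b) / 2.
Proof.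
rewrite /delta_min /seqmin.
have -> : [seq exp_deg g Om i | i <- enum 'I_n] = nseq n ((a + b) / 2).
  rewrite (eq_map rowsum_exp_adj) -[in RHS](size_enum_ord n).
  by elim: (enum 'I_n) => //= x s ->.
case: n n0 => // k _ /=; elim: k => [|k IH] /=; first by rewrite big_cons big_nil minxx.
by rewrite big_cons IH minxx.
Qed.

(** All expected degrees equal [(a + b) / 2], so normalization divides by a constant and [Lc] has
    rank two: eigenvalue 1 on [one] and [mu2] on [signv]. *)
Lemma LcE v : Lc *m v = (dotc one v / n%:R) *: one + (mu2 * dotc signv v / n%:R) *: signv.
Proof.
rewrite /Lc /exp_lap (sym_normalize_const _ rowsum_exp_adj); last by rewrite divr_ge0 // ltW.
apply/matrixP => i j; rewrite ord1 -scalemxAl.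
have Z c (w : 'cV[R]_n) : (c *: w) i 0 = c * w i 0 by rewrite mxE.
rewrite [RHS]mxE !Z dotc_one dotcE (_ : one i 0 = 1) ?mulr1; last by rewrite mxE.
rewrite [(_ *m v) i 0]mxE mulr_sumr !mulr_suml mulr_sumr !mulr_suml -big_split.
apply: eq_bigr => k _; rewrite exp_adj_blockE /mu2 /=.
by field; rewrite !lt0r_neq0.
Qed.

Lemma Lc_sym : Lc^T = Lc.
Proof.
rewrite /Lc /exp_lap sym_normalize_sym //; apply/matrixP => i j.
by rewrite mxE !exp_adj_blockE [signv j 0 * _]mulrC.
Qed.

Lemma Lc_psd v : 0 <= dotc v (Lc *m v).
Proof.
rewrite LcE dotcDr !dotcZr !(dotcC v); set x := dotc one v; set y := dotc signv v.
have -> : x / n%:R * x + mu2 * y / n%:R * y = (x ^+ 2 + mu2 * y ^+ 2) / n%:R by ring.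
rewrite divr_ge0 // addr_ge0 ?sqr_ge0 // mulr_ge0 ?sqr_ge0 //; exact: ltW mu2_gt0.
Qed.

(** On the hyperplane orthogonal to [one], a step of [Lc] shrinks lengths at least by [mu2] and
    lands on the line of [signv], inside the same hyperplane. *)
Lemma Lc_pow_le k v : dotc one v = 0 -> vnorm (Lc ^+ k *m v) <= mu2 ^+ k * vnorm v.
Proof.
have m0 : 0 <= mu2 by exact: ltW mu2_gt0.
elim: k v => [|k IH] v v1; first by rewrite !expr0 mul1mx mul1r.
rewrite exprSr -[_ * Lc]/(_ *m Lc) -mulmxA.
have E : Lc *m v = (mu2 * dotc signv v / n%:R) *: signv by rewrite LcE v1 mul0r scale0r add0r.
have o : dotc one (Lc *m v) = 0 by rewrite E dotcZr dotc_one_signv mulr0.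
apply: le_trans (IH _ o) _; rewrite exprSr -mulrA ler_wpM2l ?exprn_ge0 //.
rewrite -(@ler_pXn2r _ 2) ?nnegrE ?(mulr_ge0 m0 (vnorm_ge0 v)) ?vnorm_ge0 //.
rewrite [leRHS]exprMn !vnorm_sqr.
rewrite E nsqZ nsq_signv.
have -> : (mu2 * dotc signv v / n%:R) ^+ 2 * n%:R = mu2 ^+ 2 * (dotc signv v ^+ 2 / n%:R).
  by field; exact: lt0r_neq0.
rewrite ler_wpM2l ?sqr_ge0 //.
have : dotc signv v ^+ 2 <= n%:R * nsq v.
  have h1 := dotc_le signv v; have h2 := dotc_le (- signv) v.
  rewrite vnormN -scaleN1r dotcZl mulN1r in h2.
  have : `|dotc signv v| <= vnorm signv * vnorm v by rewrite ler_norml; lra.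
  rewrite -(@ler_pXn2r _ 2) ?nnegrE ?mulr_ge0 ?vnorm_ge0 //.
  by rewrite real_normK ?num_real // exprMn !vnorm_sqr nsq_signv.
by rewrite ler_pdivrMr // mulrC.
Qed.

Definition span_mx : 'M[R]_(n, 2) := \matrix_(i, j) (if j == 0 then 1 else signv i 0).

Lemma span_mxE (y : 'cV[R]_2) : span_mx *m y = y 0 0 *: one + y 1 0 *: signv.
Proof.
apply/matrixP => i j; rewrite ord1 mxE big_ord_recl big_ord1.
have -> : lift ord0 ord0 = 1 :> 'I_2 by exact: val_inj.
by rewrite [span_mx _ _]mxE [span_mx _ _]mxE /= !mxE mulrC; congr (_ + _); rewrite mulrC.
Qed.

Lemma nsq_comb x y : nsq (x *: one + y *: signv) = n%:R * (x ^+ 2 + y ^+ 2).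
Proof.
rewrite /nsq !(dotcDl, dotcDr, dotcZl, dotcZr) (dotcC signv one) dotc_one_signv.
rewrite -!/(nsq _) nsq_one nsq_signv; ring.
Qed.

Lemma span_mx_inj (y : 'cV[R]_2) : span_mx *m y = 0 -> y = 0.
Proof.
move=> /eqP; rewrite span_mxE -nsq_eq0 nsq_comb mulf_eq0 (gt_eqF nR0) /=.
rewrite paddr_eq0 ?sqr_ge0 // !sqrf_eq0 => /andP[/eqP y0 /eqP y1].
apply/matrixP => i j; rewrite ord1 mxE; case: i => [[|[|//]]] h.
  by rewrite -[RHS]y0; congr (y _ _); exact: val_inj.
by rewrite -[RHS]y1; congr (y _ _); exact: val_inj.
Qed.

Lemma Lc_pow_comb k x y :
  Lc ^+ k *m (x *: one + y *: signv) = x *: one + (mu2 ^+ k * y) *: signv.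
Proof.
elim: k => [|k IH]; first by rewrite !expr0 mul1mx mul1r.
rewrite exprS -[Lc * _]/(Lc *m _) -mulmxA IH LcE !(dotcDr, dotcZr) (dotcC signv one).
rewrite dotc_one_signv -!/(nsq _) nsq_one nsq_signv exprS.
by congr (_ *: _ + _ *: _); field; exact: lt0r_neq0.
Qed.

Lemma Lc_pow_span k (y : 'cV[R]_2) : mu2 ^+ k * vnorm (span_mx *m y) <= vnorm (Lc ^+ k *m (span_mx *m y)).
Proof.
have m0 := ltW mu2_gt0.
rewrite span_mxE Lc_pow_comb -(@ler_pXn2r _ 2) ?nnegrE ?(mulr_ge0 (exprn_ge0 k m0) (vnorm_ge0 _)) ?vnorm_ge0 //.
rewrite exprMn !vnorm_sqr !nsq_comb; set q := mu2 ^+ k.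
have q1 : q ^+ 2 <= 1 by rewrite -exprM exprn_ile1 ?mu2_le1.
rewrite [leLHS](_ : _ = n%:R * (q ^+ 2 * y 0 0 ^+ 2 + (q * y 1 0) ^+ 2)); last by ring.
by rewrite ler_pM2l // lerD2r -[leRHS]mul1r ler_wpM2r ?sqr_ge0.
Qed.

(** Both halves of min-max with explicit subspaces: the span of [one] and [signv], where [Lc ^+ k]
    stretches by at least [mu2 ^+ k], gives the lower bound, and the hyperplane orthogonal to [one]
    the upper one. Positivity of the form identifies the eigenvalue with its magnitude. *)
Lemma second_eig_perturb (S : 'M[R]_n) lam k c : S^T = S -> (forall v, 0 <= dotc v (S *m v)) ->
  opbound (S - Lc ^+ k) c -> eigs_by_magnitude S lam -> 0 <= lam`_1 /\ `|lam`_1 - mu2 ^+ k| <= c.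
Proof.
move=> Ss psd hS hl; have n1 := even_gt1; have l0 := eigs_ge0 Ss hl n1 psd.
split=> //; rewrite ler_norml; apply/andP; split.
  rewrite -[lam`_1]ger0_norm // lerBrDl.
  apply: (eig1_ge Ss hl n1 span_mx_inj) => y; set v := span_mx *m y.
  have := Lc_pow_span k y; rewrite -/v => h1.
  have h2 := hS v; have := vnormB_ge (Lc ^+ k *m v) (Lc ^+ k *m v - S *m v).
  have -> : vnorm (Lc ^+ k *m v - S *m v) = vnorm ((S - Lc ^+ k) *m v).
    by rewrite -vnormN opprB mulmxBl.
  by rewrite subKr mulrBl; lra.
rewrite lerBlDl -[lam`_1]ger0_norm //.
apply: (eig_le (F := one^T) Ss hl n1) => v ov.
have v1 : dotc one v = 0 by rewrite /dotc ov mxE.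
have -> : S *m v = Lc ^+ k *m v + (S - Lc ^+ k) *m v by rewrite mulmxBl addrC subrK.
apply: le_trans (vnormD _ _) _; rewrite mulrDl; apply: lerD; first exact: Lc_pow_le.
exact: hS.
Qed.

(** The perturbation bound applied to [Lc] itself, with error zero. *)
Lemma Lc_second_eig mu : eigs_by_magnitude Lc mu -> mu`_1 = mu2.
Proof.
move=> hm; have h0 : opbound (Lc - Lc ^+ 1) 0.
  by move=> v; rewrite expr1 subrr mul0mx -(scale0r (0 : 'cV[R]_n)) vnormZ normr0 !mul0r.
have [_] := second_eig_perturb Lc_sym Lc_psd h0 hm.
by rewrite expr1 normr_le0 subr_eq0 => /eqP.
Qed.

(** Origin of the bracket in [B(T)]: the first two eigenvalues of [L] have magnitude at most 1, the
    second also at most [mu2 + M], and the others at most [M] because [Lc] vanishes orthogonally to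
    [one] and [signv]. *)
Lemma trace_pow_le (L : 'M[R]_n) k M : L^T = L -> opbound L 1 -> opbound (L - Lc) M ->
  \tr (L ^+ (2 * k)) <=
    1 + Num.min 1 (mu2 + M) ^+ (2 * k) + (n - 2)%:R * M ^+ (2 * k).
Proof.
move=> Ls L1 LM; have [e he] := eigs_exist Ls; have n1 := even_gt1.
rewrite (eigs_trace _ Ls he).
have LE v : L *m v = Lc *m v + (L - Lc) *m v by rewrite mulmxBl addrC subrK.
have e0 : `|e`_0| <= 1.
  by apply: (eig_le (F := 0 : 'M[R]_(0, n)) Ls he n0) => v _; exact: L1.
have e1 : `|e`_1| <= Num.min 1 (mu2 + M).
  rewrite le_min; apply/andP; split.
    by apply: (eig_le (F := 0 : 'M[R]_(1, n)) Ls he n1) => v _; exact: L1.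
  apply: (eig_le (F := one^T) Ls he n1) => v ov.
  have v1 : dotc one v = 0 by rewrite /dotc ov mxE.
  rewrite LE; apply: le_trans (vnormD _ _) _; rewrite mulrDl; apply: lerD; last exact: LM.
  by have := Lc_pow_le 1 v1; rewrite !expr1.
have e2 (i : nat) : (2 <= i < n)%N -> `|e`_i| <= M.
  move=> /andP[i2 i_n]; have n2 := leq_ltn_trans i2 i_n.
  apply: (@le_trans _ _ `|e`_2|); first by apply: (sorted_abs he); rewrite i2.
  apply: (eig_le (F := span_mx^T) Ls he n2) => v sv.
  suff -> : L *m v = (L - Lc) *m v by exact: LM.
  rewrite LE LcE.
  have uv y : dotc (span_mx *m y) v = 0 by rewrite dotc_mull sv dotc0r.
  have := uv (delta_mx 0 0); have := uv (delta_mx 1 0); rewrite !span_mxE !mxE /= !scale0r !scale1r.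
  by rewrite addr0 add0r => -> ->; rewrite !(mul0r, mulr0, scale0r, add0r).
have pw x c : `|x| <= c -> x ^+ (2 * k) <= c ^+ (2 * k) :> R.
  move=> xc; rewrite !exprM -(real_normK (num_real x)).
  have c0 : 0 <= c by exact: le_trans xc.
  by rewrite lerXn2r ?nnegrE ?sqr_ge0 // lerXn2r ?nnegrE.
rewrite -(big_mkord predT (fun i => e`_i ^+ (2 * k))).
rewrite (big_ltn n0) (big_ltn n1) addrA; apply: lerD.
  by apply: lerD; [rewrite -[leRHS](expr1n R (2 * k)); exact: pw|exact: pw].
rewrite mulr_natl -sumr_const_nat; rewrite !big_nat; apply: ler_sum => i hi; exact: pw (e2 i hi).
Qed.

(** Superadditivity [u^k + v^k <= (u + v)^k] on nonnegative reals gives [|z - y|^k <= |z^k - y^k|],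
    so the root is Holder continuous with constant 1. *)
Lemma root_diff (x y c : R) k : (0 < k)%N -> 0 <= x -> 0 <= y -> `|x - y ^+ k| <= c ->
  `|x `^ (k%:R)^-1 - y| <= c `^ (k%:R)^-1.
Proof.
move=> k0 x0 y0 h; set z := x `^ _.
have z0 : 0 <= z by exact: powR_ge0.
have kn : k%:R != 0 :> R by rewrite pnatr_eq0 -lt0n.
have zk : z ^+ k = x by rewrite -powR_mulrn // -powRrM mulVf // powRr1.
have sup (u v : R) j : 0 <= u -> 0 <= v -> (0 < j)%N -> u ^+ j + v ^+ j <= (u + v) ^+ j.
  move=> u0 v0; elim: j => // -[|j] IH _; first by rewrite !expr1.
  rewrite [u ^+ j.+2]exprS [v ^+ j.+2]exprS [leRHS]exprS.
  have := IH isT; have : 0 <= u ^+ j.+1 by rewrite exprn_ge0.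
  have : 0 <= v ^+ j.+1 by rewrite exprn_ge0.
  nra.
have dk : `|z - y| ^+ k <= `|z ^+ k - y ^+ k|.
  have [yz|/ltW zy] := leP y z.
    have := sup (z - y) y k; rewrite subrK subr_ge0 => /(_ yz y0 k0) q.
    rewrite ger0_norm ?subr_ge0 // ger0_norm; first by lra.
    by rewrite subr_ge0 lerXn2r ?nnegrE.
  have := sup (y - z) z k; rewrite subrK subr_ge0 => /(_ zy z0 k0) q.
  rewrite distrC [leRHS]distrC ger0_norm ?subr_ge0 // ger0_norm; first by lra.
  by rewrite subr_ge0 lerXn2r ?nnegrE.
rewrite zk in dk; have c0 : 0 <= c by exact: le_trans h.
have -> : `|z - y| = (`|z - y| ^+ k) `^ (k%:R)^-1.
  by rewrite -powR_mulrn // -powRrM mulfV // powRr1.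
by apply: ge0_ler_powR; rewrite ?nnegrE ?exprn_ge0 ?invr_ge0 // (le_trans dk h).
Qed.

(** Since [rho n = (a + b) / 2 = a / (mu2 + 1)], the error of [ahat] is [a / (mu2 + 1)] times the
    error of the root as an estimate of [mu2]. *)
Lemma relative_error (lam : R) (c : R) T : (1 <= T)%N -> 0 <= lam ->
  `|lam - mu2 ^+ (2 * T)| <= c ->
  let rho := (a + b) / (2 * n%:R) in
  let ahat := lam `^ (2 * T%:R)^-1 * rho * n%:R + rho * n%:R in
  `|ahat - a| / a <= c `^ (2 * T%:R)^-1 / (mu2 + 1).
Proof.
move=> T1 l0 h; cbv zeta; set rho := (a + b) / _; set ahat := _ + rho * _.
have a0 : 0 < a by exact: le_lt_trans ba.
have m1 : 0 < mu2 + 1 by have := mu2_gt0; lra.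
have ->: `|ahat - a| / a = `|lam `^ (2 * T%:R)^-1 - mu2| / (mu2 + 1).
  have -> : ahat - a = (lam `^ (2 * T%:R)^-1 - mu2) * (a / (mu2 + 1)).
    by rewrite /ahat /rho /mu2; field; rewrite !lt0r_neq0 //=; lra.
  rewrite normrM [`|a / _|]gtr0_norm ?divr_gt0 //; field; by rewrite !lt0r_neq0.
rewrite ler_pM2r ?invr_gt0 // -natrM; apply: root_diff => //; last exact: ltW mu2_gt0.
by rewrite muln_gt0.
Qed.

End Deterministic.

(** * Integrals of products over independent blocks *)

Section PiLambdaIndep.
Context {R : realType} {d} {Om : measurableType d} (P : probability Om R).
Local Open Scope ereal_scope.

(** For fixed [B] both sides are finite measures in [A] that agree on a pi-system containing the
    whole space. *)
Lemma pi_system_indep_half (G : set (set Om)) (B : set Om) :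
  G `<=` measurable -> setI_closed G -> G setT -> measurable B ->
  (forall A, G A -> P (A `&` B) = P A * P B) ->
  forall A, <<s G >> A -> P (A `&` B) = P A * P B.
Proof.
move=> Gm GI GT mB h.
have PB0 : (0 <= fine (P B))%R by rewrite fine_ge0.
have PBE : P B = (fine (P B))%:E by rewrite fineK // fin_num_measure.
pose m1 := mrestr P mB.
pose m2 := mscale (NngNum PB0) P.
have m12 A : m2 A = P A * P B by rewrite [in RHS]PBE muleC.
have cov : \bigcup_(k : nat) [set: Om] = setT.
  by apply/seteqP; split=> // x _; exists 0%N.
have := @g_sigma_algebra_measure_unique _ _ _ G Gm (fun=> setT) (fun=> GT) cov m1 m2 GI.
move=> H A sA; rewrite -m12; apply: H => // [C GC|k].
  by rewrite [RHS]m12; exact: h.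
by rewrite /m1 /= /mrestr setTI (le_lt_trans (probability_le1 P mB)) // ltry.
Qed.

Lemma pi_system_indep (G1 G2 : set (set Om)) :
  G1 `<=` measurable -> setI_closed G1 -> G1 setT ->
  G2 `<=` measurable -> setI_closed G2 -> G2 setT ->
  (forall A B, G1 A -> G2 B -> P (A `&` B) = P A * P B) ->
  forall A B, <<s G1 >> A -> <<s G2 >> B -> P (A `&` B) = P A * P B.
Proof.
move=> m1 I1 T1 m2 I2 T2 h A B sA sB.
have sm G : G `<=` measurable -> <<s G >> `<=` @measurable _ Om.
  by move=> Gm; apply: smallest_sub => //; exact: sigma_algebra_measurable.
rewrite setIC muleC; apply: (pi_system_indep_half m2 I2 T2 (sm _ m1 _ sA)) => // C G2C.
rewrite setIC muleC; apply: (pi_system_indep_half m1 I1 T1 (m2 _ G2C)) => //.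
by move=> D G1D; apply: h.
Qed.

(** Independence makes the law of the pair a product measure. Tonelli's theorem asks only for
    nonnegativity, so exponentials are allowed before their integrability is known. *)
Lemma indep_map_integral d1 d2 (T1 : measurableType d1) (T2 : measurableType d2)
    (X1 : {mfun Om >-> T1}) (X2 : {mfun Om >-> T2}) (f1 : T1 -> R) (f2 : T2 -> R) :
  (forall A B, measurable A -> measurable B ->
     P (X1 @^-1` A `&` X2 @^-1` B) = P (X1 @^-1` A) * P (X2 @^-1` B)) ->
  measurable_fun setT f1 -> measurable_fun setT f2 ->
  (forall w, (0 <= f1 w)%R) -> (forall w, (0 <= f2 w)%R) ->
  \int[P]_w (f1 (X1 w) * f2 (X2 w))%:E =
  (\int[P]_w (f1 (X1 w))%:E) * (\int[P]_w (f2 (X2 w))%:E).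
Proof.
move=> h mf1 mf2 f10 f20.
have mpair : measurable_fun setT (fun w => (X1 w, X2 w)).
  by apply/measurable_fun_pairP; split; exact: measurable_funPT.
pose X12 : {mfun Om >-> (T1 * T2)%type} :=
  HB.pack (fun w => (X1 w, X2 w)) (isMeasurableFun.Build _ _ _ _ _ mpair).
have E A : measurable A -> (distribution P X1 \x distribution P X2) A = distribution P X12 A.
  by apply: product_measure_unique => B1 B2 mB1 mB2; exact: h.
pose F := fun z : (T1 * T2)%type => (f1 z.1 * f2 z.2)%:E.
have mF : measurable_fun [set: (T1 * T2)%type] F.
  apply/measurable_EFinP; apply: measurable_funM; exact: measurableT_comp.
have F0 z : 0 <= F z by rewrite lee_fin mulr_ge0.
transitivity (\int[distribution P X12]_z F z); first by rewrite ge0_integral_distribution.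
rewrite -(@eq_measure_integral _ _ _ _ _ (distribution P X1 \x distribution P X2)); last first.
  by move=> A mA _; exact: E.
rewrite fubini_tonelli1 // /fubini_F /F.
transitivity (\int[distribution P X1]_x ((f1 x)%:E * \int[distribution P X2]_y (f2 y)%:E)).
  apply: eq_integral => x _ /=.
  under eq_integral do rewrite EFinM.
  rewrite ge0_integralZl ?lee_fin //; first exact/measurable_EFinP.
  by move=> y _; rewrite lee_fin.
have i2 : 0 <= \int[distribution P X2]_y (f2 y)%:E.
  by apply: integral_ge0 => y _; rewrite lee_fin.
have mE1 : measurable_fun setT (fun x => (f1 x)%:E) by exact/measurable_EFinP.
have mE2 : measurable_fun setT (fun x => (f2 x)%:E) by exact/measurable_EFinP.
rewrite (@ge0_integralZr _ _ _ _ _ measurableT _ mE1 _ _ i2); last by move=> x _; rewrite lee_fin.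
by rewrite !ge0_integral_distribution.
Qed.

Lemma indep_integral_mul (G1 G2 : set (set Om)) (f1 f2 : Om -> R) :
  G1 `<=` measurable -> setI_closed G1 -> G1 setT ->
  G2 `<=` measurable -> setI_closed G2 -> G2 setT ->
  (forall A B, G1 A -> G2 B -> P (A `&` B) = P A * P B) ->
  measurable_fun setT (f1 : g_sigma_algebraType G1 -> R) ->
  measurable_fun setT (f2 : g_sigma_algebraType G2 -> R) ->
  (forall w, (0 <= f1 w)%R) -> (forall w, (0 <= f2 w)%R) ->
  \int[P]_w (f1 w * f2 w)%:E = (\int[P]_w (f1 w)%:E) * (\int[P]_w (f2 w)%:E).
Proof.
move=> m1 I1 T1 m2 I2 T2 h mf1 mf2 f10 f20.
(* The identity, with a smaller sigma-algebra on its target, turns independence of sigma-algebras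
   into independence of two random elements. *)
have mid G : G `<=` measurable -> measurable_fun setT (id : Om -> g_sigma_algebraType G).
  move=> Gm _ A mA; rewrite setTI.
  by apply: (smallest_sub _ Gm) mA; exact: sigma_algebra_measurable.
pose X1 : {mfun Om >-> g_sigma_algebraType G1} :=
  HB.pack (id : Om -> g_sigma_algebraType G1) (isMeasurableFun.Build _ _ _ _ _ (mid _ m1)).
pose X2 : {mfun Om >-> g_sigma_algebraType G2} :=
  HB.pack (id : Om -> g_sigma_algebraType G2) (isMeasurableFun.Build _ _ _ _ _ (mid _ m2)).
apply: (@indep_map_integral _ _ _ _ X1 X2) => // A B mA mB.
exact: (pi_system_indep m1 I1 T1 m2 I2 T2 h mA mB).
Qed.

End PiLambdaIndep.

(** * Sigma-algebras generated by independent blocks *)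

Section Blocks.
Context {R : realType} {d} {Om : measurableType d} (P : probability Om R).
Context {K J : finType} (S : {pred K}) (X : K -> J -> Om -> R).
Hypothesis mX : forall k j, measurable_fun setT (X k j).
Hypothesis indX : indep_blocks P S X.
Local Open Scope ereal_scope.

Definition box (B : K -> J -> set R) (k : K) : set Om :=
  \bigcap_(j in [set: J]) (X k j @^-1` B k j).
(** Cylinder events on the blocks listed in [s]: a pi-system generating the sigma-algebra of those
    blocks. *)
Definition boxes (s : seq K) : set (set Om) :=
  [set E | exists2 B : K -> J -> set R, (forall k j, measurable (B k j)) &
     E = \bigcap_(k in [set k | k \in s]) box B k].

Lemma box_measurable B k : (forall k j, measurable (B k j)) -> measurable (box B k).
Proof.
move=> mB; apply: fin_bigcap_measurable => // j _.
by rewrite -[X in measurable X]setTI; exact: mX.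
Qed.

Lemma boxes_measurable s : boxes s `<=` measurable.
Proof.
move=> _ [B mB ->]; apply: fin_bigcap_measurable => // k _; exact: box_measurable.
Qed.

Lemma boxesI s : setI_closed (boxes s).
Proof.
move=> _ _ [B mB ->] [C mC ->]; exists (fun k j => B k j `&` C k j).
  by move=> k j; exact: measurableI.
rewrite -bigcapI; apply: eq_bigcapr => k _; rewrite -bigcapI.
by apply: eq_bigcapr => j _; rewrite preimage_setI.
Qed.

Lemma boxesT s : boxes s setT.
Proof.
exists (fun _ _ => setT) => //; apply/esym/seteqP; split=> // w _ k _ j _ //.
Qed.

(** Blocks outside [s] receive the full space, whose factor is 1. *)
Lemma indep_boxes B (s : seq K) : uniq s -> {subset s <= S} ->
  (forall k j, measurable (B k j)) ->
  P (\bigcap_(k in [set k | k \in s]) box B k) = \prod_(k <- s) P (box B k).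
Proof.
move=> us sS mB.
pose C k j := if k \in s then B k j else setT.
have mC k j : measurable (C k j) by rewrite /C; case: ifP.
have CE k : box C k = if k \in s then box B k else setT.
  rewrite /box /C; case: ifP => // _; apply/seteqP; split=> // w _ j _ //.
have -> : \bigcap_(k in [set k | k \in s]) box B k = \bigcap_(k in [set k | k \in S]) box C k.
  apply/seteqP; split=> w h k /= kS; rewrite ?CE.
    by case: ifP => // ks; exact: h.
  by have := h k (sS _ kS); rewrite CE kS.
rewrite [LHS](indX mC) big_uniq //.
rewrite (eq_bigr (fun k => if k \in s then P (box B k) else 1)); last first.
  move=> k _; rewrite -/(box C k) CE; case: ifP => // _; exact: probability_setT.
rewrite -big_mkcondr; apply: eq_bigl => k; apply/andP/idP => [[]//|ks].
by split=> //; exact: sS.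
Qed.

Lemma boxes_sub s t : {subset s <= t} -> boxes s `<=` boxes t.
Proof.
move=> st _ [B mB ->]; exists (fun k j => if k \in s then B k j else setT).
  by move=> k j; case: ifP.
apply/seteqP; split=> w h k /= ks j _ /=.
  by case: ifP => // ks'; exact: h.
by have := h k (st _ ks) j I; rewrite /= ks.
Qed.

Lemma boxes_measurable_fun s t (f : Om -> R) : {subset s <= t} ->
  measurable_fun setT (f : g_sigma_algebraType (boxes s) -> R) ->
  measurable_fun setT (f : g_sigma_algebraType (boxes t) -> R).
Proof.
move=> st mf _ B mB; apply: (@smallest_sub _ _ (boxes s)); last exact: (mf measurableT B mB).
- exact: smallest_sigma_algebra.
- by move=> A /(boxes_sub st) hA; exact: sub_gen_smallest.
Qed.

Lemma boxes_coord k j : measurable_fun setT (X k j : g_sigma_algebraType (boxes [:: k]) -> R).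
Proof.
move=> _ B mB; rewrite setTI; apply: sub_gen_smallest.
exists (fun k' j' => if (k' == k) && (j' == j) then B else setT).
  by move=> k' j'; case: ifP.
apply/seteqP; split=> w.
  by move=> h k' /= k's j' _ /=; case: ifP => // /andP[/eqP -> /eqP ->].
by move=> /(_ k); rewrite /= inE eqxx => /(_ isT j I); rewrite /= !eqxx.
Qed.

(** Induction on the list: the head block is independent of the sigma-algebra generated by the
    rest. *)
Lemma indep_blocks_integral (f : K -> Om -> R) (s : seq K) : uniq s -> {subset s <= S} ->
  (forall k w, (0 <= f k w)%R) ->
  (forall k, measurable_fun setT (f k : g_sigma_algebraType (boxes [:: k]) -> R)) ->
  \int[P]_w (\prod_(k <- s) f k w)%:E = \prod_(k <- s) \int[P]_w (f k w)%:E.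
Proof.
move=> us sS f0 mf; elim: s us sS => [_ _|k s IH /= /andP[ks us] sS].
  rewrite big_nil; under eq_integral do rewrite big_nil.
  by rewrite integral_cst // mul1e; exact: probability_setT.
have sS' : {subset s <= S} by move=> i hi; apply: sS; rewrite inE hi orbT.
rewrite big_cons -IH //; under eq_integral do rewrite big_cons.
apply: (@indep_integral_mul _ _ _ P (boxes [:: k]) (boxes s)) => //.
- exact: boxes_measurable.
- exact: boxesI.
- exact: boxesT.
- exact: boxes_measurable.
- exact: boxesI.
- exact: boxesT.
- move=> _ _ [B mB ->] [C mC ->].
  (* Conditions on the head and on the tail merge into one family, without conflict because [k] is
     not in [s]. *)
  pose D k' j := if k' == k then B k' j else C k' j.
  have mD k' j : measurable (D k' j) by rewrite /D; case: ifP.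
  have Dk : box D k = box B k by rewrite /box /D eqxx.
  have Ds k' : k' \in s -> box D k' = box C k'.
    move=> k's; apply: eq_bigcapr => j _; rewrite /D ifF //.
    by apply: contraNF ks => /eqP <-.
  have b1 : \bigcap_(k0 in [set k0 | k0 \in [:: k]]) box B k0 = box D k.
    rewrite Dk; apply/seteqP; split=> w; first by move=> /(_ k); apply; rewrite /= inE.
    by move=> h k' /=; rewrite inE => /eqP ->.
  have b2 : \bigcap_(k0 in [set k0 | k0 \in s]) box C k0 = \bigcap_(k0 in [set k0 | k0 \in s]) box D k0.
    by apply: eq_bigcapr => k' k's; rewrite Ds.
  rewrite b1 b2 (indep_boxes us sS' mD).
  have := @indep_boxes D (k :: s) _ sS mD; rewrite big_cons /= ks us => /(_ isT) <-.
  congr (P _); apply/seteqP; split=> w.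
    by move=> [h1 h2] k' /=; rewrite inE => /orP[/eqP ->//|]; exact: h2.
  move=> h; split; first by apply: h; rewrite /= inE eqxx.
  by move=> k' k's; apply: h; rewrite /= inE; apply/orP; right.
- apply: measurable_prod => i hi; apply: boxes_measurable_fun (mf i).
  by move=> x; rewrite inE => /eqP ->.
- by move=> w; apply: prodr_ge0.
Qed.

End Blocks.

(** * Sub-exponential estimates *)

Section Bernstein.
Context {R : realType}.

Lemma expR_le_of_series (x c : R) :
  (forall n, \sum_(0 <= i < n) `|x| ^+ i.+2 / i.+2`!%:R <= c) ->
  expR x <= 1 + x + c.
Proof.
move=> h; rewrite /expR; apply: limr_le; first exact: is_cvg_series_exp_coeff.
exists 2%N => // -[|[|n]] //= _.
rewrite /series /= big_nat_recl // big_nat_recl // /exp_coeff /= addrA.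
rewrite expr0 expr1 !divr1 lerD2l; apply: le_trans (h n).
apply: ler_sum => i _; rewrite ler_wpM2r ?invr_ge0 //.
by rewrite -normrX ler_norm.
Qed.

Lemma geometric_tail_le (q : R) n : 0 <= q <= 1 / 2 ->
  \sum_(0 <= i < n) q ^+ i.+2 <= 2 * q ^+ 2.
Proof.
move=> /andP[q0 q1].
have h : \sum_(0 <= i < n) q ^+ i <= 2 - 2 * (1 / 2) ^+ n.
  elim: n => [|n IH]; first by rewrite big_geq // expr0; lra.
  rewrite big_nat_recr //= exprS.
  have : q ^+ n <= (1 / 2) ^+ n by apply: lerXn2r; rewrite ?nnegrE //; lra.
  lra.
rewrite (eq_bigr (fun i => q ^+ 2 * q ^+ i)); last by move=> i _; rewrite -exprD add2n.
rewrite -mulr_sumr mulrC ler_wpM2r ?sqr_ge0 //.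
apply: le_trans h _; have : 0 <= (1 / 2) ^+ n :> R by apply: exprn_ge0; lra.
lra.
Qed.

Context {d} {Om : measurableType d} (P : probability Om R).

(** With [E |xi|^m <= m! H^m] for [m >= 2], the series of [expR y - 1 - y] integrates to at most a
    geometric one in [q = |th| H <= 1/2], of sum at most [2 q^2]. The linear term is kept exact, so
    centring by [r] cancels it. *)
Lemma bernstein_mgf (xi : Om -> R) (r H th : R) :
  measurable_fun setT xi -> P.-integrable setT (EFin \o xi) ->
  (\int[P]_w (xi w)%:E = r%:E)%E ->
  0 <= H -> (forall m, (\int[P]_w (`|xi w| ^+ m.+2)%:E <= (m.+2`!%:R * H ^+ m.+2)%:E)%E) ->
  `|th| * H <= 1 / 2 ->
  (\int[P]_w (expR (th * (xi w - r)))%:E <= (expR (2 * H ^+ 2 * th ^+ 2))%:E)%E.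
Proof.
move=> mxi ixi xir H0 hm hth.
pose q := `|th| * H; have q0 : 0 <= q by rewrite mulr_ge0.
pose f (n : nat) (w : Om) : \bar R := (`|th * xi w| ^+ n.+2 / n.+2`!%:R)%:E.
have f0 n w : (0 <= f n w)%E by rewrite lee_fin divr_ge0 // exprn_ge0.
have mabs k : measurable_fun setT (fun w => `|th * xi w| ^+ k).
  by apply: measurable_funX; apply: measurableT_comp => //; exact: measurable_funM.
have mf n : measurable_fun setT (f n).
  by apply/measurable_EFinP; apply: measurable_funM.
(* The remainder is nonnegative, so its integral can be bounded before [expR] is known to be
   integrable. *)
pose g w := expR (th * xi w) - 1 - th * xi w.
have g0 w : 0 <= g w by rewrite /g; have := expR_ge1Dx (th * xi w); lra.
have mth : measurable_fun setT (fun w => th * xi w) by exact: measurable_funM.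
have mg : measurable_fun setT g.
  by apply: measurable_funB => //; apply: measurable_funB => //; exact: measurableT_comp.
have gf w : ((g w)%:E <= \sum_(n <oo) f n w)%E.
  case E : (\sum_(n <oo) f n w)%E => [c| |]; last 2 first.
  - exact: leey.
  - have : (0 <= \sum_(n <oo) f n w)%E by apply: nneseries_ge0 => *; exact: f0.
    by rewrite E.
  rewrite lee_fin /g; suff : expR (th * xi w) <= 1 + th * xi w + c by lra.
  apply: expR_le_of_series => n; rewrite -lee_fin -E -sumEFin.
  by apply: nneseries_lim_ge => *; exact: f0.
have ig : (\int[P]_w (g w)%:E <= (2 * q ^+ 2)%:E)%E.
  apply: (@le_trans _ _ (\int[P]_w (\sum_(n <oo) f n w))%E).
    apply: ge0_le_integral => //; first by move=> w _; rewrite lee_fin.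
    - exact/measurable_EFinP.
    - by apply: ge0_emeasurable_sum.
  rewrite integral_nneseries //; apply: lime_le.
    by apply: is_cvg_nneseries => n _ _; apply: integral_ge0.
  near=> n; apply: (@le_trans _ _ (\sum_(0 <= i < n) (q ^+ i.+2)%:E)%E).
    apply: lee_sum => i _.
    have -> : (\int[P]_w f i w = (`|th| ^+ i.+2 / i.+2`!%:R)%:E * \int[P]_w (`|xi w| ^+ i.+2)%:E)%E.
      have mE : measurable_fun setT (fun w => (`|xi w| ^+ i.+2)%:E).
        by apply/measurable_EFinP; apply: measurable_funX; exact: measurableT_comp.
      have c0 : (0 <= (`|th| ^+ i.+2 / i.+2`!%:R)%:E)%E by rewrite lee_fin divr_ge0 ?exprn_ge0.
      rewrite -(@ge0_integralZl _ _ _ P _ measurableT _ mE _ _ c0); last first.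
        by move=> w _; rewrite lee_fin exprn_ge0.
      by apply: eq_integral => w _; rewrite /f -EFinM normrM exprMn; congr (_%:E); ring.
    apply: le_trans (lee_wpmul2l _ (hm i)) _; first by rewrite lee_fin divr_ge0 ?exprn_ge0.
    rewrite -EFinM lee_fin /q exprMn le_eqVlt; apply/orP; left; apply/eqP.
    by field; rewrite pnatr_eq0 -lt0n fact_gt0.
  by rewrite sumEFin lee_fin; apply: geometric_tail_le; rewrite q0.
have igi : P.-integrable setT (EFin \o g).
  apply/integrableP; split; first exact/measurable_EFinP.
  under eq_integral => w _ do rewrite /= ger0_norm //.
  by rewrite (le_lt_trans ig) // ltry.
have il : P.-integrable setT (EFin \o (fun w => 1 + th * xi w)).
  rewrite (_ : _ \o _ = (cst 1 \+ (fun w => th%:E * (xi w)%:E))%E); last by apply/funext => w; rewrite /= EFinD EFinM.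
  apply: integrableD => //; first exact: finite_measure_integrable_cst.
  exact: integrableZl.
have ie : (\int[P]_w (expR (th * xi w))%:E <= (1 + th * r + 2 * q ^+ 2)%:E)%E.
  have -> : (\int[P]_w (expR (th * xi w))%:E = \int[P]_w ((1 + th * xi w)%:E + (g w)%:E))%E.
    by apply: eq_integral => w _; rewrite -EFinD /g; congr (_%:E); ring.
  rewrite integralD // EFinD; apply: leeD => //.
  rewrite le_eqVlt; apply/orP; left; apply/eqP.
  under eq_integral do rewrite EFinD EFinM.
  rewrite integralD //; [|exact: finite_measure_integrable_cst|exact: integrableZl].
  rewrite integralZl // xir integral_cst // mul1e.
  by rewrite EFinD EFinM; congr (_ + _)%E; exact: probability_setT.
have -> : (\int[P]_w (expR (th * (xi w - r)))%:E =
    (expR (- (th * r)))%:E * \int[P]_w (expR (th * xi w))%:E)%E.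
  have mE : measurable_fun setT (fun w => (expR (th * xi w))%:E).
    by apply/measurable_EFinP; exact: measurableT_comp.
  have c0 : (0 <= (expR (- (th * r)))%:E)%E by rewrite lee_fin expR_ge0.
  rewrite -(@ge0_integralZl _ _ _ P _ measurableT _ mE _ _ c0); last first.
    by move=> w _; rewrite lee_fin expR_ge0.
  by apply: eq_integral => w _; rewrite -EFinM -expRD; congr ((expR _)%:E); ring.
apply: le_trans (lee_wpmul2l _ ie) _; first by rewrite lee_fin expR_ge0.
rewrite -EFinM lee_fin.
have q2 : 2 * q ^+ 2 = 2 * H ^+ 2 * th ^+ 2.
  by rewrite /q exprMn real_normK ?num_real //; ring.
rewrite -q2 expRN ler_pdivrMl ?expR_gt0 // -expRD.
by apply: le_trans (expR_ge1Dx _); rewrite addrA.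
Unshelve. all: by end_near.
Qed.

End Bernstein.

(** * Moments from the psi2 norm *)

Section Psi2.
Context {R : realType} {d} {Om : measurableType d} (P : probability Om R).

(** The exponent [p = m] in the supremum bounds the [m]-th root of the moment by [sqrt m] times the
    norm, and the hypothesis bounds the norm by [1 / sqrt c0]. *)
Lemma psi2_moment (X : Om -> R) (c0 : R) (m : nat) : 0 < c0 ->
  (psi2_norm P X < +oo)%E ->
  (c0%:E * (psi2_norm P X * psi2_norm P X) <= 1)%E -> (0 < m)%N ->
  (\int[P]_w (`|X w| ^+ m)%:E <= ((Num.sqrt m%:R / Num.sqrt c0) ^+ m)%:E)%E.
Proof.
move=> c00 fin hc m0.
have mR : 0 < m%:R :> R by rewrite ltr0n.
set q : R := Num.sqrt m%:R.
have q0 : 0 < q by rewrite sqrtr_gt0.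
have qE : m%:R `^ (- 2^-1) = q^-1 :> R by rewrite powRN powR12_sqrt // ltW.
set v := (\int[P]_w (`|X w| ^+ m)%:E)%E.
have v0 : (0 <= v)%E by apply: integral_ge0 => w _; rewrite lee_fin exprn_ge0.
have ub : ((q^-1)%:E * v `^ (m%:R^-1) <= psi2_norm P X)%E.
  apply: ereal_sup_ubound; exists m%:R; first by rewrite /= ler1n.
  rewrite qE; congr (_ * (_ `^ _))%E.
  by apply: eq_integral => w _; rewrite powR_mulrn.
have psi0 : (0 <= psi2_norm P X)%E.
  by apply: le_trans ub; rewrite mule_ge0 ?poweR_ge0 // lee_fin invr_ge0 ltW.
case: (psi2_norm P X) fin hc ub psi0 => [f| |] // _ hc ub f0.
rewrite -!EFinM lee_fin in hc; rewrite lee_fin in f0.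
have fK : f <= (Num.sqrt c0)^-1.
  rewrite -(@ler_pXn2r _ 2) ?nnegrE ?invr_ge0 ?sqrtr_ge0 // exprVn sqr_sqrtr ?(ltW c00) //.
  by rewrite -[leRHS]mul1r ler_pdivlMr // mulrC expr2.
case: v v0 ub => [x| |] //; last first.
  by rewrite poweRyr ?invr_eq0 ?(gt_eqF mR) // mulry gtr0_sg ?invr_gt0 // mul1e.
rewrite !lee_fin => x0; rewrite ler_pdivrMl // => hx.
have <- : (x `^ m%:R^-1) ^+ m = x.
  by rewrite -powR_mulrn ?powR_ge0 // -powRrM mulVf ?gt_eqF // powRr1.
apply: lerXn2r; rewrite ?nnegrE ?powR_ge0 //.
  by rewrite divr_ge0 ?sqrtr_ge0.
by apply: le_trans hx _; rewrite ler_wpM2l // ltW.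
Qed.

(** [m^m / m!] is one term of the series of [expR m], and [expR 1 <= 3]. *)
Lemma pow_le_fact (m : nat) : m%:R ^+ m <= 3 ^+ m * m`!%:R :> R.
Proof.
have e3 := @expR1_le3 R.
case: m => [|m]; first by rewrite !expr0 mul1r.
have := @expR_ge1Dxn R m.+1%:R m (ler0n _ _).
rewrite -[X in expR X]mul1r expRM_natr => h.
have f0 : 0 < m.+1`!%:R :> R by rewrite ltr0n fact_gt0.
rewrite -ler_pdivrMr //.
have h3 : expR 1 ^+ m.+1 <= 3 ^+ m.+1 :> R by apply: lerXn2r; rewrite ?nnegrE ?expR_ge0.
by apply: le_trans h3; apply: le_trans h; rewrite lerDr.
Qed.

(* [bconst] dominates both [e / sqrt c0], for linear forms, and [2 e / c0], for
   products of two linear forms; [e] is replaced by 3. *)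
Definition bconst (c0 : R) : R := 3 / Num.sqrt c0 + 6 / c0.

Lemma bconst_gt0 (c0 : R) : 0 < c0 -> 0 < bconst c0.
Proof. by move=> h; rewrite addr_gt0 // divr_gt0 // sqrtr_gt0. Qed.

Lemma psi2_moment1 (X : Om -> R) (c0 : R) (m : nat) : 0 < c0 ->
  (psi2_norm P X < +oo)%E ->
  (c0%:E * (psi2_norm P X * psi2_norm P X) <= 1)%E -> (0 < m)%N ->
  (\int[P]_w (`|X w| ^+ m)%:E <= (m`!%:R * bconst c0 ^+ m)%:E)%E.
Proof.
move=> c00 fin hc m0; apply: le_trans (psi2_moment c00 fin hc m0) _.
rewrite lee_fin exprMn.
have k0 : 0 < Num.sqrt c0 by rewrite sqrtr_gt0.
have hs : Num.sqrt m%:R ^+ m <= 3 ^+ m * m`!%:R :> R.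
  apply: le_trans (pow_le_fact m); apply: lerXn2r; rewrite ?nnegrE ?sqrtr_ge0 //.
  rewrite -(@ler_pXn2r _ 2) ?nnegrE ?sqrtr_ge0 // sqr_sqrtr // -natrX ler_nat.
  by rewrite -[leqLHS]expn1 leq_pexp2l.
apply: (@le_trans _ _ (3 ^+ m * m`!%:R * (Num.sqrt c0)^-1 ^+ m)).
  by rewrite ler_wpM2r // exprn_ge0 // invr_ge0 ltW.
have b0 : 0 <= 3 / Num.sqrt c0 by rewrite divr_ge0 // ltW.
have b1 : 0 <= 6 / c0 by rewrite divr_ge0 // ltW.
rewrite mulrAC -exprMn mulrC ler_wpM2l //.
by apply: lerXn2r; rewrite ?nnegrE /bconst; lra.
Qed.

(** [|X Y|^m <= (X^(2m) + Y^(2m)) / 2] and [(2m)^m <= 6^m m!]: a product of two sub-Gaussian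
    variables is sub-exponential. *)
Lemma psi2_moment2 (X Y : Om -> R) (c0 : R) (m : nat) : 0 < c0 ->
  measurable_fun setT X -> measurable_fun setT Y ->
  (psi2_norm P X < +oo)%E -> (c0%:E * (psi2_norm P X * psi2_norm P X) <= 1)%E ->
  (psi2_norm P Y < +oo)%E -> (c0%:E * (psi2_norm P Y * psi2_norm P Y) <= 1)%E ->
  (0 < m)%N ->
  (\int[P]_w (`|X w * Y w| ^+ m)%:E <= (m`!%:R * bconst c0 ^+ m)%:E)%E.
Proof.
move=> c00 mX mY fX cX fY cY m0.
have m20 : (0 < 2 * m)%N by rewrite muln_gt0.
have k0 : 0 < Num.sqrt c0 by rewrite sqrtr_gt0.
have B2 : (Num.sqrt (2 * m)%:R / Num.sqrt c0) ^+ (2 * m) <= m`!%:R * bconst c0 ^+ m.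
  have sq : (Num.sqrt (2 * m)%:R / Num.sqrt c0) ^+ 2 = 2 * m%:R / c0.
    by rewrite expr_div_n !sqr_sqrtr ?(ltW c00) // natrM.
  rewrite exprM sq !exprMn.
  apply: (@le_trans _ _ (2 ^+ m * (3 ^+ m * m`!%:R) * c0^-1 ^+ m)).
    rewrite ler_wpM2r ?exprn_ge0 ?invr_ge0 ?(ltW c00) //.
    by rewrite ler_wpM2l ?exprn_ge0 // pow_le_fact.
  have b0 : 0 <= 3 / Num.sqrt c0 by rewrite divr_ge0 // ltW.
  have b1 : 0 <= c0^-1 by rewrite invr_ge0 ltW.
  rewrite mulrA -exprMn mulrAC -exprMn mulrC ler_wpM2l //.
  by apply: lerXn2r; rewrite ?nnegrE /bconst; lra.
have mp (Z : Om -> R) : measurable_fun setT Z -> measurable_fun setT (fun w : Om => (`|Z w| ^+ (2 * m) / 2)%:E).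
  move=> mZ; apply/measurable_EFinP; apply: measurable_funM => //.
  by apply: measurable_funX; exact: measurableT_comp.
apply: (@le_trans _ _ (\int[P]_w ((`|X w| ^+ (2 * m) / 2)%:E + (`|Y w| ^+ (2 * m) / 2)%:E))%E).
  apply: ge0_le_integral => //.
  - apply/measurable_EFinP; apply: measurable_funX; apply: measurableT_comp => //.
    exact: measurable_funM.
  - by apply: emeasurable_funD; exact: mp.
  move=> w _; rewrite -EFinD lee_fin normrM exprMn !(mulnC 2) !exprM.
  have := sqr_ge0 (`|X w| ^+ m - `|Y w| ^+ m); rewrite sqrrB; lra.
rewrite ge0_integralD //; [|exact: mp|exact: mp].
have half (Z : Om -> R) : measurable_fun setT Z -> (psi2_norm P Z < +oo)%E ->
    (c0%:E * (psi2_norm P Z * psi2_norm P Z) <= 1)%E ->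
    (\int[P]_w (`|Z w| ^+ (2 * m) / 2)%:E <= (m`!%:R * bconst c0 ^+ m / 2)%:E)%E.
  move=> mZ fZ cZ.
  have mE : measurable_fun setT (fun w => (`|Z w| ^+ (2 * m))%:E).
    by apply/measurable_EFinP; apply: measurable_funX; exact: measurableT_comp.
  under eq_integral do rewrite EFinM.
  rewrite ge0_integralZr //.
  rewrite [leRHS]EFinM; apply: lee_wpmul2r; first by rewrite lee_fin invr_ge0.
  apply: le_trans (psi2_moment c00 fZ cZ m20) _.
  by rewrite lee_fin.
apply: le_trans (leeD (half _ mX fX cX) (half _ mY fY cY)) _.
rewrite -EFinD lee_fin; lra.
Qed.

End Psi2.

Lemma measurable_gt_set {R : realType} {d} {Om : measurableType d} (f : Om -> R) (c : R) :
  measurable_fun setT f -> measurable [set w | c < f w].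
Proof.
move=> mf; rewrite -[X in measurable X]setTI.
rewrite (_ : [set w | c < f w] = f @^-1` `]c, +oo[); first exact: mf.
by apply/seteqP; split=> w /=; rewrite in_itv /= andbT.
Qed.

(** * Dimension-free tail for weighted sums of squares *)

Section WeightedTail.
Context {R : realType}.

(** Jensen's inequality by the tangent line at [mu]. Total mass [W < 1] only helps: it leaves the
    surplus [m mu^(m+1) (1 - W)]. *)
Lemma weighted_pow_le (I : finType) (w x : I -> R) m :
  (forall i, 0 <= w i) -> (forall i, 0 <= x i) -> \sum_i w i <= 1 ->
  (\sum_i w i * x i) ^+ m.+1 <= \sum_i w i * x i ^+ m.+1.
Proof.
move=> w0 x0 w1; set mu := \sum_i w i * x i.
have mu0 : 0 <= mu by apply: sumr_ge0 => i _; rewrite mulr_ge0.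
have tan i : mu ^+ m.+1 + m.+1%:R * mu ^+ m * (x i - mu) <= x i ^+ m.+1.
  have := young_pow m (x0 i) mu0; rewrite !(exprS mu) -natr1; lra.
apply: (@le_trans _ _ (\sum_i w i * (mu ^+ m.+1 + m.+1%:R * mu ^+ m * (x i - mu)))); last first.
  by apply: ler_sum => i _; rewrite ler_wpM2l.
have -> : \sum_i w i * (mu ^+ m.+1 + m.+1%:R * mu ^+ m * (x i - mu)) =
   (\sum_i w i) * (mu ^+ m.+1 - m.+1%:R * mu ^+ m * mu) + m.+1%:R * mu ^+ m * mu.
  rewrite mulr_suml.
  rewrite (eq_bigr (fun i => w i * (mu ^+ m.+1 - m.+1%:R * mu ^+ m * mu) + m.+1%:R * mu ^+ m * (w i * x i))).
    by rewrite big_split -mulr_sumr -/mu /=; ring.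
  by move=> i _; ring.
have : 0 <= mu ^+ m.+1 by rewrite exprn_ge0.
set W := \sum_i w i in w1 *; rewrite exprSr -[_ * _ * mu]mulrA.
set z := mu ^+ m * mu => z0.
have : 0 <= m%:R * z * (1 - W) by apply: mulr_ge0; [exact: mulr_ge0|rewrite subr_ge0].
rewrite -natr1; lra.
Qed.

Lemma even_pow_le_exp (y l : R) m : 0 < l ->
  y ^+ (2 * m.+1) <= (2 * m.+1)`!%:R / l ^+ (2 * m.+1) * (expR (l * y) + expR (- (l * y))).
Proof.
move=> l0; set k := (2 * m.+1)%N.
have kE : k = (2 * m).+1.+1 by rewrite /k mulnS.
have f0 : 0 < k`!%:R :> R by rewrite ltr0n fact_gt0.
have lk : 0 < l ^+ k by rewrite exprn_gt0.
have yE : y ^+ k = `|y| ^+ k by rewrite /k !exprM real_normK ?num_real.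
have h : (l * `|y|) ^+ k / k`!%:R <= expR (l * `|y|).
  have ly0 : 0 <= l * `|y| by rewrite mulr_ge0 // ltW.
  by apply: le_trans (expR_ge1Dxn (2 * m).+1 ly0); rewrite kE lerDr.
have h2 : expR (l * `|y|) <= expR (l * y) + expR (- (l * y)).
  case: (ger0P y) => _; first by rewrite lerDl expR_ge0.
  by rewrite mulrN lerDr expR_ge0.
have := le_trans h h2; rewrite ler_pdivrMr // exprMn mulrC -ler_pdivlMr // -yE.
by move=> /le_trans; apply; rewrite le_eqVlt; apply/orP; left; apply/eqP; ring.
Qed.

Context {d} {Om : measurableType d} (P : probability Om R).

(** Markov's inequality for the power [m+1] of the weighted sum. Jensen moves the power inside, and
    the bounds for the separate [Y i] are averaged instead of added, so their number does not
    appear. The indicator of [D] plays the part of conditioning. *)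
Lemma weighted_tail (I : finType) (v : I -> R) (Y : I -> Om -> R) (D : set Om)
   (l t B : R) (m : nat) :
  (forall i, 0 <= v i) -> \sum_i v i <= 1 -> 0 < l -> 0 < t -> 0 <= B ->
  (forall i, measurable_fun setT (Y i)) -> measurable D ->
  (forall i e, e = 1 \/ e = -1 ->
     (\int[P]_w (\1_D w * expR (e * l * Y i w))%:E <= P D * B%:E)%E) ->
  (P (D `&` [set w | (t ^+ 2 < \sum_i v i * Y i w ^+ 2)%R]) <=
    P D * (2 * B * (2 * m.+1)`!%:R / (l * t) ^+ (2 * m.+1))%:E)%E.
Proof.
move=> v0 v1 l0 t0 B0 mY mD hB.
have [c cE] : exists c : R, c = (2 * m.+1)`!%:R / (l * t) ^+ (2 * m.+1) by eexists.
have c0 : 0 <= c by rewrite cE divr_ge0 // exprn_ge0 // mulr_ge0 // ltW.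
pose g e i w := \1_D w * expR (e * l * Y i w).
have g0 e i w : 0 <= g e i w by rewrite mulr_ge0 ?expR_ge0 // indicE.
have mg e i : measurable_fun setT (g e i).
  apply: measurable_funM; first exact: measurable_indic.
  by apply: measurableT_comp => //; exact: measurable_funM.
pose F w := \sum_i v i * Y i w ^+ 2.
have mF : measurable_fun setT F.
  apply: measurable_sum => i; apply: measurable_funM => //; exact: measurable_funX.
set E := D `&` _.
have mE : measurable E by apply: measurableI => //; exact: measurable_gt_set.
have pt w : \1_E w <= \sum_i (v i * c) * (g 1 i w + g (-1) i w).
  have rhs0 : 0 <= \sum_i (v i * c) * (g 1 i w + g (-1) i w).
    by apply: sumr_ge0 => i _; rewrite !mulr_ge0 // addr_ge0.
  rewrite [leLHS]indicE; case: (boolP (w \in E)) => // /set_mem[Dw /= hw].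
  rewrite /= mulr1n.
  have d1 : \1_D w = 1 :> R by rewrite indicE mem_set.
  have t2 : 0 < t ^+ (2 * m.+1) by rewrite exprn_gt0.
  have s1 : t ^+ (2 * m.+1) <= \sum_i v i * Y i w ^+ (2 * m.+1).
    apply: (@le_trans _ _ ((\sum_i v i * Y i w ^+ 2) ^+ m.+1)).
      by rewrite exprM; apply: lerXn2r; rewrite ?nnegrE ?sqr_ge0 ?(ltW hw) // (le_trans _ (ltW hw)) ?sqr_ge0.
    apply: le_trans (weighted_pow_le m v0 _ v1) _ => [i|]; first exact: sqr_ge0.
    by apply: ler_sum => i _; rewrite -exprM.
  rewrite -(@ler_pM2r _ (t ^+ (2 * m.+1))) // mul1r; apply: le_trans s1 _.
  rewrite mulr_suml; apply: ler_sum => i _; rewrite -!mulrA ler_wpM2l //.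
  apply: le_trans (even_pow_le_exp (Y i w) m l0) _.
  rewrite /g d1 !mul1r mulN1r mulNr le_eqVlt; apply/orP; left; apply/eqP.
  rewrite cE exprMn; field; rewrite !expf_neq0 // gt_eqF //.
have -> : P E = (\int[P]_w (\1_E w)%:E)%E by rewrite integral_indic // setIT.
apply: (@le_trans _ _ (\int[P]_w (\sum_i ((v i * c)%:E * ((g 1 i w)%:E + (g (-1) i w)%:E))))%E).
  apply: ge0_le_integral => //.
  - exact/measurable_EFinP/measurable_indic.
  - apply: emeasurable_sum => i; apply: measurable_funeM.
    by apply: emeasurable_funD; exact/measurable_EFinP.
  move=> w _; have := pt w; rewrite -lee_fin => /le_trans; apply.
  rewrite -sumEFin; apply: lee_sum => i _; by rewrite EFinM EFinD.
have nn i w : (0 <= (v i * c)%:E * ((g 1 i w)%:E + (g (-1) i w)%:E))%E.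
  by apply: mule_ge0; [rewrite lee_fin mulr_ge0|apply: adde_ge0; rewrite lee_fin].
have mm i : measurable_fun setT (fun w => ((g 1 i w)%:E + (g (-1) i w)%:E)%E).
  by apply: emeasurable_funD; exact/measurable_EFinP.
rewrite ge0_integral_sum //; last by move=> i; apply: measurable_funeM.
apply: (@le_trans _ _ (\sum_i ((v i * c)%:E * (P D * (2 * B)%:E)))%E).
  apply: lee_sum => i _; rewrite ge0_integralZl ?lee_fin ?mulr_ge0 //; last first.
    by move=> w _; rewrite adde_ge0 // lee_fin.
  apply: lee_wpmul2l; first by rewrite lee_fin mulr_ge0.
  rewrite (@ge0_integralD _ _ _ P _ measurableT); last 4 first.
  - by move=> w _; rewrite lee_fin.
  - exact/measurable_EFinP.
  - by move=> w _; rewrite lee_fin.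
  - exact/measurable_EFinP.
  have -> : (P D * (2 * B)%:E = P D * B%:E + P D * B%:E)%E.
    by rewrite -muleDr ?fin_num_measure // -EFinD mulr2n mulrDl !mul1r.
  by apply: leeD; apply: hB; [left|right].
have PDE : P D = (fine (P D))%:E by rewrite fineK // fin_num_measure.
have p0 : 0 <= fine (P D) by rewrite fine_ge0.
rewrite PDE -EFinM (eq_bigr (fun i => (v i * (c * (fine (P D) * (2 * B))))%:E)); last first.
  by move=> i _; rewrite -EFinM mulrA.
rewrite sumEFin -mulr_suml -EFinM lee_fin.
have -> : fine (P D) * (2 * B * (2 * m.+1)`!%:R / (l * t) ^+ (2 * m.+1)) = 1 * (c * (fine (P D) * (2 * B))).
  by rewrite cE; ring.
by rewrite ler_wpM2r // !mulr_ge0.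
Qed.

End WeightedTail.

(** * Choice of the numerical parameters *)

Section Numbers.
Context {R : realType}.

Lemma fact_le_expn n : (n`! <= n ^ n)%N.
Proof.
elim: n => // n IH; rewrite factS expnS leq_mul2l /=.
by apply: leq_trans IH _; case: n => // n; rewrite leq_exp2r.
Qed.

(* [l] is the exponential parameter and [t] the deviation level: [l t = 12 L],
   so the factorial is beaten by [3 ^ (2 (k+1))] while the generating function
   contributes only [expR (L / 2)]. *)
Lemma tail_numbers (s : nat) (H : R) : (3 <= s)%N -> 0 < H ->
  let L := ln s%:R in
  let l := Num.sqrt (s%:R * L) / (2 * H) in
  let t := 24 * H * Num.sqrt (L / s%:R) in
  [/\ 0 < l, 0 < t, `|l / s%:R| * H <= 1 / 2 &
   2 * expR (2 * H ^+ 2 * (l / s%:R) ^+ 2) ^+ s * (2 * (Num.truncn L).+1)`!%:R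
     / (l * t) ^+ (2 * (Num.truncn L).+1) <= 2 / s%:R].
Proof.
move=> s3 H0 L l t.
have sR : 3 <= s%:R :> R by rewrite ler_nat.
have s0 : 0 < s%:R :> R by lra.
have L1 : 1 <= L.
  by rewrite -(expRK 1) ler_ln ?posrE ?expR_gt0 // (le_trans expR1_le3).
have L0 : 0 < L by lra.
have Ls : L <= s%:R by apply: ltW; exact: ln_sublinear.
have eL : expR L = s%:R by rewrite lnK.
have l0 : 0 < l by rewrite divr_gt0 ?mulr_gt0 // sqrtr_gt0 mulr_gt0.
have t0 : 0 < t by rewrite /t !mulr_gt0 // sqrtr_gt0 divr_gt0.
have l2 : l ^+ 2 = s%:R * L / (4 * H ^+ 2).
  by rewrite /l expr_div_n sqr_sqrtr ?exprMn ?mulr_ge0 ?(ltW s0) ?(ltW L0) //; field; rewrite gt_eqF.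
have lt : l * t = 12 * L.
  have -> : l * t = 12 * (Num.sqrt (s%:R * L) * Num.sqrt (L / s%:R)).
    by rewrite /l /t; field; rewrite gt_eqF.
  rewrite -sqrtrM ?mulr_ge0 ?(ltW s0) ?(ltW L0) //.
  have -> : s%:R * L * (L / s%:R) = L ^+ 2 by field; rewrite gt_eqF.
  by rewrite sqrtr_sqr ger0_norm // ltW.
have [k kE] : exists k, k = (Num.truncn L).+1 by eexists.
have kL : L <= k%:R <= L + 1.
  have /andP[h1 h2] : ((Num.truncn L)%:R <= L < (Num.truncn L).+1%:R) by apply: truncn_itv; lra.
  by rewrite kE; apply/andP; split; [exact: ltW|rewrite -natr1; lra].
split=> //.
  have th0 : 0 <= l / s%:R by rewrite divr_ge0 // ltW.
  have h2 : (0 : R) <= 1 / 2 by lra.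
  rewrite ger0_norm // -(@ler_pXn2r _ 2) ?nnegrE ?(mulr_ge0 th0 (ltW H0)) //.
  rewrite exprMn expr_div_n l2.
  have -> : s%:R * L / (4 * H ^+ 2) / s%:R ^+ 2 * H ^+ 2 = (L / s%:R) / 4.
    by field; rewrite !gt_eqF.
  have : L / s%:R <= 1 by rewrite ler_pdivrMr // mul1r.
  lra.
rewrite -kE lt -expRM_natr.
have -> : 2 * H ^+ 2 * (l / s%:R) ^+ 2 * s%:R = L / 2.
  by rewrite expr_div_n l2; field; rewrite !gt_eqF.
(* [2k <= 2 (L + 1) <= 4 L] because [L >= 1], which is where [3 <= s] matters. Against [(12 L)^(2k)]
   there remains [3^(-2k) <= expR (- 2 L)]. *)
have f1 : (2 * k)`!%:R <= (4 * L) ^+ (2 * k) :> R.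
  apply: (@le_trans _ _ ((2 * k)%:R ^+ (2 * k))); first by rewrite -natrX ler_nat fact_le_expn.
  apply: lerXn2r; rewrite ?nnegrE ?natrM; lra.
have f2 : (2 * k)`!%:R / (12 * L) ^+ (2 * k) <= (1 / 3) ^+ (2 * k).
  rewrite ler_pdivrMr ?exprn_gt0 ?mulr_gt0 // -exprMn.
  by rewrite [X in _ <= X ^+ _](_ : _ = 4 * L) //; field.
have f3 : (1 / 3) ^+ (2 * k) <= expR (- (2 * L)) :> R.
  apply: (@le_trans _ _ (expR (- 1) ^+ (2 * k))).
    have e1 : 1 / 3 <= expR (- 1) :> R.
      by rewrite expRN div1r lef_pV2 ?posrE ?expR_gt0 // expR1_le3.
    by apply: lerXn2r => //; rewrite ?nnegrE ?expR_ge0 //; lra.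
  rewrite -expRM_natr ler_expR natrM; lra.
rewrite -!mulrA ler_pM2l // ; apply: (@le_trans _ _ (expR (L / 2) * expR (- (2 * L)))).
  by rewrite ler_wpM2l ?expR_ge0 // (le_trans f2).
rewrite -expRD -eL -expRN ler_expR; lra.
Qed.
End Numbers.

(** * Linear and quadratic forms of one sample *)

Section Sampling.
Context {R : realType} {d} {Om : measurableType d} (P : probability Om R).
Context {n s : nat} (x : 'I_s -> Om -> 'cV[R]_n) (c0 : R).
Hypothesis c00 : 0 < c0.
Hypothesis mx : forall i j, measurable_fun setT (fun w => x i w j 0).
Hypothesis meanx : forall i j, P.-integrable setT (fun w => (x i w j 0)%:E) /\
               (\int[P]_w (x i w j 0)%:E = 0)%E.
Hypothesis covx : forall i j k, (\int[P]_w (x i w j 0 * x i w k 0)%:E = ((j == k)%:R)%:E)%E.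
Hypothesis subg : forall i (u : 'cV[R]_n), (psi2_norm P (fun w => dotc u (x i w)) < +oo)%E.
Hypothesis bmom : forall i (u : 'cV[R]_n),
  (c0%:E * (psi2_norm P (fun w => dotc u (x i w)) * psi2_norm P (fun w => dotc u (x i w)))
     <= \int[P]_w ((dotc u (x i w)) ^+ 2)%:E)%E.

Lemma dotc_measurable d' (T : measurableType d') (y : T -> 'cV[R]_n) (u : 'cV[R]_n) :
  (forall j, measurable_fun setT (fun w => y w j 0)) ->
  measurable_fun setT (fun w => dotc u (y w)).
Proof.
move=> my; rewrite (_ : (fun w => _) = (fun w => \sum_j u j 0 * y w j 0)).
  by apply: measurable_sum => j; exact: measurable_funM.
by apply/funext => w; rewrite dotcE.
Qed.

Lemma integrable_xx i j k : P.-integrable setT (fun w => (x i w j 0 * x i w k 0)%:E).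
Proof.
have sq l : P.-integrable setT (fun w => (x i w l 0 ^+ 2)%:E).
  apply/integrableP; split; first by apply/measurable_EFinP; exact: measurable_funX.
  rewrite (eq_integral (fun w => (x i w l 0 * x i w l 0)%:E)); last first.
    by move=> w _; rewrite -expr2 gee0_abs // lee_fin sqr_ge0.
  by rewrite covx ltry.
apply: (@le_integrable _ _ _ P _ measurableT _ (fun w => (x i w j 0 ^+ 2)%:E + (x i w k 0 ^+ 2)%:E)%E).
- by apply/measurable_EFinP; exact: measurable_funM.
- move=> w _ /=; rewrite lee_fin [leRHS]ger0_norm ?addr_ge0 ?sqr_ge0 //.
  rewrite normrM -(real_normK (num_real (x i w j 0))) -(real_normK (num_real (x i w k 0))).
  have := sqr_ge0 (`|x i w j 0| - `|x i w k 0|); rewrite sqrrB.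
  have := sqr_ge0 (`|x i w j 0|); have := sqr_ge0 (`|x i w k 0|); lra.
exact: integrableD.
Qed.

Lemma integrable_dotc i u : P.-integrable setT (fun w => (dotc u (x i w))%:E).
Proof.
rewrite (_ : (fun w => _) = (fun w => \sum_j (u j 0)%:E * (x i w j 0)%:E)%E).
  by apply: (integrable_sum measurableT) => j _; apply: integrableZl => //; case: (meanx i j).
by apply/funext => w; rewrite dotcE -sumEFin; apply: eq_bigr => j _; rewrite EFinM.
Qed.

Lemma mean_dotc i u : (\int[P]_w (dotc u (x i w))%:E = 0)%E.
Proof.
under eq_integral => w _ do rewrite dotcE -sumEFin.
rewrite integral_sum // => [|j]; last first.
  under eq_fun do rewrite EFinM.
  by apply: integrableZl => //; exact: (proj1 (meanx i j)).
rewrite big1 // => j _; under eq_integral do rewrite EFinM.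
by rewrite integralZl // ?(proj2 (meanx i j)) ?mule0 //; exact: (proj1 (meanx i j)).
Qed.

Lemma dotc_mul_sum i u v w : (dotc u (x i w) * dotc v (x i w))%:E =
  (\sum_(p : 'I_n * 'I_n) (u p.1 0 * v p.2 0)%:E * (x i w p.1 0 * x i w p.2 0)%:E)%E.
Proof.
rewrite !dotcE mulr_suml -(pair_bigA_idem _ (fun j k => (u j 0 * v k 0)%:E * (x i w j 0 * x i w k 0)%:E)%E) /=.
  rewrite -sumEFin; apply: eq_bigr => j _; rewrite mulr_sumr -sumEFin.
  by apply: eq_bigr => k _; rewrite -EFinM; congr (_%:E); ring.
by rewrite adde0.
Qed.

Lemma integrable_dotc2 i u v : P.-integrable setT (fun w => (dotc u (x i w) * dotc v (x i w))%:E).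
Proof.
under eq_fun do rewrite dotc_mul_sum.
by apply: (integrable_sum measurableT) => p _; apply: integrableZl => //; exact: integrable_xx.
Qed.

Lemma cov_dotc i u v : (\int[P]_w (dotc u (x i w) * dotc v (x i w))%:E = (dotc u v)%:E)%E.
Proof.
under eq_integral do rewrite dotc_mul_sum.
rewrite integral_sum // => [|p]; last by apply: integrableZl => //; exact: integrable_xx.
rewrite (eq_bigr (fun p : 'I_n * 'I_n => (u p.1 0 * v p.2 0 * (p.1 == p.2)%:R)%:E)); last first.
  move=> p _; rewrite integralZl //; last exact: integrable_xx.
  by rewrite covx -EFinM.
rewrite sumEFin -(pair_bigA _ (fun j k => u j 0 * v k 0 * (j == k)%:R)) /= dotcE.
congr (_%:E); apply: eq_bigr => j _; rewrite (bigD1 j) //= eqxx mulr1 big1 ?addr0 //.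
by move=> k /negPf kj; rewrite eq_sym kj mulr0.
Qed.

(** Identity covariance makes the second moment equal to [nsq u], so the bounded moments assumption
    caps the psi2 norm uniformly over the unit ball. *)
Lemma bmom1 i u : nsq u <= 1 ->
  (c0%:E * (psi2_norm P (fun w => dotc u (x i w)) * psi2_norm P (fun w => dotc u (x i w))) <= 1)%E.
Proof.
move=> u1; apply: le_trans (bmom i u) _.
rewrite (eq_integral (fun w => (dotc u (x i w) * dotc u (x i w))%:E)) => [|w _]; last by rewrite expr2.
by rewrite cov_dotc lee_fin.
Qed.

Lemma mgf_linear i u th : nsq u <= 1 -> `|th| * bconst c0 <= 1 / 2 ->
  (\int[P]_w (expR (th * (dotc u (x i w) - 0)))%:E <= (expR (2 * bconst c0 ^+ 2 * th ^+ 2))%:E)%E.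
Proof.
move=> u1 hth; apply: bernstein_mgf => //.
- by apply: dotc_measurable.
- exact: integrable_dotc.
- exact: mean_dotc.
- exact: ltW (bconst_gt0 c00).
by move=> m; apply: psi2_moment1 => //; exact: bmom1.
Qed.

Lemma mgf_quadratic i u v th : nsq u <= 1 -> nsq v <= 1 -> `|th| * bconst c0 <= 1 / 2 ->
  (\int[P]_w (expR (th * (dotc u (x i w) * dotc v (x i w) - dotc u v)))%:E <=
    (expR (2 * bconst c0 ^+ 2 * th ^+ 2))%:E)%E.
Proof.
move=> u1 v1 hth; apply: bernstein_mgf => //.
- by apply: measurable_funM; apply: dotc_measurable.
- exact: integrable_dotc2.
- exact: cov_dotc.
- exact: ltW (bconst_gt0 c00).
by move=> m; apply: psi2_moment2 => //; (try exact: bmom1); apply: dotc_measurable.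
Qed.

End Sampling.

(** * Empirical covariance and mean *)

Section SamplingTail.
Context {R : realType} {d} {Om : measurableType d} (P : probability Om R).
Context {n s : nat} (x : 'I_s -> Om -> 'cV[R]_n) (c0 : R).
Hypothesis c00 : 0 < c0.
Hypothesis mx : forall i j, measurable_fun setT (fun w => x i w j 0).
Hypothesis meanx : forall i j, P.-integrable setT (fun w => (x i w j 0)%:E) /\
               (\int[P]_w (x i w j 0)%:E = 0)%E.
Hypothesis covx : forall i j k, (\int[P]_w (x i w j 0 * x i w k 0)%:E = ((j == k)%:R)%:E)%E.
Hypothesis subg : forall i (u : 'cV[R]_n), (psi2_norm P (fun w => dotc u (x i w)) < +oo)%E.
Hypothesis bmom : forall i (u : 'cV[R]_n),
  (c0%:E * (psi2_norm P (fun w => dotc u (x i w)) * psi2_norm P (fun w => dotc u (x i w)))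
     <= \int[P]_w ((dotc u (x i w)) ^+ 2)%:E)%E.

(** [D] stands for an event fixing the adjacency matrix, and [G i] for events generating the
    sigma-algebra of sample [i]. [factor] expresses through integrals that, given [D], the samples
    stay independent with unchanged laws. *)
Variables (D : set Om) (G : 'I_s -> set (set Om)).
Hypothesis mD : measurable D.
Hypothesis mxG : forall i j,
  measurable_fun setT ((fun w => x i w j 0) : g_sigma_algebraType (G i) -> R).
Hypothesis factor : forall F : 'I_s -> Om -> R, (forall i w, 0 <= F i w) ->
  (forall i, measurable_fun setT (F i : g_sigma_algebraType (G i) -> R)) ->
  (\int[P]_w (\1_D w * \prod_i F i w)%:E = P D * \prod_i \int[P]_w (F i w)%:E)%E.

Lemma lee_prod_const (I : finType) (f : I -> \bar R) (b : R) : 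
  (forall i, 0 <= f i)%E -> (forall i, f i <= b%:E)%E ->
  (\prod_i f i <= (b ^+ #|I|)%:E)%E.
Proof.
move=> f0 fb.
have fE i : f i = (fine (f i))%:E.
  by rewrite fineK // ge0_fin_numE // (le_lt_trans (fb i)) // ltry.
have -> : (\prod_i f i = (\prod_i fine (f i))%:E)%E.
  rewrite (eq_bigr (fun i => (fine (f i))%:E)) => [|i _]; last exact: fE.
  by elim/big_rec2: _ => // i y1 y2 _ ->; rewrite EFinM.
rewrite lee_fin -prodr_const; apply: ler_prod => i _.
by rewrite fine_ge0 // -lee_fin -fE fb.
Qed.

Lemma mgf_avg (xi : 'I_s -> Om -> R) (r th b : R) :
  (forall i, measurable_fun setT (xi i : g_sigma_algebraType (G i) -> R)) ->
  (forall i, (\int[P]_w (expR (th / s%:R * (xi i w - r)))%:E <= b%:E)%E) ->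
  (\int[P]_w (\1_D w * expR (th * (s%:R^-1 * \sum_i (xi i w - r))))%:E <= P D * (b ^+ s)%:E)%E.
Proof.
move=> mxi hb.
rewrite (eq_integral (fun w => (\1_D w * \prod_i expR (th / s%:R * (xi i w - r)))%:E)); last first.
  by move=> w _; rewrite mulrA mulr_sumr expR_sum.
rewrite (factor (F := fun i w => expR (th / s%:R * (xi i w - r)))).
- apply: lee_wpmul2l => //; rewrite -[X in b ^+ X](card_ord s); apply: lee_prod_const => // i.
  by apply: integral_ge0 => w _; rewrite lee_fin expR_ge0.
- by move=> i w; exact: expR_ge0.
move=> i; apply: measurableT_comp => //; apply: measurable_funM => //.
exact: measurable_funB.
Qed.

Context {J : finType} (u : J -> 'cV[R]_n).

(* The zero vector is fixed, since [0^-1 = 0]. *)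
Definition unitize (v : 'cV[R]_n) := (vnorm v)^-1 *: v.

Lemma unitizeE v : v = vnorm v *: unitize v.
Proof.
rewrite /unitize scalerA; have [->|v0] := eqVneq v 0; first by rewrite scaler0.
by rewrite mulfV ?scale1r // gt_eqF // vnorm_gt0.
Qed.

Lemma nsq_unitize v : nsq (unitize v) <= 1.
Proof.
rewrite /unitize nsqZ exprVn vnorm_sqr; have [->|v0] := eqVneq (nsq v) 0; first by rewrite mulr0.
by rewrite mulVf.
Qed.

Definition emp_cov w j k : R :=
  s%:R^-1 * \sum_i (dotc (u j) (x i w) * dotc (u k) (x i w)) - dotc (u j) (u k).
Definition emp_mean w j : R := s%:R^-1 * \sum_i dotc (u j) (x i w).
Let tau := \sum_j nsq (u j).
Let H := bconst c0.
Let L : R := ln s%:R.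
Let t := 24 * H * Num.sqrt (L / s%:R).

Hypothesis s3 : (3 <= s)%N.

Lemma s_neq0 : s%:R != 0 :> R.
Proof. by rewrite pnatr_eq0; case: s s3. Qed.

Let tau0 : 0 <= tau. Proof. by apply: sumr_ge0 => j _; exact: nsq_ge0. Qed.

Lemma sum_div_le1 (I : finType) (f : I -> R) : \sum_i (f i / \sum_j f j) <= 1.
Proof.
rewrite -mulr_suml; have [->|h] := eqVneq (\sum_j f j) 0; first by rewrite mul0r.
by rewrite mulfV.
Qed.

(** The vectors [u j] are normalized so that one generating function bound serves all pairs; their
    squared lengths become the weights [v], of sum at most 1, and [tau] carries the scale. *)
Lemma emp_cov_tail :
  (P (D `&` [set w | (t ^+ 2 * tau ^+ 2 < \sum_(p : J * J) emp_cov w p.1 p.2 ^+ 2)%R]) <=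
   P D * (2 / s%:R)%:E)%E.
Proof.
have [l0 t0 lH fin] := tail_numbers s3 (bconst_gt0 c00).
set l := _ / (2 * bconst c0) in l0 lH fin.
have sn0 := s_neq0.
pose uu j := unitize (u j).
pose Y (p : J * J) w := s%:R^-1 * \sum_i
   (dotc (uu p.1) (x i w) * dotc (uu p.2) (x i w) - dotc (uu p.1) (uu p.2)).
pose v (p : J * J) := nsq (u p.1) * nsq (u p.2) / tau ^+ 2.
have v0 p : 0 <= v p by rewrite divr_ge0 ?sqr_ge0 // mulr_ge0 // nsq_ge0.
have tau2 : tau ^+ 2 = \sum_(p : J * J) nsq (u p.1) * nsq (u p.2).
  by rewrite -(pair_bigA _ (fun j k => nsq (u j) * nsq (u k))) expr2 {1}/tau mulr_suml;
    apply: eq_bigr => j _; rewrite mulr_sumr.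
have v1 : \sum_p v p <= 1 by rewrite /v tau2; exact: sum_div_le1.
have mY p : measurable_fun setT (Y p).
  apply: measurable_funM => //; apply: measurable_sum => i; apply: measurable_funB => //.
  by apply: measurable_funM; apply: dotc_measurable.
have ZY w p : emp_cov w p.1 p.2 = vnorm (u p.1) * vnorm (u p.2) * Y p w.
  have e1 z : dotc (u p.1) z = vnorm (u p.1) * dotc (uu p.1) z.
    by rewrite {1}(unitizeE (u p.1)) dotcZl.
  have e2 z : dotc (u p.2) z = vnorm (u p.2) * dotc (uu p.2) z.
    by rewrite {1}(unitizeE (u p.2)) dotcZl.
  rewrite /Y /emp_cov sumrB sumr_const card_ord e1 (dotcC _ (u p.2)) e2 (dotcC _ (uu p.1)).
  rewrite -[X in _ * (_ - X)]mulr_natl mulrBr mulKf // mulrBr.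
  congr (_ - _); last by ring.
  rewrite mulrCA; congr (_ * _); rewrite mulr_sumr; apply: eq_bigr => i _.
  by rewrite e1 e2; ring.
have sub : D `&` [set w | (t ^+ 2 * tau ^+ 2 < \sum_(p : J * J) emp_cov w p.1 p.2 ^+ 2)%R] `<=`
   D `&` [set w | (t ^+ 2 < \sum_p v p * Y p w ^+ 2)%R].
  move=> w [Dw /= hw]; split=> //=.
  have E : \sum_(p : J * J) emp_cov w p.1 p.2 ^+ 2 = \sum_p (nsq (u p.1) * nsq (u p.2)) * Y p w ^+ 2.
    by apply: eq_bigr => p _; rewrite ZY !exprMn !vnorm_sqr.
  (* If [tau = 0], every [u j] vanishes and the strict inequality is impossible; otherwise division
     by [tau] is legitimate. *)
  have [t00|tn0] := eqVneq tau 0.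
    move: hw; rewrite E t00 expr0n mulr0 big1 ?ltxx // => p _.
    have -> : nsq (u p.1) = 0 by apply: (psumr_eq0P _ t00) => // k _; exact: nsq_ge0.
    by rewrite !mul0r.
  have tp : 0 < tau ^+ 2 by rewrite exprn_gt0 // lt0r tn0.
  rewrite -(ltr_pM2r tp); apply: lt_le_trans hw _; rewrite E mulr_suml.
  apply: ler_sum => p _.
  by have -> : v p * Y p w ^+ 2 * tau ^+ 2 = nsq (u p.1) * nsq (u p.2) * Y p w ^+ 2 by rewrite /v; field.
have mcov p : measurable_fun setT (fun w => emp_cov w p.1 p.2).
  by rewrite (_ : (fun w => _) = (fun w => vnorm (u p.1) * vnorm (u p.2) * Y p w));
    [exact: measurable_funM|apply/funext => w; exact: ZY].
apply: (@le_trans _ _ (P (D `&` [set w | (t ^+ 2 < \sum_p v p * Y p w ^+ 2)%R]))).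
  apply: le_measure => //; rewrite inE; apply: measurableI => //; apply: measurable_gt_set;
    apply: measurable_sum => p.
    exact: measurable_funX.
  by apply: measurable_funM => //; exact: measurable_funX.
apply: le_trans (weighted_tail (B := expR (2 * H ^+ 2 * (l / s%:R) ^+ 2) ^+ s) (Num.truncn L) v0 v1 l0 t0 _ mY mD _) _.
- by rewrite exprn_ge0 // expR_ge0.
- move=> p e e1; rewrite /Y.
  apply: mgf_avg => i.
    apply: measurable_funM; exact: dotc_measurable.
  have -> : (l / s%:R) ^+ 2 = (e * l / s%:R) ^+ 2.
    by case: e1 => ->; rewrite ?mul1r // mulN1r mulNr sqrrN.
  apply: mgf_quadratic => //; try exact: nsq_unitize.
  have -> : `|e * l / s%:R| = `|l / s%:R|.
    by case: e1 => ->; rewrite ?mul1r // mulN1r mulNr normrN.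
  exact: lH.
by apply: lee_wpmul2l => //; rewrite lee_fin.
Qed.

(** The mean is linear in the sample, so its squared norm scales with [tau], not [tau ^+ 2], and the
    weights are [nsq (u j) / tau]. *)
Lemma emp_mean_tail :
  (P (D `&` [set w | (t ^+ 2 * tau < \sum_j emp_mean w j ^+ 2)%R]) <=
   P D * (2 / s%:R)%:E)%E.
Proof.
have [l0 t0 lH fin] := tail_numbers s3 (bconst_gt0 c00).
set l := _ / (2 * bconst c0) in l0 lH fin.
have sn0 := s_neq0.
pose uu j := unitize (u j).
pose Y j w := s%:R^-1 * \sum_i (dotc (uu j) (x i w) - 0).
pose v j := nsq (u j) / tau.
have v0 j : 0 <= v j by rewrite divr_ge0 // nsq_ge0.
have v1 : \sum_j v j <= 1 by exact: sum_div_le1.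
have mY j : measurable_fun setT (Y j).
  apply: measurable_funM => //; apply: measurable_sum => i; apply: measurable_funB => //.
  by apply: dotc_measurable.
have ZY w j : emp_mean w j = vnorm (u j) * Y j w.
  rewrite /Y /emp_mean mulrCA; congr (_ * _); rewrite mulr_sumr; apply: eq_bigr => i _.
  by rewrite subr0 {1}(unitizeE (u j)) dotcZl.
have sub : D `&` [set w | (t ^+ 2 * tau < \sum_j emp_mean w j ^+ 2)%R] `<=`
   D `&` [set w | (t ^+ 2 < \sum_j v j * Y j w ^+ 2)%R].
  move=> w [Dw /= hw]; split=> //=.
  have E : \sum_j emp_mean w j ^+ 2 = \sum_j nsq (u j) * Y j w ^+ 2.
    by apply: eq_bigr => j _; rewrite ZY !exprMn !vnorm_sqr.
  have [t00|tn0] := eqVneq tau 0.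
    move: hw; rewrite E t00 mulr0 big1 ?ltxx // => j _.
    have -> : nsq (u j) = 0 by apply: (psumr_eq0P _ t00) => // k _; exact: nsq_ge0.
    by rewrite !mul0r.
  have tp : 0 < tau by rewrite lt0r tn0.
  rewrite -(ltr_pM2r tp); apply: lt_le_trans hw _; rewrite E mulr_suml.
  apply: ler_sum => p _.
  by have -> : v p * Y p w ^+ 2 * tau = nsq (u p) * Y p w ^+ 2 by rewrite /v; field.
have mcov j : measurable_fun setT (fun w => emp_mean w j).
  by rewrite (_ : (fun w => _) = (fun w => vnorm (u j) * Y j w));
    [exact: measurable_funM|apply/funext => w; exact: ZY].
apply: (@le_trans _ _ (P (D `&` [set w | (t ^+ 2 < \sum_p v p * Y p w ^+ 2)%R]))).
  apply: le_measure => //; rewrite inE; apply: measurableI => //; apply: measurable_gt_set;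
    apply: measurable_sum => p.
    exact: measurable_funX.
  by apply: measurable_funM => //; exact: measurable_funX.
apply: le_trans (weighted_tail (B := expR (2 * H ^+ 2 * (l / s%:R) ^+ 2) ^+ s) (Num.truncn L) v0 v1 l0 t0 _ mY mD _) _.
- by rewrite exprn_ge0 // expR_ge0.
- move=> p e e1; rewrite /Y.
  apply: mgf_avg => i.
    exact: dotc_measurable.
  have -> : (l / s%:R) ^+ 2 = (e * l / s%:R) ^+ 2.
    by case: e1 => ->; rewrite ?mul1r // mulN1r mulNr sqrrN.
  apply: mgf_linear => //; try exact: nsq_unitize.
  have -> : `|e * l / s%:R| = `|l / s%:R|.
    by case: e1 => ->; rewrite ?mul1r // mulN1r mulNr normrN.
  exact: lH.
by apply: lee_wpmul2l => //; rewrite lee_fin.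
Qed.

End SamplingTail.

(** * Edges of the stochastic block model *)

Section Edges.
Context {R : realType} {n : nat}.

(** Self-loops are included, and each independent entry of [A] is counted once. *)
Definition edge := {p : 'I_n * 'I_n | (p.1 <= p.2)%N}.

Definition ordpair (i j : 'I_n) : 'I_n * 'I_n := if (i <= j)%N then (i, j) else (j, i).

Lemma ordpairC i j : ordpair i j = ordpair j i.
Proof.
rewrite /ordpair; case: (leqP i j) => ij; case: (leqP j i) => ji //.
  by have -> : i = j by apply/val_inj/anti_leq; rewrite ij.
by have := ltn_trans ij ji; rewrite ltnn.
Qed.

Lemma ordpairP i j : ((ordpair i j).1 <= (ordpair i j).2)%N.
Proof. by rewrite /ordpair; case: (leqP i j) => h /=; [exact: h|exact: ltnW]. Qed.

Definition edge_of (i j : 'I_n) : edge := exist _ (ordpair i j) (ordpairP i j).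

Lemma edge_ofC i j : edge_of i j = edge_of j i.
Proof. by apply/eqP; rewrite -val_eqE /= ordpairC. Qed.

Lemma edge_of_inj i : injective (edge_of i).
Proof.
move=> j k /(congr1 val) /=; rewrite /ordpair; case: leqP => ij; case: leqP => ik [] //.
  by move=> -> ->.
by move=> E1 E2; rewrite E1.
Qed.

Definition edge_mx (e : edge) : 'M[R]_n := \matrix_(i, j) (e == edge_of i j)%:R.
Definition incident (e : edge) (i : 'I_n) : bool := [exists j, e == edge_of i j].

Lemma edge_mx_sym e : (edge_mx e)^T = edge_mx e.
Proof. by apply/matrixP => i j; rewrite !mxE edge_ofC. Qed.

Lemma incidentE e i : (incident e i)%:R = \sum_j (e == edge_of i j)%:R :> R.
Proof.
rewrite /incident; case: existsP => [[j /eqP ->]|h]; last first.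
  by rewrite big1 // => j _; case: eqP => // E; case: h; exists j; apply/eqP.
rewrite (bigD1 j) //= eqxx big1 ?addr0 // => k kj.
by rewrite (inj_eq (@edge_of_inj i)) eq_sym (negPf kj).
Qed.

(** An edge matrix exchanges its endpoints, or fixes the endpoint of a loop, and kills the other
    basis vectors; its square is the projection on the endpoints. *)
Lemma edge_mx_sqr e : edge_mx e *m edge_mx e = diag_mx (\row_i (incident e i)%:R).
Proof.
apply/matrixP => i k; rewrite !mxE; have [->|ik] := eqVneq i k.
  rewrite mulr1n incidentE; apply: eq_bigr => j _; rewrite !mxE (edge_ofC j k).
  by case: (_ == _); rewrite ?mulr1 ?mulr0.
rewrite mulr0n big1 // => j _; rewrite !mxE.
case: (e =P edge_of i j) => [->|_]; rewrite ?mul0r // mul1r.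
by rewrite (edge_ofC i j) (inj_eq (@edge_of_inj j)) (negPf ik).
Qed.

Definition adj_mx (al : {ffun edge -> bool}) : 'M[R]_n := \matrix_(i, j) (al (edge_of i j))%:R.

Lemma sum_incident (f : edge -> R) i :
  \sum_e f e * (incident e i)%:R = \sum_j f (edge_of i j).
Proof.
under eq_bigr => e _ do rewrite incidentE mulr_sumr.
rewrite exchange_big; apply: eq_bigr => j _ /=.
rewrite (bigD1 (edge_of i j)) //= eqxx mulr1 big1 ?addr0 // => e /negPf ->.
by rewrite mulr0.
Qed.

Variable q : 'I_n -> 'I_n -> R.
Hypothesis qC : forall i j, q i j = q j i.
Definition edge_prob (e : edge) : R := q (val e).1 (val e).2.

Lemma edge_prob_of i j : edge_prob (edge_of i j) = q i j.
Proof. by rewrite /edge_prob /= /ordpair; case: leqP. Qed.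

Lemma bdeg_rowsum al i : bdeg incident al i = rowsum (adj_mx al) i.
Proof.
rewrite /bdeg sum_incident; apply: eq_bigr => j _; by rewrite mxE.
Qed.

Lemma bexp_rowsum i : bexp edge_prob incident i = \sum_j q i j.
Proof. by rewrite /bexp sum_incident; apply: eq_bigr => j _; rewrite edge_prob_of. Qed.

Lemma cmx_adj al : cmx edge_prob edge_mx al = adj_mx al - \matrix_(i, j) q i j.
Proof.
apply/matrixP => i j; rewrite /cmx summxE !mxE.
rewrite (bigD1 (edge_of i j)) //= big1 ?addr0; last first.
  by move=> e /negPf h; rewrite !mxE h mulr0.
by rewrite !mxE eqxx mulr1 edge_prob_of.
Qed.

Lemma adj_mx_sym al : (adj_mx al)^T = adj_mx al.
Proof. by apply/matrixP => i j; rewrite !mxE edge_ofC. Qed.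

Lemma laplacian_concentration (de l : R) :
  (forall i j, 0 <= q i j <= 1) -> 2 <= l -> 27 * l < de -> (forall i, \sum_j q i j = de) ->
  exists good : pred {ffun edge -> bool},
    (forall al, good al ->
       opbound (sym_normalize (adj_mx al) - sym_normalize (\matrix_(i, j) q i j))
         (3 * Num.sqrt (3 * l / de))) /\
    \sum_(al | ~~ good al) bweight edge_prob al <= 3 * n%:R * expR (- l).
Proof.
move=> q01 l2 lde dE.
have p01 e : 0 <= edge_prob e <= 1 by exact: q01.
have be i : bexp edge_prob incident i = de by rewrite bexp_rowsum.
have [good [hg hb]] := adjacency_concentration p01 edge_mx_sym edge_mx_sqr l2 lde be.
exists good; split=> // al /hg [h1 h2].
have de0 : 0 < de by lra.
apply: (sym_normalize_perturb (de := de)) => //.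
- exact: adj_mx_sym.
- by move=> i j; rewrite mxE.
- by move=> i; rewrite /rowsum -(dE i); apply: eq_bigr => j _; rewrite mxE.
- rewrite sqrtr_ge0 /= -(@ler_pXn2r _ 2) ?nnegrE ?sqrtr_ge0 ?divr_ge0 // sqr_sqrtr.
    by rewrite ler_pdivrMr //; lra.
  by rewrite divr_ge0 ?mulr_ge0 ?(ltW de0) //; lra.
- by move=> i; rewrite -bdeg_rowsum.
by rewrite -cmx_adj.
Qed.

End Edges.

Lemma indic_set1 (R : realType) (r c : R) : \1_[set c] r = (r == c)%:R :> R.
Proof. by rewrite indicE; case: eqP => h; [rewrite mem_set|rewrite memNset]. Qed.

(** * The law of the adjacency matrix as a finite product *)

Section Linking.
Context {R : realType} {d} {Om : measurableType d} (P : probability Om R).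
Context {n s : nat} (A : Om -> 'M[R]_n) (x0 : 'I_s -> Om -> 'cV[R]_n) (q : 'I_n -> 'I_n -> R).
Hypothesis n0 : (0 < n)%N.
Hypothesis A01 : forall w i j, A w i j = 0 \/ A w i j = 1.
Hypothesis Asym : forall w i j, A w i j = A w j i.
Hypothesis mA : forall i j, measurable_fun setT (fun w => A w i j).
Hypothesis PA : forall i j, P [set w | A w i j = 1] = (q i j)%:E.
Hypothesis mx0 : forall i j, measurable_fun setT (fun w => x0 i w j 0).

Let K := (('I_n * 'I_n) + 'I_s)%type.
Let S : {pred K} := [pred k : K | match k with inl p => (p.1 <= p.2)%N | inr _ => true end].
Definition model_coord (k : ('I_n * 'I_n) + 'I_s) (j : 'I_n) (w : Om) : R :=
  match k with inl p => A w p.1 p.2 | inr i => x0 i w j 0 end.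
Hypothesis ind : indep_blocks P S model_coord.

Definition adj_event (al : {ffun @edge n -> bool}) : set Om := [set w | A w = adj_mx al].

Let mX k j : measurable_fun setT (model_coord k j).
Proof. by case: k => [p|i]; rewrite /model_coord. Qed.

Definition edge_ind (al : {ffun @edge n -> bool}) (e : @edge n) (w : Om) : R :=
  (A w (val e).1 (val e).2 == (al e)%:R)%:R.

(** Symmetry recovers the entries below the diagonal, so one condition per edge determines the whole
    matrix. *)
Lemma adj_event_ind al w : \1_(adj_event al) w = \prod_e edge_ind al e w :> R.
Proof.
rewrite indicE; case: (boolP (w \in adj_event al)) => [/set_mem Aw|h].
  rewrite big1 // => -[[i j] ij] _; rewrite /edge_ind Aw mxE /=.
  rewrite (_ : edge_of i j = exist _ (i, j) ij) ?eqxx //.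
  by apply/eqP; rewrite -val_eqE /= /ordpair ij.
apply/esym/eqP; rewrite prodf_seq_eq0; apply/hasP.
suff [e he] : exists e, A w (val e).1 (val e).2 != (al e)%:R.
  by exists e; rewrite ?mem_index_enum //= /edge_ind (negPf he).
apply: contrapT => hn; move/negP: h; apply; rewrite inE /adj_event /=.
have hA e : A w (val e).1 (val e).2 = (al e)%:R.
  by apply/eqP; apply: contrapT => /negP h; apply: hn; exists e.
apply/matrixP => i j; rewrite mxE -hA /= /ordpair.
by case: (leqP i j) => _ //=; rewrite Asym.
Qed.

Lemma adj_event_measurable al : measurable (adj_event al).
Proof.
have m1 : measurable_fun setT (\1_(adj_event al) : Om -> R).
  rewrite (_ : \1_(adj_event al) = fun w => \prod_(e <- index_enum _) edge_ind al e w); last first.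
    by apply/funext => w; rewrite adj_event_ind.
  apply: measurable_prod => e _.
  rewrite (_ : edge_ind al e = (\1_[set (al e)%:R : R]) \o (fun w => A w (val e).1 (val e).2)).
    by apply: measurableT_comp => //; apply: measurable_indic.
  by apply/funext => w; rewrite /edge_ind /= indic_set1.
have -> : adj_event al = (\1_(adj_event al) : Om -> R) @^-1` [set 1].
  apply/seteqP; split => w /=; rewrite indicE.
    by move=> h; rewrite mem_set.
  by case: (boolP (w \in adj_event al)) => [/set_mem //|_ /esym/eqP]; rewrite oner_eq0.
by rewrite -[X in measurable X]setTI; apply: m1.
Qed.

(** Blocks are indexed by all ordered pairs, so a configuration on pairs [i <= j] is extended to
    them. *)
Let ext (al : {ffun @edge n -> bool}) (p : 'I_n * 'I_n) : bool := if insub p is Some e then al e else false.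

Let blockf al (F : 'I_s -> Om -> R) (k : K) (w : Om) : R :=
  match k with inl p => (A w p.1 p.2 == (ext al p)%:R)%:R | inr i => F i w end.

Let ext_val al (e : @edge n) : ext al (val e) = al e.
Proof. by rewrite /ext valK. Qed.

(** Indicator and samples form a single product over distinct blocks, edges and signals; each edge
    integral is a Bernoulli weight. *)
Lemma adj_event_factor_raw al (F : 'I_s -> Om -> R) : (forall i w, 0 <= F i w) ->
  (forall i, measurable_fun setT (F i : g_sigma_algebraType (boxes model_coord [:: inr i]) -> R)) ->
  (\int[P]_w (\1_(adj_event al) w * \prod_i F i w)%:E =
    (bweight (edge_prob q) al)%:E * \prod_i \int[P]_w (F i w)%:E)%E.
Proof.
(* An edge block is a constant family over ['I_n]; [0 < n] provides a member [j0] to read it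
   from. *)
move=> F0 mF; pose j0 : 'I_n := Ordinal n0.
pose sl : seq K := [seq inl (val e) | e <- index_enum (@edge n)] ++ [seq inr i | i <- index_enum 'I_s].
have usl : uniq sl.
  rewrite cat_uniq !map_inj_uniq ?index_enum_uniq //=; last 2 first.
  - by move=> i j [].
  - by move=> e e' [] /val_inj.
  by rewrite andbT; apply/hasPn => k /mapP[i _ ->]; apply/negP => /mapP[].
have slS : {subset sl <= S}.
  move=> k; rewrite mem_cat => /orP[/mapP[e _ ->]|/mapP[i _ ->]]; rewrite inE //=.
  exact: valP e.
have f0 k w : 0 <= blockf al F k w by case: k => [p|i] /=.
have mf k : measurable_fun setT (blockf al F k : g_sigma_algebraType (boxes model_coord [:: k]) -> R).
  case: k => [p|i] /=; last exact: mF.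
  rewrite (_ : blockf _ _ _ = (\1_[set (ext al p)%:R : R]) \o (model_coord (inl p) j0)).
    by apply: measurableT_comp; [exact: measurable_indic|exact: boxes_coord].
  by apply/funext => w; rewrite /= indic_set1.
have := indep_blocks_integral mX ind usl slS f0 mf.
rewrite [in RHS]big_cat !big_map /=.
under eq_integral => w _ do rewrite big_cat !big_map /=.
have -> : (\prod_(e : @edge n) \int[P]_w ((A w (val e).1 (val e).2 == (ext al (val e))%:R)%:R)%:E =
   (bweight (edge_prob q) al)%:E)%E.
  transitivity (\prod_(e : @edge n) (bern (edge_prob q e) (al e))%:E)%E; last first.
    by rewrite /bweight; elim/big_rec2: _ => // i y1 y2 _ ->; rewrite EFinM.
  apply: eq_bigr => e _; rewrite ext_val.
  set i := (val e).1; set j := (val e).2.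
  have mset c : measurable [set w | A w i j = c].
    rewrite (_ : [set w | _] = (fun w => A w i j) @^-1` [set c]) //.
    by rewrite -[X in measurable X]setTI; exact: mA.
  transitivity (P [set w | A w i j = (al e)%:R]).
    rewrite -[X in P X]setIT -integral_indic //.
    apply: eq_integral => w _; rewrite indicE; congr ((_%:R)%:E).
    by case: eqP => h; [rewrite mem_set|rewrite memNset].
  rewrite /bern /edge_prob -/i -/j; case: (al e) => /=; first exact: PA.
  rewrite mulr0n; have -> : [set w | A w i j = 0] = ~` [set w | A w i j = 1].
    apply/seteqP; split=> w /=; first by move=> -> /esym/eqP; rewrite oner_eq0.
    by case: (A01 w i j).
  by rewrite probability_setC // PA EFinB.
move=> <-; apply: eq_integral => w _; rewrite adj_event_ind; congr ((_ * _)%:E).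
by apply: eq_bigr => e _; rewrite /edge_ind ext_val.
Qed.

Lemma adj_event_prob al : P (adj_event al) = (bweight (edge_prob q) al)%:E.
Proof.
have := @adj_event_factor_raw al (fun _ _ => 1) (fun _ _ => ler01) (fun _ => measurable_cst _).
rewrite (eq_integral (fun w => (\1_(adj_event al) w)%:E)); last first.
  by move=> w _; rewrite big1 ?mulr1.
rewrite integral_indic ?setIT //; last exact: adj_event_measurable.
move=> ->; rewrite big1 ?mule1 // => i _.
by rewrite integral_cst // mul1e; exact: probability_setT.
Qed.

Lemma adj_event_factor al (F : 'I_s -> Om -> R) : (forall i w, 0 <= F i w) ->
  (forall i, measurable_fun setT (F i : g_sigma_algebraType (boxes model_coord [:: inr i]) -> R)) ->
  (\int[P]_w (\1_(adj_event al) w * \prod_i F i w)%:E =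
    P (adj_event al) * \prod_i \int[P]_w (F i w)%:E)%E.
Proof. by move=> F0 mF; rewrite adj_event_prob; exact: adj_event_factor_raw. Qed.

Lemma signal_box_measurable i j : measurable_fun setT
  ((fun w => x0 i w j 0) : g_sigma_algebraType (boxes model_coord [:: inr i]) -> R).
Proof. exact: (@boxes_coord _ _ _ _ _ model_coord (inr i) j). Qed.

End Linking.

(** * Sample covariance as a deterministic perturbation *)

Section SampleCov.
Context {R : realType} {n s : nat}.

Lemma opbound_frobenius (S : 'M[R]_n) c : 0 <= c ->
  \sum_(p : 'I_n * 'I_n) S p.1 p.2 ^+ 2 <= c ^+ 2 -> opbound S c.
Proof.
move=> c0 h v; rewrite -(@ler_pXn2r _ 2) ?nnegrE ?vnorm_ge0 ?(mulr_ge0 c0 (vnorm_ge0 v)) //.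
rewrite exprMn !vnorm_sqr.
apply: (@le_trans _ _ ((\sum_(p : 'I_n * 'I_n) S p.1 p.2 ^+ 2) * nsq v)); last first.
  by rewrite ler_wpM2r ?nsq_ge0.
rewrite -(pair_bigA _ (fun i j => S i j ^+ 2)) /= {1}/nsq dotcE mulr_suml.
apply: ler_sum => i _; rewrite -expr2.
have -> : (S *m v) i 0 = dotc (row i S)^T v by rewrite /dotc trmxK -row_mul [RHS]mxE.
have -> : \sum_j S i j ^+ 2 = nsq (row i S)^T.
  by rewrite /nsq dotcE; apply: eq_bigr => j _; rewrite !mxE expr2.
rewrite -!vnorm_sqr -exprMn -(real_normK (num_real (dotc _ _))).
apply: lerXn2r; rewrite ?nnegrE ?mulr_ge0 ?vnorm_ge0 //.
rewrite ler_norml dotc_le andbT lerNl; have := dotc_le (- (row i S)^T) v.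
by rewrite vnormN -scaleN1r dotcZl mulN1r.
Qed.

Lemma opbound_outer (y : 'cV[R]_n) : opbound (y *m y^T) (nsq y).
Proof.
move=> v; rewrite outer_mul vnormZ -vnorm_sqr expr2 mulrAC ler_wpM2r ?vnorm_ge0 //.
rewrite ler_norml dotc_le andbT lerNl; have := dotc_le (- y) v.
by rewrite vnormN -scaleN1r dotcZl mulN1r.
Qed.

Lemma sample_cov_sym (y : 'I_s -> 'cV[R]_n) : (sample_cov y)^T = sample_cov y.
Proof.
rewrite /sample_cov linearZ /= (linear_sum (@trmx R n n)) /=; congr (_ *: _).
by apply: eq_bigr => i _; rewrite trmx_mul trmxK.
Qed.

Lemma sample_cov_psd (y : 'I_s -> 'cV[R]_n) v : 0 <= dotc v (sample_cov y *m v).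
Proof.
rewrite /sample_cov -scalemxAl dotcZr mulr_ge0 ?invr_ge0 // mulmx_suml.
rewrite /dotc mulmx_sumr summxE; apply: sumr_ge0 => i _.
by rewrite outer_mul -scalemxAr mxE -/(dotc v _) dotcC -expr2 sqr_ge0.
Qed.

Lemma sample_covE (y : 'I_s -> 'cV[R]_n) : (0 < s)%N ->
  sample_cov y = s%:R^-1 *: (\sum_i y i *m (y i)^T) - sample_mean y *m (sample_mean y)^T.
Proof.
move=> s0; have sn0 : s%:R != 0 :> R by rewrite pnatr_eq0 -lt0n.
set m := sample_mean y.
have my : \sum_i y i = s%:R *: m by rewrite /m /sample_mean scalerA mulfV ?scale1r.
rewrite /sample_cov -/m.
have -> : \sum_i ((y i - m) *m (y i - m)^T) = \sum_i y i *m (y i)^T - s%:R *: (m *m m^T).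
  rewrite (eq_bigr (fun i => y i *m (y i)^T + (- (y i *m m^T) + (- (m *m (y i)^T) + m *m m^T)))); last first.
    by move=> i _; rewrite linearB /= mulmxBl !mulmxBr opprB -!addrA; congr (_ + (_ + _)); rewrite addrC.
  rewrite !big_split /= !sumrN -mulmx_suml -mulmx_sumr -(linear_sum (@trmx R n 1)) /= my.
  have -> : (s%:R *: m)^T = s%:R *: m^T by rewrite linearZ.
  rewrite -scalemxAl -scalemxAr sumr_const card_ord -[(m *m m^T) *+ s]scaler_nat.
  by rewrite addNr addr0.
by rewrite scalerBr scalerA mulVf ?scale1r.
Qed.

Context (x : 'I_s -> 'cV[R]_n) (G : 'M[R]_n).
Hypothesis Gs : G^T = G.
Hypothesis s0 : (0 < s)%N.
(** Entry [j] of [G *m x] is the inner product of [row_vec j] with [x], which casts the covariance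
    of [G *m x] as products of linear forms. *)
Definition row_vec (j : 'I_n) : 'cV[R]_n := (row j G)^T.

Lemma dotc_row_vec j v : dotc (row_vec j) v = (G *m v) j 0.
Proof. by rewrite /dotc trmxK -row_mul [LHS]mxE. Qed.

Lemma dotc_row_vec2 j k : dotc (row_vec j) (row_vec k) = (G ^+ 2) j k.
Proof.
rewrite dotc_row_vec expr2 -[_ * _]/(_ *m _) !mxE; apply: eq_bigr => l _.
by rewrite -{3}Gs !mxE.
Qed.

Lemma sum_nsq_row_vec : \sum_j nsq (row_vec j) = \tr (G ^+ 2).
Proof. by apply: eq_bigr => j _; exact: dotc_row_vec2. Qed.

(** The uncentred covariance is compared with [G ^+ 2] in Frobenius norm. The subtracted outer
    product of the mean has operator norm at most its squared length, whence the second term. *)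
Lemma sample_cov_opbound (t : R) : 0 <= t ->
  let tau := \tr (G ^+ 2) in
  \sum_(p : 'I_n * 'I_n) (s%:R^-1 * \sum_i (dotc (row_vec p.1) (x i) * dotc (row_vec p.2) (x i))
      - dotc (row_vec p.1) (row_vec p.2)) ^+ 2 <= t ^+ 2 * tau ^+ 2 ->
  \sum_j (s%:R^-1 * \sum_i dotc (row_vec j) (x i)) ^+ 2 <= t ^+ 2 * tau ->
  opbound (sample_cov (fun i => G *m x i) - G ^+ 2) (t * tau + t ^+ 2 * tau).
Proof.
move=> t0 tau h1 h2.
have tau0 : 0 <= tau by rewrite /tau -sum_nsq_row_vec; apply: sumr_ge0 => j _; exact: nsq_ge0.
rewrite sample_covE // addrAC; apply: opboundB.
  apply: opbound_frobenius; first exact: mulr_ge0.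
  rewrite exprMn; apply: le_trans h1; rewrite le_eqVlt; apply/orP; left; apply/eqP.
  apply: eq_bigr => -[j k] _ /=; congr (_ ^+ 2).
  rewrite dotc_row_vec2 [LHS]mxE [X in _ + X]mxE [X in X - _]mxE summxE.
  congr (_ * _ - _); apply: eq_bigr => i _.
  by rewrite !dotc_row_vec [in LHS]mxE big_ord1 [(_^T) _ _]mxE.
apply: opbound_le (opbound_outer _).
apply: le_trans h2; rewrite /nsq dotcE; apply: ler_sum => j _.
rewrite -expr2 le_eqVlt; apply/orP; left; apply/eqP; congr (_ ^+ 2).
by rewrite /sample_mean mxE summxE; congr (_ * _); apply: eq_bigr => i _; rewrite dotc_row_vec.
Qed.

End SampleCov.

(** * Conclusion *)

Section Union.
Context {R : realType} {d} {Om : measurableType d} (P : probability Om R).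

(** Total probability over the disjoint [D i]: good indices lose a fraction [c], the others, of mass
    [b], are discarded, and [(1 - c)(1 - b) >= 1 - c - b]. *)
Lemma disjoint_union_prob (I : finType) (good : pred I) (D Bd : I -> set Om) (w : I -> R) (c : R) :
  0 <= c <= 1 -> (forall i, 0 <= w i) -> \sum_i w i = 1 ->
  (forall i, measurable (D i)) -> (forall i, measurable (Bd i)) ->
  (forall i j x, D i x -> D j x -> i = j) ->
  (forall i, P (D i) = (w i)%:E) ->
  (forall i, good i -> (P (D i `&` Bd i) <= P (D i) * c%:E)%E) ->
  ((1 - c - \sum_(i | ~~ good i) w i)%:E <=
    P (\bigcup_(i in [set i | good i]) (D i `\` Bd i)))%E.
Proof.
move=> /andP[c0 c1] w0 w1 mD mB dis PD hB.
have PU : (P (\bigcup_(i in [set i | good i]) (D i `\` Bd i)) =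
    \sum_(i | good i) P (D i `\` Bd i))%E.
  rewrite measure_fin_bigcup //.
  - rewrite (fsbigE [seq i <- index_enum I | good i]) /=.
    + rewrite big_filter_cond; apply: eq_bigl => i; case: (boolP (good i)) => gi //=.
      by rewrite mem_set.
    + by rewrite filter_uniq // index_enum_uniq.
    + by move=> i /=; rewrite mem_filter => /andP[].
    + by move=> i gi; rewrite mem_filter gi mem_index_enum.
  - exact: finite_finset.
  - by move=> i j _ _ [x [[Dx _] [Dx' _]]]; exact: dis Dx Dx'.
  - by move=> i _; exact: measurableD.
rewrite PU.
apply: (@le_trans _ _ (\sum_(i | good i) (w i * (1 - c))%:E)%E).
  rewrite sumEFin lee_fin -mulr_suml.
  move: w1; rewrite (bigID good) /= => w1.
  have b0 : 0 <= \sum_(i | ~~ good i) w i by exact: sumr_ge0.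
  set g := \sum_(i | good i) w i in w1 *; set b := \sum_(i | ~~ good i) w i in w1 b0 *.
  have : 0 <= c * b by rewrite mulr_ge0.
  nra.
apply: lee_sum => i gi.
have fD : P (D i) \is a fin_num by rewrite fin_num_measure.
rewrite measureD ?(le_lt_trans (probability_le1 P (mD i))) ?ltry //.
have := hB i gi; rewrite PD -EFinM => h.
apply: (@le_trans _ _ ((w i)%:E - (w i * c)%:E)%E); first by rewrite -EFinB lee_fin mulrBr mulr1.
apply: leeB; first by rewrite -(PD i); exact: lexx.
exact: h.
Qed.

End Union.

Lemma rate_const_gt0 (R : realType) (H : R) : 0 < H -> 0 < 24 * H + 576 * H ^+ 2.
Proof. by move=> H0; have : 0 < H ^+ 2 by [exact: exprn_gt0]; lra. Qed.

Lemma sqrt_ln_ratio_le1 (R : realType) (s : nat) : (0 < s)%N ->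
  Num.sqrt (ln s%:R / s%:R) <= 1 :> R.
Proof.
move=> s0; have sp : 0 < s%:R :> R by rewrite ltr0n.
rewrite -[leRHS]sqrtr1; apply: ler_wsqrtr.
by rewrite ler_pdivrMr // mul1r ltW // ln_sublinear.
Qed.

(** As [r <= 1], the quadratic contribution of the sample mean is at most linear in [r], with
    [576 = 24^2]. *)
Lemma rate_const_le (R : realType) (H r : R) : 0 <= r <= 1 ->
  24 * H * r + (24 * H * r) ^+ 2 <= (24 * H + 576 * H ^+ 2) * r.
Proof.
move=> /andP[r0 r1]; have r2 : r ^+ 2 <= r by rewrite expr2 -[leRHS]mulr1 ler_wpM2l.
have := ler_wpM2l (sqr_ge0 H) r2; set x := H ^+ 2 * r ^+ 2 => hx.
have -> : (24 * H * r) ^+ 2 = 576 * x by rewrite /x; ring.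
have -> : (24 * H + 576 * H ^+ 2) * r = 24 * H * r + 576 * (H ^+ 2 * r) by ring.
set y := H ^+ 2 * r in hx *; lra.
Qed.

Lemma rate_bound (R : realType) (H r tau br : R) : 0 <= H -> 0 <= r <= 1 -> 0 <= tau <= br ->
  24 * H * r * tau + (24 * H * r) ^+ 2 * tau <= (24 * H + 576 * H ^+ 2) * br * r.
Proof.
move=> H0 hr /andP[tau0 tb]; have h := rate_const_le H hr.
have -> : 24 * H * r * tau + (24 * H * r) ^+ 2 * tau = (24 * H * r + (24 * H * r) ^+ 2) * tau by ring.
have c0 : 0 <= 24 * H + 576 * H ^+ 2 by have := sqr_ge0 H; lra.
rewrite [leRHS]mulrAC; case/andP: hr => r0 _.
apply: (le_trans (ler_wpM2r tau0 h)); exact: (ler_wpM2l (mulr_ge0 c0 r0) tb).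
Qed.

Unset Implicit Arguments. Set Strict Implicit. Set Printing Implicit Defensive.
Theorem theorem5p3 :
  forall (R : realType) (c0 : R), 0 < c0 ->
  exists C : R, 0 < C /\
  forall (eps : R) (n s T : nat) (a b : R) (g : 'I_n -> 'I_2)
    (d : measure_display) (Omega : measurableType d) (P : probability Omega R)
    (A : Omega -> 'M[R]_n) (x0 : 'I_s -> Omega -> 'cV[R]_n),
  (* parameters *)
  0 < eps -> (0 < n)%N -> ~~ odd n -> (2 <= s)%N -> (1 <= T)%N ->
  0 <= b -> b < a -> a <= n%:R ->
  (* two equally-sized groups *)
  #|[pred i | g i == 0]| = n./2 ->
  let Om : 'M[R]_2 := ((a - b) / n%:R)%:M + const_mx (b / n%:R) in
  (* the model lies in M_n(eps) *)
  in_Mn_eps g Om eps ->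
  (* A: symmetric 0/1 adjacency, entries A_ij (i <= j) Bernoulli(Om_{g_i g_j}) *)
  (forall w i j, A w i j = A w j i) ->
  (forall w i j, A w i j = 0 \/ A w i j = 1) ->
  (forall i j, measurable_fun setT (fun w => A w i j)) ->
  (forall i j, P [set w | A w i j = 1] = (Om (g i) (g j))%:E) ->
  (* the initial signals are random vectors *)
  (forall i j, measurable_fun setT (fun w => x0 i w j 0)) ->
  (* joint independence of {A_ij : i <= j} and x0^(1), ..., x0^(s) *)
  indep_blocks P
    [pred k : ('I_n * 'I_n) + 'I_s |
       match k with inl p => (p.1 <= p.2)%N | inr _ => true end]
    (fun (k : ('I_n * 'I_n) + 'I_s) (j : 'I_n) w =>
       match k with inl p => A w p.1 p.2 | inr i => x0 i w j 0 end) ->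
  (* identically distributed *)
  (forall i i', same_law P (fun j w => x0 i w j 0) (fun j w => x0 i' w j 0)) ->
  (* zero mean *)
  (forall i j, P.-integrable setT (fun w => (x0 i w j 0)%:E) /\
               (\int[P]_w (x0 i w j 0)%:E = 0)%E) ->
  (* identity covariance *)
  (forall i j k, (\int[P]_w (x0 i w j 0 * x0 i w k 0)%:E = ((j == k)%:R)%:E)%E) ->
  (* sub-Gaussian *)
  (forall i (u : 'cV[R]_n),
      (psi2_norm P (fun w => (u^T *m x0 i w) ord0 ord0) < +oo)%E) ->
  (* bounded moments assumption with constant c0 *)
  (forall i (u : 'cV[R]_n),
      (c0%:E * (psi2_norm P (fun w => (u^T *m x0 i w) ord0 ord0) *
                psi2_norm P (fun w => (u^T *m x0 i w) ord0 ord0))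
       <= \int[P]_w (((u^T *m x0 i w) ord0 ord0) ^+ 2)%:E)%E) ->
  let rho := (a + b) / (2 * n%:R) in
  let Lc := exp_lap g Om in
  let M := 3 * Num.sqrt (3 * ln (4 * n%:R / eps) / delta_min g Om) in
  forall mu : seq R, eigs_by_magnitude Lc mu ->
  let Bt := C * (1 + (\sum_(1 <= i < 2) (Num.min 1 (`|mu`_i| + M)) ^+ (2 * T))
                 + (n - 2)%:R * M ^+ (2 * T))
             * Num.sqrt (ln s%:R / s%:R) in
  let Sigma w := sample_cov (fun i => (sym_normalize (A w)) ^+ T *m x0 i w) in
  exists E : set Omega, measurable E /\
    E `<=` [set w | forall lam : seq R, eigs_by_magnitude (Sigma w) lam ->
              let ahat := lam`_1 `^ (2 * T%:R)^-1 * rho * n%:R + rho * n%:R in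
              `|ahat - a| / a
                <= (2 * T%:R * M + Bt) `^ (2 * T%:R)^-1 / (mu`_1 + 1)] /\
    ((1 - 5 / s%:R - 2 * eps)%:E <= P E)%E.
Proof.
move=> R c0 c00; pose H := bconst c0; have H0 : 0 < H := bconst_gt0 c00.
(* The constant depends on [c0] alone: [24 H] pays for the covariance, [(24 H)^2] for the sample
   mean. *)
exists (24 * H + 576 * H ^+ 2); split; first exact: rate_const_gt0.
move=> eps n s T a b g d Omega P A x0 eps0 n0 neven s2 T1 b0 ba an card_g Om inM.
move=> Asym A01 mA PA mx0 ind _ meanx covx subg bmom rho Lc M mu hmu Bt Sigma.
(* For [s <= 5] or [eps >= 1/2] the claimed probability is at most 0 and the empty event suffices.
   Otherwise [4 n / eps >= 16], which exceeds [expR 2] and gives [2 <= l]. *)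
have [triv|] := boolP ((s < 6)%N || (1 / 2 <= eps)).
  exists set0; split=> //; split=> //; rewrite measure0 lee_fin.
  have sR : 0 < s%:R :> R by rewrite ltr0n; exact: leq_trans s2.
  case/orP: triv => h; last by have : 0 <= 5 / s%:R :> R by [rewrite divr_ge0]; lra.
  have : 1 <= 5 / s%:R :> R by rewrite ler_pdivlMr // mul1r ler_nat -ltnS.
  lra.
rewrite negb_or -leqNgt -ltNge => /andP[s6 eps2].
have nR : 2 <= n%:R :> R by rewrite ler_nat even_gt1.
have sR : 6 <= s%:R :> R by rewrite ler_nat.
have s0 : (0 < s)%N by exact: leq_trans s6.
have s3 : (3 <= s)%N by exact: leq_trans s6.
pose de := (a + b) / 2.
have dminE : delta_min g Om = de := delta_min_block a b n0 neven card_g.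
pose l := ln (4 * n%:R / eps).
have q0 : 0 < 4 * n%:R / eps by rewrite divr_gt0 // mulr_gt0 //; lra.
have el : expR (- l) = eps / (4 * n%:R).
  by rewrite expRN lnK ?posrE // invf_div.
have l2 : 2 <= l.
  rewrite /l -(expRK 2) ler_ln ?posrE ?expR_gt0 //.
  apply: (@le_trans _ _ (3 ^+ 2)).
    have -> : (2 : R) = 1 * 2%:R by rewrite mul1r.
    by rewrite expRM_natr; apply: lerXn2r; rewrite ?nnegrE ?expR_ge0 // expR1_le3.
  rewrite ler_pdivlMr //; lra.
have lde : 27 * l < de by move: inM; rewrite /in_Mn_eps dminE.
have de0 : 0 < de by lra.
pose q i j := Om (g i) (g j).
have qE : \matrix_(i, j) q i j = exp_adj g Om.
  by apply/matrixP => i j; rewrite mxE exp_adjE.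
have qC i j : q i j = q j i by rewrite /q !mxE eq_sym.
(* The bound by 1 is [a <= n]: within a group the entry is [(a - b)/n + b/n = a/n]. *)
have q01 i j : 0 <= q i j <= 1.
  have nR0 : 0 < n%:R :> R by lra.
  rewrite /q !mxE; case: (g i == g j); rewrite ?mulr1n ?mulr0n ?add0r.
    rewrite -mulrDl subrK divr_ge0 ?ler_pdivrMr ?mul1r //; lra.
  rewrite divr_ge0 ?ler_pdivrMr ?mul1r //; lra.
have sumq i : \sum_j q i j = de.
  apply: etrans (rowsum_exp_adj a b n0 neven card_g i); rewrite /rowsum.
  by apply: eq_bigr => j _; rewrite -qE mxE.
have [good [hgood hbad]] := laplacian_concentration qC q01 l2 lde sumq.
have ME : M = 3 * Num.sqrt (3 * l / de) by rewrite /M dminE.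
pose Lal al : 'M[R]_n := sym_normalize (adj_mx al).
have Lsym al : (Lal al)^T = Lal al by apply: sym_normalize_sym; exact: adj_mx_sym.
pose G al := Lal al ^+ T.
have Gsym al : (G al)^T = G al by exact: sym_expr.
pose u al := row_vec (G al).
pose tau al := \tr (G al ^+ 2).
pose t := 24 * H * Num.sqrt (ln s%:R / s%:R).
have t0 : 0 <= t by rewrite /t !mulr_ge0 ?sqrtr_ge0 // ltW.
pose D al := adj_event A al.
have mD al : measurable (D al) by exact: adj_event_measurable.
pose Cov al w := \sum_(p : 'I_n * 'I_n) emp_cov x0 (u al) w p.1 p.2 ^+ 2.
pose Mean al w := \sum_j emp_mean x0 (u al) w j ^+ 2.
pose B1 al := [set w | t ^+ 2 * tau al ^+ 2 < Cov al w].
pose B2 al := [set w | t ^+ 2 * tau al < Mean al w].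
have mdot al i j : measurable_fun setT (fun w => dotc (u al j) (x0 i w)).
  exact: dotc_measurable.
have mB1 al : measurable (B1 al).
  apply: measurable_gt_set; apply: measurable_sum => p; apply: measurable_funX.
  apply: measurable_funB => //; apply: measurable_funM => //.
  by apply: measurable_sum => i; exact: measurable_funM.
have mB2 al : measurable (B2 al).
  apply: measurable_gt_set; apply: measurable_sum => j; apply: measurable_funX.
  by apply: measurable_funM => //; exact: measurable_sum.
have PD al : P (D al) = (bweight (edge_prob q) al)%:E.
  exact: (adj_event_prob n0 A01 Asym mA PA mx0 ind).
have tauE al : tau al = \sum_j nsq (u al j) by rewrite sum_nsq_row_vec.
(* Covariance and mean each fail with conditional probability at most [2/s]. *)
have hB al : (P (D al `&` (B1 al `|` B2 al)) <= P (D al) * (4 / s%:R)%:E)%E.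
  have fac := adj_event_factor n0 A01 Asym mA PA mx0 ind al.
  have mxG i j := @signal_box_measurable _ _ Omega n s A x0 i j.
  have h1 := emp_cov_tail c00 mx0 covx subg bmom (mD al) mxG fac (u al) s3.
  have h2 := emp_mean_tail c00 mx0 meanx covx subg bmom (mD al) mxG fac (u al) s3.
  rewrite -tauE in h1; rewrite -tauE in h2.
  rewrite setIUr; apply: (@le_trans _ _ (P (D al `&` B1 al) + P (D al `&` B2 al))%E).
    by apply: measureU2; exact: measurableI.
  have -> : (4 / s%:R)%:E = ((2 / s%:R)%:E + (2 / s%:R)%:E)%E :> \bar R.
    by rewrite -EFinD; congr (_%:E); lra.
  rewrite ge0_muleDr ?lee_fin ?divr_ge0 //; exact: leeD.
(* Each good adjacency matrix contributes its event minus its own sampling failures. The event is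
   thus fixed before any eigenvalue list [lam] is considered. *)
exists (\bigcup_(al in [set al | good al]) (D al `\` (B1 al `|` B2 al))); split.
  apply: fin_bigcup_measurable; first exact: finite_finset.
  by move=> al _; apply: measurableD => //; exact: measurableU.
split; last first.
  have c4 : 0 <= (4 / s%:R : R) <= 1.
    by rewrite divr_ge0 //= ler_pdivrMr; lra.
  have dis al al' w : D al w -> D al' w -> al = al'.
    rewrite /D /adj_event /= => -> /matrixP E; apply/ffunP => -[[i j] ij].
    have := E i j; rewrite !mxE (_ : edge_of i j = exist _ (i, j) ij).
      by move=> /eqP; rewrite eqr_nat; case: (al _); case: (al' _).
    by apply/eqP; rewrite -val_eqE /= /ordpair ij.
  have p01 e : 0 <= edge_prob q e <= 1 by exact: q01.
  apply: le_trans (disjoint_union_prob (w := bweight (edge_prob q)) c4 _ _ mD _ dis PD _).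
  (* The losses are [4/s] from sampling and [3 n expR (- l) = (3/4) eps] from the graph, within
     [5/s + 2 eps]. *)
  - rewrite lee_fin; apply: (@le_trans _ _ (1 - 4 / s%:R - 3 * n%:R * expR (- l))); last by lra.
    rewrite el; have -> : 3 * n%:R * (eps / (4 * n%:R)) = 3 / 4 * eps.
      by field; rewrite gt_eqF //; lra.
    have : 0 <= s%:R^-1 :> R by rewrite invr_ge0.
    lra.
  - by move=> al; exact: bweight_ge0.
  - exact: bweight_sum.
  - by move=> al; exact: measurableU.
  - by move=> al _; exact: hB.
move=> w [al gal [Dw nB]] lam hlam.
have Aw : A w = adj_mx al := Dw.
have LM : opbound (Lal al - exp_lap g Om) M by rewrite ME /exp_lap -qE; exact: hgood.
have L1 : opbound (Lal al) 1.
  by apply: sym_normalize_opbound => [|i j]; [exact: adj_mx_sym|rewrite mxE].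
have Lc1 : opbound (exp_lap g Om) 1.
  apply: sym_normalize_opbound => [|i j]; rewrite -qE; last by rewrite mxE; case/andP: (q01 i j).
  by apply/matrixP => i j; rewrite !mxE.
have SE : Sigma w = sample_cov (fun i => G al *m x0 i w) by rewrite /Sigma Aw.
rewrite SE in hlam.
have c1 : Cov al w <= t ^+ 2 * tau al ^+ 2.
  by rewrite leNgt; apply/negP => h; apply: nB; left.
have c2 : Mean al w <= t ^+ 2 * tau al.
  by rewrite leNgt; apply/negP => h; apply: nB; right.
have b1 := sample_cov_opbound (Gsym al) s0 t0 c1 c2.
(* The filtered signals have conditional covariance [G al ^+ 2], which explains the exponent [2T]
   and the root of that order in the estimator. *)
have G2 : G al ^+ 2 = Lal al ^+ (2 * T) by rewrite /G -exprM mulnC.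
have mu2E := Lc_second_eig n0 neven b0 ba card_g hmu.
have mu20 := mu2_gt0 b0 ba.
set m2 := (a - b) / (a + b) in mu2E mu20.
have tauB : tau al <= 1 + Num.min 1 (m2 + M) ^+ (2 * T) + (n - 2)%:R * M ^+ (2 * T).
  rewrite /tau G2; exact: (trace_pow_le n0 neven b0 ba card_g T (Lsym al) L1 LM).
have BtE : t * tau al + t ^+ 2 * tau al <= Bt.
  rewrite /Bt big_nat1 mu2E (ger0_norm (ltW mu20)).
  set br := 1 + _ + _ in tauB *.
  set r := Num.sqrt (ln s%:R / s%:R).
  have r0 : 0 <= r by exact: sqrtr_ge0.
  have r1 : r <= 1 by exact: sqrt_ln_ratio_le1.
  have tau0 : 0 <= tau al by rewrite tauE; apply: sumr_ge0 => j _; exact: nsq_ge0.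
  by apply: rate_bound; rewrite ?(ltW H0) ?r0 ?tau0.
(* This spectral error is added to the sampling error [Bt] to give the perturbation bound for the
   second eigenvalue. *)
have b2 := opboundXB (2 * T) L1 Lc1 LM.
have b3 : opbound (sample_cov (fun i => G al *m x0 i w) - exp_lap g Om ^+ (2 * T)) (2 * T%:R * M + Bt).
  rewrite G2 in b1; have b12 := opboundD b1 b2; rewrite addrA subrK in b12.
  have e2 : (2 * T)%:R * M = 2 * T%:R * M by rewrite natrM.
  by apply: opbound_le b12; rewrite e2 [leRHS]addrC -G2; exact: (lerD BtE (lexx _)).
have [l0 hl] := second_eig_perturb n0 neven b0 ba card_g (sample_cov_sym _) (sample_cov_psd _) b3 hlam.
rewrite mu2E; exact: (relative_error n0 b0 ba T1 l0 hl).
Qed.
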